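(* Suppose that $\mu$ is basic and that the cooling map $\tau$ satisfies $\lim_{k\to\infty}(\tau(k)-\tau(k-1))=\infty$. Then, for $\mu^{\mathbb{N}}$-a.e. $\Omega$, the sequence $(X_n/n)_{n\in\mathbb{N}}$ under $P_0^{\Omega,\tau}$ satisfies the large deviation principle on $\mathbb{R}$ with rate $n$ and with rate function $\mathcal{I}=\mathcal{I}_\mu$, the same rate function as the one in the quenched large deviation principle for the displacement $(Z_n/n)_{n\in\mathbb{N}}$ of the random walk in the static random environment with law $\mu$.
   Context: Notation: $\mathbb{N}=\{1,2,\dots\}$, $\mathbb{N}_0=\mathbb{N}\cup\{0\}$. Basic law. Let $\alpha$ be a probability distribution on $(0,1)$ and $\mu=\alpha^{\mathbb{Z}}$, so that under $\mu$ the environment $\omega=(\omega(x))_{x\in\mathbb{Z}}$ is i.i.d. with marginal $\alpha$. Write $\rho=(1-\omega(0))/\omega(0)$. Such a $\mu$ is called basic if (i) (uniform ellipticity) the support of $\alpha$ is contained in $[\mathfrak{c},1-\mathfrak{c}]$ for some $\mathfrak{c}>0$; and (ii) (nestedness) $\rho_{\min}<1<\rho_{\max}$, where $\rho_{\min},\rho_{\max}$ are the minimum and maximum of $\rho$ over the support of $\alpha$. Large deviation principle. Probability measures $(P_n)_{n\in\mathbb{N}}$ on the Borel sets of a topological space $\mathcal{S}$ satisfy the LDP with rate $n$ and rate function $I:\mathcal{S}\to[0,\infty]$ if $I$ has compact level sets, $I\not\equiv\infty$, $\liminf_{n}\frac1n\log P_n(\mathcal{O})\ge-\inf_{x\in\mathcal{O}}I(x)$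 for all open $\mathcal{O}$, and $\limsup_n\frac1n\log P_n(\mathcal{C})\le-\inf_{x\in\mathcal{C}}I(x)$ for all closed $\mathcal{C}$. A sequence of random variables satisfies the LDP if their laws do. Static model. Given $\omega$, $Z=(Z_n)_{n\in\mathbb{N}_0}$ is the Markov chain on $\mathbb{Z}$ jumping from $x$ to $x+1$ with probability $\omega(x)$ and to $x-1$ with probability $1-\omega(x)$; $P_0^\omega$ is its law when $Z_0=0$. It is known (Greven and den Hollander) that if $\mu$ is basic, then there is a convex deterministic rate function $\mathcal{I}=\mathcal{I}_\mu$ on $\mathbb{R}$ such that, for $\mu$-a.e. $\omega$, $(Z_n/n)_{n\in\mathbb{N}}$ under $P_0^\omega$ satisfies the LDP with rate $n$ and rate function $\mathcal{I}$. This determines $\mathcal{I}$ uniquely. Random walk in cooling random environment. A cooling map is a strictly increasing function $\tau:\mathbb{N}_0\to\mathbb{N}_0$ with $\tau(0)=0$. Let $\Omega=(\omega_k)_{k\in\mathbb{N}}$ be i.i.d. environments with law $\mu$, i.e. $\Omega$ has law $\mu^{\mathbb{N}}$. For $n\in\mathbb{N}_0$ let $\ell(n)=\inf\{k:\tau(k)>n\}$. Given $(\Omega,\tau)$, $X=(X_n)_{n\in\mathbb{N}_0}$ is the (time-inhomogeneous) Markov chain on $\mathbb{Z}$ with $$P^{\Omega,\tau}(X_{n+1}=x+1\mid X_n=x)=\omega_{\ell(n)}(x),\qquad P^{\Omega,\tau}(X_{n+1}=x-1\mid X_n=x)=1-\omega_{\ell(n)}(x).$$ $P_0^{\Omega,\tau}$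 denotes its (quenched) law when $X_0=0$. *)

(* Defs.v *)
From HB Require Import structures.
From mathcomp Require Import all_boot all_order all_algebra.
From mathcomp Require Import all_classical all_reals all_analysis.
From mathcomp Require Import measurable_realfun ring lra.

Set Implicit Arguments.
Unset Strict Implicit.
Unset Printing Implicit Defensive.

Import Order.TTheory GRing.Theory Num.Theory.
Import numFieldNormedType.Exports.

Local Open Scope classical_set_scope.
Local Open Scope ring_scope.

HB.instance Definition _ := isPointed.Build int 0.
HB.instance Definition _ := @isMeasurable.Build default_measure_display
  int discrete_measurable discrete_measurable0
  discrete_measurableC discrete_measurableU.

(* Product sigma-algebra on [I -> T], and product measures over an arbitrary
   index type: by the pi-lambda theorem [is_product_law a P] characterizes
   [P] as [a^I]. *)
Definition cylinders (I : Type) (d : measure_display) (T : measurableType d) :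
  set (set (I -> T)) :=
  [set C | exists i A, measurable A /\ C = [set f | A (f i)]].

Definition fspace (I : Type) (d : measure_display) (T : measurableType d) :=
  g_sigma_algebraType (@cylinders I d T).

Definition is_product_law (R : realType) (I : choiceType) (d : measure_display)
    (T : measurableType d) (a : probability T R)
    (P : probability (fspace I T) R) : Prop :=
  forall (s : seq I) (A : I -> set T), uniq s -> (forall i, measurable (A i)) ->
    P [set f | forall i, i \in s -> A i (f i)]
    = (\big[*%E/1%E]_(i <- s) a (A i))%E.

Definition env (R : realType) := fspace int (measurableTypeR R).

Definition env_seq (R : realType) := fspace nat (env R).

Definition traj := fspace nat int.

Definition msupport (R : realType) (alpha : probability (measurableTypeR R) R) :
  set R :=
  [set x | forall U : set R, open U -> U x -> (0 < alpha U)%E].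

Definition rho (R : realType) (p : R) : R := (1 - p) / p.

Definition uniformly_elliptic (R : realType)
    (alpha : probability (measurableTypeR R) R) : Prop :=
  exists2 c : R, 0 < c & msupport alpha `<=` `[c, 1 - c]%classic.

(* Under uniform ellipticity the support is compact and [rho] is continuous on
   it, so this infimum and supremum are a minimum and a maximum. *)
Definition nested (R : realType)
    (alpha : probability (measurableTypeR R) R) : Prop :=
  inf [set rho p | p in msupport alpha] < 1
  < sup [set rho p | p in msupport alpha].

Definition basic (R : realType)
    (alpha : probability (measurableTypeR R) R) : Prop :=
  [/\ alpha `]0, 1[%classic = 1%E, uniformly_elliptic alpha & nested alpha].

(* The value of the sequence at [n = 0] is irrelevant. *)
Record LDP (R : realType) (P : nat -> probability (measurableTypeR R) R)
    (I : R -> \bar R) : Prop := {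
  ldp_ge0 : forall x, (0 <= I x)%E ;
  ldp_compact : forall a : R, compact [set x | (I x <= a%:E)%E] ;
  ldp_proper : exists x, I x != +oo%E ;
  ldp_lower : forall O : set R, open O ->
    (- ereal_inf [set I x | x in O]
     <= limn_einf (fun n => (n%:R^-1)%:E * lne (P n O)))%E ;
  ldp_upper : forall C : set R, closed C ->
    (limn_esup (fun n => (n%:R^-1)%:E * lne (P n C))
     <= - ereal_inf [set I x | x in C])%E
}.

Definition econvex (R : realType) (I : R -> \bar R) : Prop :=
  forall x y t : R, 0 <= t <= 1 ->
    (I (t * x + (1 - t) * y)%R <= t%:E * I x + (1 - t)%R%:E * I y)%E.

(* [p n x] is the probability of a step from [x] to [x + 1] at time [n]. *)
Definition step_prob (R : realType) (p : nat -> int -> R) (n : nat)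
    (x y : int) : R :=
  if y == x + 1 then p n x else if y == x - 1 then 1 - p n x else 0.

(* [Q] is the law on trajectories of the nearest-neighbour Markov chain started
   at 0 with these (possibly time-dependent) transition probabilities; the
   cylinder probabilities determine [Q]. *)
Definition walk_law (R : realType) (p : nat -> int -> R)
    (Q : probability traj R) : Prop :=
  forall (n : nat) (x : nat -> int),
    Q [set X | forall i, (i <= n)%N -> X i = x i]
    = ((x 0%N == 0)%:R * \prod_(i < n) step_prob p i (x i) (x i.+1))%:E.

Lemma measurable_coord (I : Type) (d : measure_display) (T : measurableType d)
  (i : I) : measurable_fun setT (fun f : fspace I T => (f i : T)).
Proof.
by move=> _ B mB; rewrite setTI; apply: sub_sigma_algebra; exists i, B.
Qed.

Lemma measurable_from_int (d : measure_display) (T : measurableType d)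
  (f : int -> T) : measurable_fun setT f.
Proof. by []. Qed.

(* [walk_law] is not vacuous: the chain is realized on ([0, 1], Lebesgue). *)
Section walk_law_exists.
Context (R : realType) (p : nat -> int -> R).
Hypothesis p01 : forall n x, 0 <= p n x <= 1.

(* Position after [n] steps driven by [u], with the left end and the length of
   the interval of those [u] in [0, 1[ that produce the same first steps. *)
Fixpoint coded_walk (n : nat) (u : R) : int * R * R :=
  if n is n'.+1 then
    let: (x, a, l) := coded_walk n' u in
    let m := a + l * p n' x in
    if u < m then (x + 1, a, l * p n' x) else (x - 1, m, l * (1 - p n' x))
  else (0, 0, 1).

Let pos n u := (coded_walk n u).1.1.
Let lft n u := (coded_walk n u).1.2.
Let len n u := (coded_walk n u).2.
Let mid n u := lft n u + len n u * p n (pos n u).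

Let stepE n u :
  [/\ pos n.+1 u = (if u < mid n u then pos n u + 1 else pos n u - 1),
      lft n.+1 u = (if u < mid n u then lft n u else mid n u) &
      len n.+1 u = (if u < mid n u then len n u * p n (pos n u)
                    else len n u * (1 - p n (pos n u)))].
Proof.
rewrite /mid /pos /lft /len /=; case: (coded_walk n u) => [[x a] l] /=.
by case: ifP.
Qed.

Let measurable_coded n : [/\ measurable_fun setT (pos n),
  measurable_fun setT (lft n) & measurable_fun setT (len n)].
Proof.
elim: n => [|n [mx ma ml]]; first by split; exact: measurable_cst.
have mp (g : int -> R) : measurable_fun setT (fun u => g (pos n u)).
  exact: (measurableT_comp (@measurable_from_int _ (measurableTypeR R) g) mx).
have mi (g : int -> int) : measurable_fun setT (fun u => g (pos n u)).
  exact: (measurableT_comp (@measurable_from_int _ int g) mx).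
have mm : measurable_fun setT (mid n).
  by apply: measurable_funD => //; apply: measurable_funM => //; exact: mp.
have mt : measurable_fun setT (fun u : R => u < mid n u).
  exact: measurable_fun_ltr.
split.
- rewrite (_ : pos n.+1 = fun u : R =>
    if u < mid n u then pos n u + 1 else pos n u - 1).
    by apply: measurable_fun_ifT => //; [exact: mi (fun z => z + 1)|
                                         exact: mi (fun z => z - 1)].
  by apply/funext => u; case: (stepE n u).
- rewrite (_ : lft n.+1 = fun u : R => if u < mid n u then lft n u else mid n u).
    exact: measurable_fun_ifT.
  by apply/funext => u; case: (stepE n u).
- rewrite (_ : len n.+1 = fun u : R => if u < mid n u then len n u * p n (pos n u)
                    else len n u * (1 - p n (pos n u))).
    apply: measurable_fun_ifT => //; apply: measurable_funM => //.
    exact: (mp (fun z => 1 - p n z)).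
  by apply/funext => u; case: (stepE n u).
Qed.

Let wt n (x : nat -> int) : R :=
  (x 0%N == 0)%:R * \prod_(i < n) step_prob p i (x i) (x i.+1).

Let coded_prefix n (x : nat -> int) : exists a,
  [/\ 0 <= a, 0 <= wt n x, a + wt n x <= 1 &
    forall u, 0 <= u < 1 ->
      ((forall i, (i <= n)%N -> pos i u = x i) <-> a <= u < a + wt n x) /\
      ((forall i, (i <= n)%N -> pos i u = x i) ->
        lft n u = a /\ len n u = wt n x)].
Proof.
elim: n => [|n [a [a0 w0 aw1 H]]].
  exists 0; rewrite /wt big_ord0 mulr1 add0r; split=> //; first by case: eqP.
  move=> u /andP[u0 u1]; have [x0|/eqP x0] := eqVneq (x 0%N) 0.
    rewrite mulr1n u0 u1; split; last by [].
    by split=> // _ [|i] // _; rewrite x0.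
  have F : ~ (forall i, (i <= 0)%N -> pos i u = x i).
    by move=> /(_ 0%N (leqnn _)) /esym.
  split; last by move/F.
  by split; [move/F | rewrite mulr0n => /andP[? ?]; lra].
have wS : wt n.+1 x = wt n x * step_prob p n (x n) (x n.+1).
  by rewrite /wt big_ord_recr /= mulrA.
have prefS u : (forall i, (i <= n.+1)%N -> pos i u = x i) <->
    (forall i, (i <= n)%N -> pos i u = x i) /\ pos n.+1 u = x n.+1.
  split=> [h|[h h'] i]; first by split=> [i /leqW/h|]; last exact: h.
  by rewrite leq_eqVlt => /predU1P[->|/h].
have /andP[p0 p1] := p01 n (x n).
set q := p n (x n) in p0 p1 *.
have wq : 0 <= wt n x * q by exact: mulr_ge0.
have wq' : 0 <= wt n x * (1 - q) by apply: mulr_ge0 => //; lra.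
have wqD : wt n x * (1 - q) = wt n x - wt n x * q by ring.
have xne : x n + 1 <> x n - 1 by move=> /addrI.
have key u : (forall i, (i <= n)%N -> pos i u = x i) -> 0 <= u < 1 ->
  [/\ pos n.+1 u = (if u < a + wt n x * q then x n + 1 else x n - 1),
      lft n.+1 u = (if u < a + wt n x * q then a else a + wt n x * q) &
      len n.+1 u = (if u < a + wt n x * q then wt n x * q
                    else wt n x * (1 - q))].
  move=> h u01; have [_ /(_ h)[<- <-]] := H u u01.
  by rewrite /q -(h n (leqnn n)); exact: stepE.
rewrite wS /step_prob -/q.
have [y1|/eqP y1] := eqVneq (x n.+1) (x n + 1).
  exists a; split=> //; first lra.
  move=> u u01; have [E _] := H u u01; split.
    rewrite prefS; split=> [[h]|/andP[h1 h2]].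
      have [-> _ _] := key u h u01; move: (h) => /E/andP[-> _] /=.
      by case: ifP => // _; rewrite y1 => /esym.
    have h : forall i, (i <= n)%N -> pos i u = x i by apply/E; lra.
    by split=> //; have [-> _ _] := key u h u01; rewrite h2.
  rewrite prefS => -[h]; have [-> -> ->] := key u h u01.
  by case: ifP => // _; rewrite y1 => /esym.
have [y2|/eqP y2] := eqVneq (x n.+1) (x n - 1).
  exists (a + wt n x * q); split=> //; [lra|lra|].
  move=> u u01; have [E _] := H u u01; split.
    rewrite prefS; split=> [[h]|/andP[h1 h2]].
      have [-> _ _] := key u h u01; move: (h) => /E/andP[h1 h2].
      case: ltP => [_ /esym//|h3 _].
      by apply/andP; split=> //; lra.
    have h : forall i, (i <= n)%N -> pos i u = x i by apply/E; lra.
    by split=> //; have [-> _ _] := key u h u01; rewrite ltNge h1.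
  rewrite prefS => -[h]; have [-> -> ->] := key u h u01.
  by case: ifP => // _ /esym.
exists a; rewrite mulr0 addr0; split=> //; first lra.
move=> u u01.
have F : ~ (forall i, (i <= n.+1)%N -> pos i u = x i).
  rewrite prefS => -[h]; have [-> _ _] := key u h u01.
  by case: ifP => _ /esym.
split; last by move/F.
by split; [move/F | move=> /andP[? ?]; lra].
Qed.

Let code (u : measurableTypeR R) : traj := pos ^~ u.

Let measurable_code : measurable_fun setT code.
Proof.
apply: (@measurability _ _ _ _ setT code (@cylinders nat _ int)) => //.
move=> _ [_ [i [A [mA ->]]] <-].
by have [mx _ _] := measurable_coded i; exact: mx.
Qed.

HB.instance Definition _ :=
  isMeasurableFun.Build _ _ (measurableTypeR R) traj code measurable_code.

Lemma walk_law_exists : exists Q : probability traj R, walk_law p Q.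
Proof.
exists (distribution (uniform_prob (@ltr01 R)) code) => n x.
have [a [a0 w0 aw1 H]] := coded_prefix n x.
rewrite -/(wt n x) /distribution /= /pushforward.
set B := (_ @^-1` _).
have mB : measurable B.
  rewrite (_ : B = \bigcap_(i in [set i | (i <= n)%N]) pos i @^-1` [set x i]).
    apply: bigcap_measurable => [|i _]; first by exists 0%N.
    have [mx _ _] := measurable_coded i.
    by rewrite -[X in measurable X]setTI; exact: mx.
  by apply/seteqP; split=> u h i; exact: h.
rewrite /uniform_prob integral_uniform_pdf.
rewrite (eq_integral (fun=> 1%E)); last first.
  move=> u; rewrite inE => -[_] /=; rewrite in_itv/= /uniform_pdf => ->.
  by rewrite subr0 invr1.
rewrite integral_cst ?mul1e; last exact: measurableI.
have Iw : lebesgue_measure (`[a, a + wt n x[ : set R) = (wt n x)%:E.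
  rewrite lebesgue_measure_itv/= lte_fin ltrDl; case: ltP => [_|w].
    by rewrite -EFinB addrAC subrr add0r.
  by congr EFin; apply/esym/le_anti; rewrite w.
apply/le_anti/andP; split.
  apply: (@le_trans _ _
      (lebesgue_measure ((`[a, a + wt n x[ : set R) `|` [set 1]))).
    apply: le_measure; rewrite ?inE//.
    - exact: measurableI.
    - exact: measurableU.
    move=> u [Bu] /=; rewrite in_itv/= => /andP[u0 u1].
    have [->|un1] := eqVneq u 1; [by right|left].
    rewrite /= in_itv/=; apply: (H u _).1.1; last exact: Bu.
    by rewrite u0 lt_neqAle un1.
  rewrite -Iw -[leRHS]adde0 -(lebesgue_measure_set1 (1 : R)).
  exact: measureU2.
rewrite -Iw; apply: le_measure; rewrite ?inE//; first exact: measurableI.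
move=> u /=; rewrite in_itv/= => /andP[u0 u1].
have u01 : 0 <= u < 1 by apply/andP; split; lra.
split; last by rewrite in_itv/=; lra.
by apply: (H u u01).1.2; apply/andP.
Qed.

End walk_law_exists.

Definition speed (R : realType) (n : nat) (X : traj) : measurableTypeR R :=
  (X n)%:~R / n%:R.

Lemma measurable_speed (R : realType) (n : nat) :
  measurable_fun setT (@speed R n).
Proof.
exact: (measurableT_comp
  (@measurable_from_int _ (measurableTypeR R) (fun z => z%:~R / n%:R))
  (@measurable_coord nat _ int n)).
Qed.

HB.instance Definition _ (R : realType) (n : nat) :=
  isMeasurableFun.Build _ _ traj (measurableTypeR R) (@speed R n)
    (@measurable_speed R n).

Definition walk_LDP (R : realType) (p : nat -> int -> R) (I : R -> \bar R) :
  Prop :=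
  forall Q : probability traj R, walk_law p Q ->
    LDP (fun n => distribution Q (@speed R n)) I.

(* This LDP determines [I]; the convexity is part of the theorem of Greven and
   den Hollander that produces it. *)
Definition static_rate_function (R : realType) (mu : probability (env R) R)
    (I : R -> \bar R) : Prop :=
  econvex I /\ {ae mu, forall w : env R, walk_LDP (fun _ => w) I}.

Definition cooling_map (tau : nat -> nat) : Prop :=
  tau 0%N = 0%N /\ {homo tau : m n / (m < n)%N}.

(* The least [k] with [n < tau k]: for a cooling map [n < tau n.+1]. *)
Definition ell (tau : nat -> nat) (n : nat) : nat :=
  find (fun k => n < tau k)%N (iota 0 n.+2).

Lemma ellP (tau : nat -> nat) (n : nat) : cooling_map tau ->
  (n < tau (ell tau n))%N /\ (forall k, (n < tau k)%N -> (ell tau n <= k)%N).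
Proof.
move=> [_ tauS].
have le_tau k : (k <= tau k)%N.
  by elim: k => // k IH; exact: leq_ltn_trans IH (tauS _ _ (ltnSn k)).
have hs : has (fun k => n < tau k)%N (iota 0 n.+2).
  by apply/hasP; exists n.+1; [rewrite mem_iota/= ltnSn|exact: le_tau].
have lt_ell : (ell tau n < n.+2)%N by move: hs; rewrite has_find size_iota.
split; first by have := nth_find 0%N hs; rewrite -/(ell tau n) nth_iota.
move=> k nk; rewrite leqNgt; apply/negP => k_lt.
have := before_find 0%N k_lt.
by rewrite nth_iota ?add0n ?nk// (ltn_trans k_lt).
Qed.

(* The environments omega_1, omega_2, ... are stored as [Om 0], [Om 1], ...;
   [ell tau n >= 1] because [tau 0 = 0]. *)
Definition cooling_prob (R : realType) (Om : env_seq R) (tau : nat -> nat)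
    (n : nat) (x : int) : R :=
  (Om (ell tau n).-1 : env R) x.

(* Main.v *)
(* Reflecting all environments exchanges left and right, so it suffices to bound
   probabilities of speeds in [0, oo).  Both drifts occur in the environment, hence
   long traps have positive probability; this gives I(0) = 0 and, by convexity,
   I is nondecreasing on [0, oo).

   The static bounds hold from a random time on, which is not uniform over the
   infinitely many blocks of the cooling walk.  They are therefore turned into moment
   bounds valid for all times.

   Upper bound at v > 0: let u -> s u - r be a line below I with s v - r close to I(v),
   and let r' > r.  The quenched transforms of the passage times from x to x + 1, at
   exponent - r', multiply up to a function h of the position along which the walk
   grows like exp(r' n).  If the growth rate of h were at most s, this would contradict
   the static upper bound.  Regularized to a finite range of dependence, log h is a sum
   of weakly dependent terms, so for a small t > 0, all times T and all y,
   the integral of (exp(s y) P(Z_T = y))^t is at most exp(t r' T).  Since t <= 1,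
   (a + b)^t <= a^t + b^t, and these bounds multiply over independent blocks, up to
   factors polynomial in the block lengths, which are subexponential as the lengths
   tend to infinity.  Markov's inequality and Borel-Cantelli conclude.

   Lower bound at 0 < v < 1, for a > I(v): by repeating a good block of the static
   walk there are t > 0 and targets Y_T near v T for which the integral of
   P(Z_T = Y_T)^(-t) is at most C exp(t a T).  Forcing the cooling walk through such
   targets at the resampling times, these bounds multiply over the blocks as well. *)

From HB Require Import structures.
Require Import Defs.
From mathcomp Require Import all_boot all_order all_algebra.
From mathcomp Require Import all_classical all_reals all_analysis.
From mathcomp Require Import measurable_realfun zify ring lra.

Set Implicit Arguments.
Unset Strict Implicit.
Unset Printing Implicit Defensive.

Import Order.TTheory GRing.Theory Num.Theory.
Import numFieldNormedType.Exports.

Local Open Scope classical_set_scope.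
Local Open Scope ring_scope.

(** * Product laws *)

(** The obstacle is that the mean of [P(Z_T = y)] over environments sees the annealed rate, which
    can be smaller than the quenched one. A moment of small order [t] restores the quenched
    exponent: for a sum of bounded, weakly dependent terms of negative mean, the linear term of
    [exp (t * S)] beats the quadratic one, so its moment stays at most 1 for any number of terms.
    Hence every comparison is first made strict ([s < lam], [a1 < a], [a < I v]). For the lower
    bound the exponent is [- t], so that rare bad environments cannot spoil it; ellipticity keeps
    the negative powers bounded.

    Each block starts at a site that depends on the earlier ones, so the bounds are needed for all
    durations and all displacements; shift invariance then removes the starting site. Diverging
    block lengths mean that only o(n) blocks are seen up to time [n], so a constant factor per block
    is harmless.

    The truncation of the passage transforms is one-sided: the truncated [h] is an exact
    supersolution, hence no error accumulates in the moment bound, and the truncation error enters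
    only the proof of [s < lam]. *)

Section product_laws.
Context (R : realType) (d : measure_display) (T : measurableType d).
Context (I : choiceType) (a : probability T R).

Definition fcylinder (s : seq I) (A : I -> set T) : set (fspace I T) :=
  [set f | forall i, i \in s -> A i (f i)].

Lemma measurable_fcylinder s A : (forall i, measurable (A i)) ->
  measurable (fcylinder s A).
Proof.
move=> mA; rewrite (_ : fcylinder s A =
    \big[setI/setT]_(i <- s) [set f : fspace I T | A i (f i)]).
  apply: bigsetI_measurable => i _.
  by have := @measurable_coord I d T i measurableT _ (mA i); rewrite setTI.
rewrite -bigcap_seq; apply/seteqP; split=> f h i; exact: h.
Qed.

Lemma product_law_unique (P P' : probability (fspace I T) R) :
  is_product_law a P -> is_product_law a P' ->
  forall B, measurable B -> P B = P' B.
Proof.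
move=> aP aP' B mB.
(* Cylinders over finitely many coordinates are stable under intersection, unlike the one-coordinate
   cylinders that define the sigma-algebra. *)
pose G : set (set (fspace I T)) := [set C | exists s A,
  [/\ uniq s, (forall i, measurable (A i)) & C = fcylinder s A]].
have GT : G setT.
  by exists [::], (fun=> setT); split=> //; apply/seteqP; split.
have mG : @measurable _ (fspace I T) = <<s G >>.
  apply/seteqP; split; apply: smallest_sub.
  - exact: smallest_sigma_algebra.
  - move=> _ [i [A [mA ->]]]; apply: sub_sigma_algebra.
    exists [:: i], (fun=> A); split=> //; apply/seteqP; split=> f /=.
      by move=> Af j; rewrite inE => /eqP ->.
    by move=> /(_ i); apply; rewrite inE.
  - exact: sigma_algebra_measurable.
  - by move=> _ [s [A [_ mA ->]]]; exact: measurable_fcylinder.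
apply: (@measure_unique _ _ _ G (fun=> setT)) => //.
- move=> _ _ [s [A [us mA ->]]] [s' [A' [us' mA' ->]]].
  exists (undup (s ++ s')), (fun i => (if i \in s then A i else setT) `&`
                              (if i \in s' then A' i else setT)).
  split; first exact: undup_uniq.
    by move=> i; apply: measurableI; case: ifP.
  apply/seteqP; split=> f /=.
    move=> [h h'] i _; split.
      by case: ifP => // /h.
    by case: ifP => // /h'.
  move=> h; split=> i is_ /=.
    have [|] := h i; first by rewrite mem_undup mem_cat is_.
    by rewrite is_.
  have [|_] := h i; first by rewrite mem_undup mem_cat is_ orbT.
  by rewrite is_.
- by apply/seteqP; split=> // f _; exists 0%N.
- by move=> _ [s [A [us mA ->]]]; exact: etrans (aP _ _ us mA) (esym (aP' _ _ us mA)).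
- by move=> _; apply: (@le_lt_trans _ _ 1%E); [exact: probability_le1|exact: ltry].
Qed.

Lemma product_law_coord (P : probability (fspace I T) R) i A :
  is_product_law a P -> measurable A -> P [set f | A (f i)] = a A.
Proof.
move=> aP mA; have := aP [:: i] (fun=> A) isT (fun=> mA).
rewrite big_seq1 => <-; congr (P _); apply/seteqP; split=> f /=.
  by move=> Af j; rewrite inE => /eqP ->.
by move=> /(_ i); apply; rewrite inE.
Qed.

Lemma measurable_to_fspace d' (S : measurableType d') (F : S -> fspace I T) :
  (forall i, measurable_fun setT (fun x => (F x i : T))) ->
  measurable_fun setT F.
Proof.
move=> mF; apply: (@measurability _ _ _ _ setT F (@cylinders I d T)) => //.
by move=> _ [_ [i [A [mA ->]]] <-]; exact: mF.
Qed.

End product_laws.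

Lemma product_law_map (R : realType) d d' (T : measurableType d)
    (T' : measurableType d') (I I' : choiceType) (a : probability T R)
    (a' : probability T' R) (P : probability (fspace I T) R)
    (P' : probability (fspace I' T') R)
    (f : T -> T') (s : I' -> I) (s' : I -> I') :
  is_product_law a P -> cancel s s' -> measurable_fun setT f ->
  (forall A, measurable A -> a' A = a (f @^-1` A)) ->
  (forall A, measurable A ->
     P' A = P [set w | A (fun i => f (w (s i)))]) ->
  is_product_law a' P'.
Proof.
move=> aP ss' mf a'E P'E r A ur mA.
rewrite P'E; last exact: measurable_fcylinder.
have mfA i : measurable (f @^-1` A i) by rewrite -[X in measurable X]setTI; exact: mf.
have := aP (map s r) (fun j => f @^-1` A (s' j)).
rewrite map_inj_uniq; last exact: can_inj ss'.
move=> /(_ ur (fun j => mfA _)); rewrite big_map => E.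
transitivity (\big[*%E/1%E]_(j <- r) a (f @^-1` A (s' (s j)))); last first.
  by apply: eq_bigr => i _; rewrite ss' a'E.
rewrite -E; congr (P _); apply/seteqP; split=> w /=.
  by move=> h j /mapP[i ir ->]; rewrite ss'; exact: h.
by move=> h i ir; have := h (s i) (map_f s ir); rewrite /= ss'.
Qed.

Definition depends_on (I T U : Type) (J : pred I) (f : (I -> T) -> U) :=
  forall w w', (forall i, J i -> w i = w' i) -> f w = f w'.

Section independence.
Context (R : realType) (d : measure_display) (T : measurableType d).
Context (I : choiceType) (a : probability T R) (P : probability (fspace I T) R).
Hypothesis aP : is_product_law a P.
Variable J : pred I.

(** Replacing the coordinates outside [J] by those of an independent copy preserves the product law.
    After this, [f] reads only the first copy and [g] only the second, so independence becomes
    Tonelli's theorem on [P \x P]. *)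
Let splice (u : fspace I T * fspace I T) : fspace I T :=
  fun i => if J i then u.1 i else u.2 i.

Let measurable_splice : measurable_fun setT splice.
Proof.
apply: measurable_to_fspace => i; rewrite /splice.
by case: (J i); apply: (measurableT_comp (@measurable_coord I d T i)).
Qed.

HB.instance Definition _ := isMeasurableFun.Build _ _ _ _ splice measurable_splice.

Let splice_law : is_product_law a (distribution (P \x P)%E splice).
Proof.
move=> s A us mA; rewrite /distribution /= /pushforward.
pose A1 i := if J i then A i else setT.
pose A2 i := if J i then setT else A i.
have mA1 i : measurable (A1 i) by rewrite /A1; case: ifP.
have mA2 i : measurable (A2 i) by rewrite /A2; case: ifP.
rewrite (_ : _ @^-1` _ = fcylinder s A1 `*` fcylinder s A2); last first.
  apply/seteqP; split=> -[f g] /=.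
    move=> h; split=> i is_; have := h i is_; rewrite /splice /A1 /A2 /=;
    by case: (J i).
  move=> [h h'] i is_; have := h i is_; have := h' i is_.
  by rewrite /splice /A1 /A2 /=; case: (J i).
transitivity (P (fcylinder s A1) * P (fcylinder s A2))%E.
  by apply: product_measure1E; exact: measurable_fcylinder.
rewrite /fcylinder !aP// -big_split/=; apply: eq_bigr => i _.
by rewrite /A1 /A2; case: (J i); rewrite probability_setT ?mule1 ?mul1e.
Qed.

Lemma product_law_indep (f g : fspace I T -> R) :
  measurable_fun setT f -> measurable_fun setT g ->
  (forall w, 0 <= f w) -> (forall w, 0 <= g w) ->
  depends_on J f -> depends_on (predC J) g ->
  (\int[P]_w (f w * g w)%:E = \int[P]_w (f w)%:E * \int[P]_w (g w)%:E)%E.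
Proof.
move=> mf mg f0 g0 fJ gJ.
have mfg : measurable_fun setT (fun w => (f w * g w)%:E).
  by apply/measurable_EFinP; exact: measurable_funM.
rewrite (@eq_measure_integral _ _ _ _ (distribution (P \x P)%E splice)); last first.
  by move=> A mA _; apply: (product_law_unique aP splice_law).
rewrite ge0_integral_pushforward//; last first.
  by move=> w _; rewrite lee_fin mulr_ge0.
have mE1 : measurable_fun setT (EFin \o f) by exact/measurable_EFinP.
have mE2 : measurable_fun setT (EFin \o g) by exact/measurable_EFinP.
rewrite preimage_setT (eq_integral (fun u => (EFin \o f) u.1 * (EFin \o g) u.2)%E);
  last first.
  move=> u _ /=; rewrite EFinM; congr (EFin _ * EFin _)%E.
    by apply: fJ => i Ji; rewrite /splice Ji.
  by apply: gJ => i /= /negbTE Ji; rewrite /splice Ji.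
rewrite fubini_tonelli1/=; last 2 first.
- apply: emeasurable_funM.
    exact: (measurableT_comp mE1 measurable_fst).
  exact: (measurableT_comp mE2 measurable_snd).
- by move=> u; rewrite mule_ge0// lee_fin.
rewrite /fubini_F /=.
have g0E w : (0 <= (g w)%:E)%E by rewrite lee_fin.
have f0E w : (0 <= (f w)%:E)%E by rewrite lee_fin.
under eq_integral do rewrite ge0_integralZl//.
rewrite muleC -ge0_integralZl//; last exact: integral_ge0.
by apply: eq_integral => w _; rewrite muleC.
Qed.

End independence.

(** * Products of weakly dependent functionals *)

Section eventually_small.
Context (R : realType) (d : measure_display) (T : measurableType d).
Variable P : probability T R.

Lemma markov_ge0 (f : T -> R) (e : R) : measurable_fun setT f ->
  (forall w, 0 <= f w) -> 0 < e ->
  (e%:E * P [set w | (e <= f w)%R] <= \int[P]_w (f w)%:E)%E.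
Proof.
move=> mf f0 e0.
have := @le_integral_comp_abse _ T R P setT measurableT (EFin \o f) e id.
rewrite setTI (eq_integral (EFin \o f)); last first.
  by move=> w _ /=; rewrite ger0_norm.
rewrite (_ : [set x | _] = [set w | (e <= f w)%R]).
  by apply=> //; exact/measurable_EFinP.
by apply/seteqP; split=> w /=; rewrite lee_fin ger0_norm.
Qed.

(** Markov's inequality at level 1 gives summable probabilities, and the limsup set is null by
    Borel-Cantelli. It takes the place of an ergodic theorem for the costs and yields both cooling
    bounds. *)
Lemma ae_eventually_le1 (f : nat -> T -> R) (C e : R) :
  (forall n, measurable_fun setT (f n)) -> (forall n w, 0 <= f n w) -> 0 < e ->
  (forall n, (\int[P]_w (f n w)%:E <= (C * expR (- (e * n%:R)))%:E)%E) ->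
  {ae P, forall w, \forall n \near \oo, f n w <= 1}.
Proof.
move=> mf f0 e0 fC.
pose F n := [set w | (1 <= f n w)%R].
have mF n : measurable (F n).
  by rewrite -[X in measurable X]setTI; exact: measurable_fun_ler.
have FC n : (P (F n) <= (C * expR (- (e * n%:R)))%:E)%E.
  by have := le_trans (markov_ge0 (mf n) (f0 n) ltr01) (fC n); rewrite mul1e.
have C0 : 0 <= C.
  by have := le_trans (measure_ge0 _ _) (FC 0%N); rewrite lee_fin mulr0 oppr0 expR0 mulr1.
have z0 : 0 < expR (- e) by exact: expR_gt0.
have z1 : `|expR (- e)| < 1 by rewrite gtr0_norm// expR_lt1; lra.
have S : (\sum_(n <oo) P (F n) < +oo)%E.
  apply: (@le_lt_trans _ _ (C * (1 - expR (- e))^-1)%:E); last exact: ltry.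
  apply: lime_le; first by apply: is_cvg_nneseries => *; exact: measure_ge0.
  apply: nearW => n.
  apply: (@le_trans _ _ (series (geometric C (expR (- e))) n)%:E).
    rewrite /series/= -sumEFin; apply: lee_sum => i _.
    apply: (le_trans (FC i)); rewrite lee_fin /= -expRM_natl.
    by rewrite mulrN [i%:R * e]mulrC.
  by rewrite lee_fin geometric_le_lim.
have F0 := lim_sup_set_cvg0 mF S.
exists (lim_sup_set F); split=> //.
  by apply: bigcap_measurable => // k _; exact: bigcup_measurable.
move=> w; apply: contra_notP => /existsNP[k]; rewrite not_implyP => -[_ kF].
exists k => // n kn; rewrite leNgt; apply/negP => fn; apply: kF.
by exists n => //; exact: ltW.
Qed.

End eventually_small.

Section dependent_products.
Context (R : realType) (d : measure_display) (T : measurableType d).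
Context (I : choiceType) (a : probability T R) (P : probability (fspace I T) R).
Hypothesis aP : is_product_law a P.

Lemma integral_prod_le1 (F : nat -> fspace I T -> R) (J : nat -> pred I)
    (r : seq nat) : uniq r ->
  (forall i, measurable_fun setT (F i)) -> (forall i w, 0 <= F i w) ->
  (forall i, depends_on (J i) (F i)) ->
  (forall i j x, i \in r -> j \in r -> i != j -> ~~ (J i x && J j x)) ->
  (forall i, (\int[P]_w (F i w)%:E <= 1)%E) ->
  (\int[P]_w (\prod_(i <- r) F i w)%:E <= 1)%E.
Proof.
move=> ur mF F0 FJ JJ F1; elim: r ur JJ => [_ _|i r IH /= /andP[ir ur] JJ].
  under eq_integral do rewrite big_nil.
  by rewrite integral_cst//= mul1e probability_le1.
have p0 w : 0 <= \prod_(j <- r) F j w by apply: prodr_ge0 => *.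
have mp : measurable_fun setT (fun w => \prod_(j <- r) F j w).
  by apply: measurable_prod => *.
under eq_integral do rewrite big_cons.
rewrite (@product_law_indep _ _ _ _ _ _ aP (J i))//.
- rewrite -[leRHS]mule1; apply: lee_pmul => //.
  + by apply: integral_ge0 => w _; rewrite lee_fin.
  + by apply: integral_ge0 => w _; rewrite lee_fin.
  + by apply: IH => // k l x kr lr; apply: JJ; rewrite inE ?kr ?lr orbT.
- move=> w w' ww'; apply: eq_big_seq => j jr; apply: FJ => x Jjx; apply: ww'.
  apply/negP => Jix; have := JJ i j x; rewrite !inE eqxx jr orbT Jix Jjx.
  move=> /(_ isT isT); rewrite negb_and orbF; case: eqVneq => [ij|_ /(_ isT)//].
  by rewrite -ij (negbTE ir) in jr.
Qed.

(** Jensen's inequality from the tangent of the exponential at the mean [m]: the linear corrections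
    [x c - m] sum to zero. *)
Lemma expR_mean_le (M : nat) (x : 'I_M -> R) : (0 < M)%N ->
  expR (M%:R^-1 * \sum_c x c) <= M%:R^-1 * \sum_c expR (x c).
Proof.
move=> M0; set m := _ * _.
have M0' : 0 < M%:R :> R by rewrite ltr0n.
have xE : \sum_c x c = M%:R * m by rewrite mulVKf// lt0r_neq0.
rewrite -ler_pdivrMl ?invr_gt0// invrK.
apply: (@le_trans _ _ (\sum_c (expR m * (1 + (x c - m))))).
  rewrite -mulr_sumr big_split/= sumrB xE !sumr_const card_ord.
  by rewrite -[m *+ M]mulr_natl subrr addr0 mulrC.
apply: ler_sum => c _; rewrite -{2}(subrK m (x c)) expRD mulrC.
by rewrite ler_wpM2r ?expR_ge0// expR_ge1Dx.
Qed.

(* Within a residue class modulo [M] the terms are independent; Jensen's inequality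
   handles the average over the classes. *)
Lemma integral_exp_dependent_sum (g : nat -> fspace I T -> R) (J : nat -> pred I)
    (M N : nat) : (0 < M)%N ->
  (forall i, measurable_fun setT (g i)) ->
  (forall i, depends_on (J i) (g i)) ->
  (forall i j x, (i + M <= j)%N -> ~~ (J i x && J j x)) ->
  (forall i, (\int[P]_w (expR (M%:R * g i w))%:E <= 1)%E) ->
  (\int[P]_w (expR (\sum_(i < N) g i w))%:E <= 1)%E.
Proof.
move=> M0 mg gJ JJ g1.
have M0' : 0 < M%:R :> R by rewrite ltr0n.
pose r (c : 'I_M) := [seq i <- iota 0 N | (i %% M == c)%N].
have mE i : measurable_fun setT (fun w => expR (M%:R * g i w)).
  by apply: measurableT_comp => //; exact: measurable_funM.
have mp c : measurable_fun setT (fun w => \prod_(i <- r c) expR (M%:R * g i w)).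
  by apply: measurable_prod => *.
have p0 c w : 0 <= \prod_(i <- r c) expR (M%:R * g i w).
  by apply: prodr_ge0 => *; exact: expR_ge0.
apply: (@le_trans _ _ (\int[P]_w
    (M%:R^-1 * \sum_(c < M) \prod_(i <- r c) expR (M%:R * g i w))%:E)%E).
  apply: ge0_le_integral => //.
  - apply/measurable_EFinP; apply: measurableT_comp => //.
    by apply: measurable_sum => *.
  - apply/measurable_EFinP; apply: measurable_funM => //.
    by apply: measurable_sum => *.
  move=> w _; rewrite lee_fin.
  rewrite (_ : \sum_(i < N) g i w =
      M%:R^-1 * \sum_(c < M) \sum_(i <- r c) M%:R * g i w); last first.
    rewrite -(big_mkord xpredT (fun i => g i w)) /index_iota subn0.
    rewrite (partition_big (fun i => Ordinal (ltn_pmod i M0)) xpredT)//=.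
    rewrite mulr_sumr; apply: eq_bigr => c _.
    rewrite -mulr_sumr mulrA mulVf ?mul1r ?lt0r_neq0//.
    by rewrite /r big_filter; apply: eq_bigl => i; rewrite -val_eqE.
  apply: le_trans (expR_mean_le _ M0) _.
  rewrite ler_wpM2l ?invr_ge0//; apply: ler_sum => c _.
  by rewrite expR_sum.
under eq_integral do rewrite EFinM -sumEFin.
have mpE c : measurable_fun setT (fun w => (\prod_(i <- r c) expR (M%:R * g i w))%:E).
  exact/measurable_EFinP.
have p0E c w : (0 <= (\prod_(i <- r c) expR (M%:R * g i w))%:E)%E by rewrite lee_fin.
rewrite ge0_integralZl ?lee_fin ?invr_ge0//.
all: try by [apply: emeasurable_sum|move=> w _; exact: sume_ge0].
rewrite ge0_integral_sum//.
apply: (@le_trans _ _ ((M%:R^-1)%:E * \sum_(c < M) 1)%E).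
  rewrite lee_wpmul2l ?lee_fin ?invr_ge0//; apply: lee_sum => c _.
  apply: (@integral_prod_le1 _ J) => //.
  - by rewrite filter_uniq ?iota_uniq.
  - by move=> i w w' /gJ ->.
  - move=> i j x; rewrite !mem_filter => /andP[/eqP ic _] /andP[/eqP jc _].
    have far k l : (k %% M = c)%N -> (l %% M = c)%N -> (k < l)%N -> (k + M <= l)%N.
      move=> kc lc; rewrite (divn_eq k M) (divn_eq l M) kc lc ltn_add2r ltn_mul2r.
      by rewrite M0/= addnAC leq_add2r -mulSnr leq_mul2r => ->; rewrite orbT.
    rewrite neq_lt => /orP[ij|ji]; first exact/JJ/far.
    by rewrite andbC; exact/JJ/far.
rewrite sumEFin sumr_const card_ord -EFinM lee_fin.
by rewrite mulVf// lt0r_neq0.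
Qed.

End dependent_products.

(** * Expectations of nearest-neighbour walks *)

Section chain.
Context (R : realType).
Implicit Types (p : nat -> int -> R) (f g : int -> R) (x y z : int).

(* [ev p s n f x] is the expectation of [f] after [n] steps, for the chain
   started from [x] at time [s]. *)
Fixpoint ev p (s n : nat) f x : R :=
  if n is m.+1 then
    p s x * ev p s.+1 m f (x + 1) + (1 - p s x) * ev p s.+1 m f (x - 1)
  else f x.

Lemma ev_add p s n m f x : ev p s (n + m) f x = ev p s n (ev p (s + n) m f) x.
Proof.
elim: n s x => [|n IH] s x; first by rewrite addn0.
by rewrite addSn /= !IH addSnnS.
Qed.

(** Steps have length one, so after [t] steps only sites within distance [t] of the start have been
    read. This is the origin of every finite range of dependence below, apart from that of
    [passage]. *)
Lemma ev_congr p p' s s' n f x :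
  (forall t y, (t < n)%N -> `|y - x| <= t%:Z -> p (s + t)%N y = p' (s' + t)%N y) ->
  ev p s n f x = ev p' s' n f x.
Proof.
elim: n s s' x => //= n IH s s' x pp'.
have <- : p s x = p' s' x.
  by have := pp' 0%N x isT; rewrite !addn0; apply; rewrite subrr.
rewrite !(IH s.+1 s'.+1)// => t y tn yx; rewrite !addSnnS; apply: pp' => //.
  by move: yx; lia.
by move: yx; lia.
Qed.

Lemma evD p s n f g x :
  ev p s n (fun y => f y + g y) x = ev p s n f x + ev p s n g x.
Proof. by elim: n s x => //= n IH s x; rewrite !IH; ring. Qed.

Lemma evZ p s n k f x : ev p s n (fun y => k * f y) x = k * ev p s n f x.
Proof. by elim: n s x => //= n IH s x; rewrite !IH; ring. Qed.

Lemma ev_cst p s n k x : ev p s n (fun=> k) x = k.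
Proof. by elim: n s x => //= n IH s x; rewrite !IH; ring. Qed.

Lemma ev_sum p s n (J : Type) (r : seq J) (F : J -> int -> R) x :
  ev p s n (fun y => \sum_(z <- r) F z y) x = \sum_(z <- r) ev p s n (F z) x.
Proof.
elim: r => [|z r IH].
  rewrite big_nil -[RHS](ev_cst p s n 0 x); congr ev.
  by apply/funext => y; rewrite big_nil.
rewrite big_cons -IH -evD; congr ev; apply/funext => y.
by rewrite big_cons.
Qed.

Lemma ev_translate p s n f x z :
  ev p s n f (x + z) = ev (fun t y => p t (y + z)) s n (fun y => f (y + z)) x.
Proof. by elim: n s x => //= n IH s x; rewrite -!IH addrAC [x - 1 + z]addrAC. Qed.

Lemma ev_reflect p s n f x :
  ev p s n f (- x) = ev (fun t y => 1 - p t (- y)) s n (fun y => f (- y)) x.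
Proof.
elim: n s x => //= n IH s x; rewrite -!IH !opprD opprK.
by rewrite addrC; congr (_ * _ + _); ring.
Qed.

Section sub_stochastic.
Variable p : nat -> int -> R.
Hypothesis p01 : forall t x, 0 <= p t x <= 1.

(** The comparison is asked only at the reachable sites: [a] steps up and [b] steps down with
    [a + b = n]. This keeps the parity constraint and the bound [n] on the displacement available to
    the callers. *)
Lemma ev_le s n f g x :
  (forall a b, (a + b)%N = n -> f (x + a%:Z - b%:Z) <= g (x + a%:Z - b%:Z)) ->
  ev p s n f x <= ev p s n g x.
Proof.
elim: n s x => [|n IH] s x fg /=; first by have := fg 0%N 0%N erefl; rewrite addr0 subr0.
have /andP[p0 p1] := p01 s x.
apply: lerD; apply: ler_wpM2l; rewrite ?subr_ge0//; apply: IH => a b abn.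
  have := fg a.+1 b; rewrite addSn abn => /(_ erefl).
  by rewrite (_ : x + a.+1%:Z - b%:Z = x + 1 + a%:Z - b%:Z)//; lia.
have := fg a b.+1; rewrite addnS abn => /(_ erefl).
by rewrite (_ : x + a%:Z - b.+1%:Z = x - 1 + a%:Z - b%:Z)//; lia.
Qed.

Lemma ev_eq s n f g x :
  (forall a b, (a + b)%N = n -> f (x + a%:Z - b%:Z) = g (x + a%:Z - b%:Z)) ->
  ev p s n f x = ev p s n g x.
Proof.
by move=> fg; apply/le_anti/andP; split; apply: ev_le => a b /fg ->.
Qed.

Lemma ev_ge0 s n f x : (forall y, 0 <= f y) -> 0 <= ev p s n f x.
Proof. by move=> f0; rewrite -(ev_cst p s n 0 x); apply: ev_le. Qed.

Lemma ev_indic_le1 s n (A : set int) x : ev p s n \1_A x <= 1.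
Proof.
rewrite -[leRHS](ev_cst p s n 1 x); apply: ev_le => a b _.
by rewrite indicE lern1 leq_b1.
Qed.

(** A one-step supersolution with factor [K] loses at most that factor at each step; [ev_sub] is the
    converse for subsolutions. *)
Lemma ev_super s n f (K : R) x : 0 <= K ->
  (forall t y, p t y * f (y + 1) + (1 - p t y) * f (y - 1) <= K * f y) ->
  ev p s n f x <= K ^+ n * f x.
Proof.
move=> K0 fK; elim: n s x => [|n IH] s x /=; first by rewrite expr0 mul1r.
have /andP[p0 p1] := p01 s x.
apply: (@le_trans _ _ (p s x * (K ^+ n * f (x + 1)) +
                       (1 - p s x) * (K ^+ n * f (x - 1)))).
  by apply: lerD; apply: ler_wpM2l; rewrite ?subr_ge0.
rewrite mulrCA [X in _ + X]mulrCA -mulrDr exprSr -mulrA ler_wpM2l//.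
exact: exprn_ge0.
Qed.

Lemma ev_sub s n f (K : R) x : 0 <= K ->
  (forall t y, K * f y <= p t y * f (y + 1) + (1 - p t y) * f (y - 1)) ->
  K ^+ n * f x <= ev p s n f x.
Proof.
move=> K0 fK; elim: n s x => [|n IH] s x /=; first by rewrite expr0 mul1r.
have /andP[p0 p1] := p01 s x.
apply: (@le_trans _ _ (p s x * (K ^+ n * f (x + 1)) +
                       (1 - p s x) * (K ^+ n * f (x - 1)))); last first.
  by apply: lerD; apply: ler_wpM2l; rewrite ?subr_ge0.
rewrite mulrCA [X in _ <= _ + X]mulrCA -mulrDr exprSr -mulrA ler_wpM2l//.
exact: exprn_ge0.
Qed.

Lemma ev_ge_at s n f x y : (forall z, 0 <= f z) ->
  ev p s n \1_[set y] x * f y <= ev p s n f x.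
Proof.
move=> f0; rewrite mulrC -evZ; apply: ev_le => a b _; rewrite indicE.
set z := x + _ - _; have [|_] := boolP (z \in _); last by rewrite mulr0.
by rewrite inE /= => ->; rewrite mulr1.
Qed.

Lemma ev_elliptic (c : R) s a b x : 0 <= c ->
  (forall t y, c <= p t y <= 1 - c) ->
  c ^+ (a + b) <= ev p s (a + b) \1_[set x + a%:Z - b%:Z] x.
Proof.
move=> c0 pc.
have step t y f (q : R) : (forall z, 0 <= f z) -> 0 <= q ->
    q <= f (y + 1) -> c * q <= p t y * f (y + 1) + (1 - p t y) * f (y - 1).
  move=> f0 q0 qf; have /andP[p1 p2] := pc t y; have /andP[p3 p4] := p01 t y.
  rewrite -[leLHS]addr0; apply: lerD; first exact: ler_pM.
  by rewrite mulr_ge0// subr_ge0.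
have step' t y f (q : R) : (forall z, 0 <= f z) -> 0 <= q ->
    q <= f (y - 1) -> c * q <= p t y * f (y + 1) + (1 - p t y) * f (y - 1).
  move=> f0 q0 qf; have /andP[p1 p2] := pc t y; have /andP[p3 p4] := p01 t y.
  rewrite -[leLHS]add0r; apply: lerD; first by rewrite mulr_ge0// subr_ge0.
  by apply: ler_pM => //; lra.
have i0 t n y A : 0 <= ev p t n \1_A y by apply: ev_ge0 => z; rewrite indicE.
elim: a s x => [|a IH] s x.
  rewrite add0n addr0; elim: b s x => [|b IH] s x.
    by rewrite /= subr0 indicE mem_set.
  rewrite exprS /=; apply: step'; [by move=> z|exact: exprn_ge0|].
  by rewrite (_ : x - b.+1%:Z = x - 1 - b%:Z)//; lia.
rewrite addSn exprS /=; apply: step; [by move=> z|exact: exprn_ge0|].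
by rewrite (_ : x + a.+1%:Z - b%:Z = x + 1 + a%:Z - b%:Z)//; lia.
Qed.

Definition disps (n : nat) : seq int := [seq i%:Z - n%:Z | i <- iota 0 n.*2.+1].

Lemma mem_disps n z : (z \in disps n) = (`|z| <= n%:Z).
Proof.
apply/mapP/idP => [[i]|zn]; first by rewrite mem_iota => + ->; lia.
exists (absz (z + n%:Z)); first by rewrite mem_iota; lia.
by lia.
Qed.

Lemma uniq_disps n : uniq (disps n).
Proof. by rewrite map_inj_uniq ?iota_uniq// => i j; lia. Qed.

Lemma size_disps n : size (disps n) = n.*2.+1.
Proof. by rewrite size_map size_iota. Qed.

(** Displacements of the wrong parity are listed too, with weight zero. A fixed list of [2n + 1]
    terms is what allows a fractional power to be distributed over the end points. *)
Lemma ev_disps s n f x :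
  ev p s n f x = \sum_(z <- disps n) ev p s n \1_[set x + z] x * f (x + z).
Proof.
rewrite (eq_bigr (fun z => ev p s n (fun y => f (x + z) * \1_[set x + z] y) x));
  last by move=> z _; rewrite evZ mulrC.
rewrite -ev_sum; apply: ev_eq => a b abn.
have E : x + a%:Z - b%:Z = x + (a%:Z - b%:Z) by rewrite addrA.
rewrite E (bigD1_seq (a%:Z - b%:Z)) ?uniq_disps//=; last by rewrite mem_disps; lia.
rewrite indicE mem_set// mulr1 big1 ?addr0// => z zab.
rewrite indicE memNset ?mulr0// => /= /addrI abz.
by rewrite abz eqxx in zab.
Qed.

End sub_stochastic.

Lemma measurable_ev d (T : measurableType d) (p : T -> nat -> int -> R) s n f x :
  (forall t y, measurable_fun setT (fun u => p u t y)) ->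
  measurable_fun setT (fun u => ev (p u) s n f x).
Proof.
move=> mp; elim: n s x => [|n IH] s x /=; first exact: measurable_cst.
by apply: measurable_funD; apply: measurable_funM => //; exact: measurable_funB.
Qed.

End chain.

(** * Trajectory laws and iterated one-step averages *)

Section walk_law_ev.
Context (R : realType) (p : nat -> int -> R) (Q : probability traj R).
Hypothesis pQ : walk_law p Q.

Let path (k : nat) (x : nat -> int) : set traj :=
  [set X | forall i, (i <= k)%N -> X i = x i].

Let measurable_at i (A : set int) : measurable [set X : traj | A (X i)].
Proof.
by have := @measurable_coord nat _ int i measurableT A; rewrite setTI; exact.
Qed.

Let measurable_path k x : measurable (path k x).
Proof.
rewrite (_ : path k x = \bigcap_(i in [set i | (i <= k)%N]) [set X : traj | [set x i] (X i)]).
  by apply: bigcap_measurable => [|i _]; [exists 0%N|exact: measurable_at].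
by apply/seteqP; split=> u h i; exact: h.
Qed.

Let extend k (x : nat -> int) (y : int) : nat -> int :=
  fun i => if (i <= k)%N then x i else y.

Let path_extend k x y :
  path k.+1 (extend k x y) = path k x `&` [set X | X k.+1 = y].
Proof.
apply/seteqP; split=> X /=.
  move=> h; split=> [i ik|]; last by rewrite h// /extend ltnn.
  by rewrite h ?leqW// /extend ik.
move=> [h h'] i; rewrite /extend leq_eqVlt => /predU1P[->|ik].
  by rewrite ltnn.
by rewrite -ltnS ik; exact: h.
Qed.

Let law_extend k x y :
  Q (path k.+1 (extend k x y)) = (Q (path k x) * (step_prob p k (x k) y)%:E)%E.
Proof.
rewrite /path !pQ -EFinM big_ord_recr /= !mulrA; congr (_ * _)%:E; last first.
  by rewrite /extend leqnn ltnn.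
congr (_ * _).
by apply: eq_bigr => i _; rewrite /extend (ltnW (ltn_ord i)) (ltn_ord i).
Qed.

(** The Markov property. [walk_law] only prescribes the probability of prefixes, so the prefix of
    length [k] is split by its next step, and the induction applies to the two extended prefixes. *)
Let law_path_ev n k x (A : set int) :
  Q (path k x `&` [set X | A (X (k + n)%N)]) =
  (Q (path k x) * (ev p k n \1_A (x k))%:E)%E.
Proof.
elim: n k x => [|n IH] k x /=.
  rewrite addn0 indicE; case: (asboolP (A (x k))) => Ax.
    rewrite mem_set// mule1; congr (Q _); apply/seteqP; split=> X; first by case.
    by move=> h; split=> //=; rewrite h.
  rewrite memNset// mule0 -(measure0 Q); congr (Q _).
  by apply/seteqP; split=> X //= [h]; rewrite h.
pose up := path k.+1 (extend k x (x k + 1)).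
pose dn := path k.+1 (extend k x (x k - 1)).
have mup : measurable up by exact: measurable_path.
have mdn : measurable dn by exact: measurable_path.
have mpk : measurable (path k x) by exact: measurable_path.
have ne : x k - 1 <> x k + 1 by lia.
have Qup : Q up = (Q (path k x) * (p k (x k))%:E)%E.
  by rewrite law_extend /step_prob eqxx.
have Qdn : Q dn = (Q (path k x) * (1 - p k (x k))%:E)%E.
  by rewrite law_extend /step_prob eqxx; case: eqP.
have updn0 : up `&` dn = set0.
  by apply/seteqP; split=> X //=; rewrite /up /dn !path_extend /= => -[[_ ->] [_ /esym]].
have subup : up `<=` path k x by rewrite /up path_extend => X [].
have subdn : dn `<=` path k x by rewrite /dn path_extend => X [].
(* Jumps other than to a neighbour are not excluded pointwise; they are null because the two
   admissible steps already exhaust the mass of the prefix. *)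
have QD : Q (path k x `\` (up `|` dn)) = 0%E.
  have Qoo : (Q (path k x) < +oo)%E.
    by apply: (@le_lt_trans _ _ 1%E); [exact: probability_le1|exact: ltry].
  have -> : Q (path k x `\` (up `|` dn)) =
      (Q (path k x) - Q (path k x `&` (up `|` dn)))%E.
    by apply: measureD => //; exact: measurableU.
  have -> : path k x `&` (up `|` dn) = up `|` dn.
    by rewrite setIidr// => X [/subup|/subdn].
  have -> : Q (up `|` dn) = (Q up + Q dn)%E by exact: measureU.
  rewrite Qup Qdn /path pQ -!EFinM; congr EFin; ring.
set B := [set X : traj | A (X (k + n.+1)%N)].
have mB : measurable B by exact: measurable_at.
have -> : path k x `&` B = ((up `&` B) `|` (dn `&` B)) `|`
    ((path k x `\` (up `|` dn)) `&` B).
  apply/seteqP; split=> X /=.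
    move=> [h hB]; have [hu|hu] := pselect (up X); first by left; left.
    have [hd|hd] := pselect (dn X); first by left; right.
    by right; split=> //; split=> //; case.
  by move=> [[[/subup]|[/subdn]]|[[]]].
have mD : measurable (path k x `\` (up `|` dn)).
  by apply: measurableD => //; exact: measurableU.
rewrite measureU0; [|by do ?apply: measurableU; exact: measurableI|
  exact: measurableI|]; last first.
  by apply: (subset_measure0 _ mD _ QD) => //; exact: measurableI.
transitivity (Q (up `&` B) + Q (dn `&` B))%E.
  apply: measureU; [exact: measurableI|exact: measurableI|].
  by rewrite setIACA updn0 set0I.
have Bu : Q (up `&` B) = (Q up * (ev p k.+1 n \1_A (x k + 1))%:E)%E.
  by rewrite /B -addSnnS /up IH /extend ltnn.
have Bd : Q (dn `&` B) = (Q dn * (ev p k.+1 n \1_A (x k - 1))%:E)%E.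
  by rewrite /B -addSnnS /dn IH /extend ltnn.
by rewrite Bu Bd Qup Qdn /path pQ -!EFinM; congr EFin; ring.
Qed.

Lemma walk_law_ev n (A : set int) :
  Q [set X | A (X n)] = (ev p 0 n \1_A 0)%:E.
Proof.
have := law_path_ev n 0 (fun=> 0) A; rewrite add0n.
have -> : path 0 (fun=> 0) `&` [set X | A (X n)] =
    [set X | A (X n)] `\` ([set X | A (X n)] `\` path 0 (fun=> 0)).
  by rewrite setDD setIC.
have p1 : Q (path 0 (fun=> 0)) = 1%E by rewrite /path pQ eqxx big_ord0 mulr1.
have mp0 : measurable (path 0 (fun=> 0)) by exact: measurable_path.
have pC : Q (~` path 0 (fun=> 0)) = 0%E.
  by rewrite probability_setC//; rewrite p1 subee.
have p0 : Q ([set X | A (X n)] `\` path 0 (fun=> 0)) = 0%E.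
  apply: (subset_measure0 _ _ _ pC) => [||X []//].
    by apply: measurableD => //; exact: measurable_at.
  exact: measurableC.
rewrite p1 mul1e => <-; rewrite setDD.
have mA : measurable [set X : traj | A (X n)] by exact: measurable_at.
set S := [set X | A (X n)] in mA p0 *; set S0 := path _ _ in mp0 p0 *.
transitivity (Q (S `\` S0) + Q (S `&` S0))%E; last by rewrite p0 add0e.
exact: measureDI.
Qed.

End walk_law_ev.

(** * Regularized passage-time transforms *)

Section passage_factors.
Context (R : realType) (q c : R).
Hypotheses (q0 : 0 < q) (q1 : q < 1) (c0 : 0 < c).

(** The solution [u] of [u = q * (v + (1 - v) * t * u)], a decomposition at the first step: either
    the walk moves to the right at once, or it moves to the left and must first return (transform
    [t]) and then cross (transform [u]). *)
Definition passage_map (v t : R) : R := q * v / (1 - q * (1 - v) * t).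

(* With [q = e^-r], a regularization at depth [m] of
   E_x[exp(- r * (first hitting time of x + 1))]. *)
Fixpoint passage (w : int -> R) (m : nat) (x : int) : R :=
  if m is k.+1 then passage_map (w x) (passage w k (x - 1)) else q.

Lemma passage_map_den v t : c <= v <= 1 - c -> 0 <= t <= q ->
  0 < 1 - q * (1 - v) * t <= 1.
Proof.
have [hq0 hq1 hc0] := And3 q0 q1 c0.
move=> /andP[v0 v1] /andP[t0 tq].
have qv : 0 <= q * (1 - v) by apply: mulr_ge0; lra.
have qvt : q * (1 - v) * t <= q * (1 - v) * 1 by apply: ler_wpM2l => //; lra.
have qv1 : q * (1 - v) <= 1 * (1 - v) by apply: ler_wpM2r; lra.
by have := mulr_ge0 qv t0; lra.
Qed.

Lemma passage_map_bounds v t : c <= v <= 1 - c -> 0 <= t <= q ->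
  q * c <= passage_map v t <= q.
Proof.
have [hq0 hq1 hc0] := And3 q0 q1 c0.
move=> vc tq; have /andP[D0 D1] := passage_map_den vc tq.
move: vc tq => /andP[v0 v1] /andP[t0 tq].
rewrite /passage_map; set D := 1 - _ in D0 D1 *.
rewrite ler_pdivlMr// ler_pdivrMr//; apply/andP; split.
  by rewrite -(mulrA q) ler_pM2l// (le_trans _ v0)// ler_piMr// ltW.
rewrite ler_pM2l// /D.
have qt1 : q * t <= 1 by rewrite -[leRHS]mulr1; apply: ler_pM; lra.
have : (1 - v) * (q * t) <= (1 - v) * 1 by apply: ler_wpM2l => //; lra.
lra.
Qed.

Section environment.
Variable w : int -> R.
Hypothesis wc : forall x, c <= w x <= 1 - c.

Lemma passage_bounds m x : q * c <= passage w m x <= q.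
Proof.
have [hq0 hq1 hc0] := And3 q0 q1 c0.
elim: m x => [|m IH] x /=.
  have := wc 0; rewrite lexx andbT => ?.
  by rewrite -[leRHS]mulr1 ler_pM2l//; lra.
apply: passage_map_bounds => //.
have /andP[h ->] := IH (x - 1); rewrite andbT.
by apply: le_trans h; rewrite mulr_ge0// ltW.
Qed.

Lemma passage_ge0 m x : 0 <= passage w m x <= q.
Proof.
have /andP[h ->] := passage_bounds m x; rewrite andbT.
by apply: le_trans h; rewrite mulr_ge0// ltW.
Qed.

Lemma passage_gt0 m x : 0 < passage w m x.
Proof.
have /andP[h _] := passage_bounds m x.
by apply: lt_le_trans h; rewrite mulr_gt0.
Qed.

(** The initial value [q] is the largest value of the map (and its value at drift 1, as if the walk
    were reflected at [x - m]), and the map is increasing in [t]; hence the iterates decrease with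
    the depth. *)
Lemma passage_mono m x : passage w m.+1 x <= passage w m x.
Proof.
have [hq0 hq1 hc0] := And3 q0 q1 c0.
elim: m x => [|m IH] x.
  by have /andP[] := passage_bounds 1 x.
have /andP[D0 _] := passage_map_den (wc x) (passage_ge0 m.+1 (x - 1)).
have /andP[D0' _] := passage_map_den (wc x) (passage_ge0 m (x - 1)).
rewrite [leLHS]/= [leRHS]/= -!/(passage w _.+1 _).
rewrite /passage_map -/(passage w m.+1 _).
have /andP[v0 v1] := wc x.
apply: ler_wpM2l; first by rewrite mulr_ge0//; lra.
rewrite lef_pV2 ?posrE// lerD2l lerN2; apply: ler_wpM2l => //.
by rewrite mulr_ge0//; lra.
Qed.

(* The passage map contracts (t - t') / (t' * (1 - q * t)) by the factor q ^ 2. *)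
Lemma passage_contract m x :
  passage w m x - passage w m.+1 x <=
  (c * (1 - q ^+ 2))^-1 * q ^+ (2 * m) *
  (passage w m.+1 x * (1 - q * passage w m x)).
Proof.
have [hq0 hq1 hc0] := And3 q0 q1 c0.
set K := (c * _)^-1.
have q21 : 0 < 1 - q ^+ 2 by rewrite subr_gt0 exprn_ilt1// ltW.
have K0 : 0 < K by rewrite invr_gt0 mulr_gt0.
elim: m x => [|m IH] x.
  (* The constant [K] is made for this case: the left side is at most [q], and
     [q * c <= passage w 1 x] turns the right side into at least [q]. *)
  rewrite muln0 expr0 mulr1.
  have /andP[v0 v1] := wc x.
  have /andP[D0 D1] := passage_map_den (wc x) (passage_ge0 0 (x - 1)).
  have h : q * c <= passage w 1 x by have /andP[] := passage_bounds 1 x.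
  apply: (@le_trans _ _ q); first by rewrite lerBlDr lerDl ltW// passage_gt0.
  rewrite [passage w 0 x]/= -expr2 /K invfM mulrCA mulrA -mulrA mulrVK; last first.
    by rewrite unitfE lt0r_neq0.
  by rewrite ler_pdivlMr.
set t := passage w m (x - 1); set t' := passage w m.+1 (x - 1).
have /andP[t0 tq] : 0 <= t <= q := passage_ge0 m (x - 1).
have /andP[t0' tq'] : 0 <= t' <= q := passage_ge0 m.+1 (x - 1).
have IH' : t - t' <= K * q ^+ (2 * m) * (t' * (1 - q * t)) := IH (x - 1).
have /andP[v0 v1] := wc x.
have /andP[D0 _] := passage_map_den (wc x) (passage_ge0 m (x - 1)).
have /andP[D0' _] := passage_map_den (wc x) (passage_ge0 m.+1 (x - 1)).
rewrite -/t -/t' in D0 D0'.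
have E1 : passage w m.+1 x = q * w x / (1 - q * (1 - w x) * t) by [].
have E2 : passage w m.+2 x = q * w x / (1 - q * (1 - w x) * t') by [].
rewrite E1 E2; set v := w x in D0 D0' v0 v1 *.
set D := 1 - _ * t in D0 *; set D' := 1 - _ * t' in D0' *.
have -> : q * v / D - q * v / D' = q * v / (D * D') * (q * (1 - v) * (t - t')).
  by rewrite /D /D'; field; rewrite !lt0r_neq0.
have -> : q * v / D' * (1 - q * (q * v / D)) =
    q * v / (D * D') * (D - q ^+ 2 * v).
  by field; rewrite !lt0r_neq0.
rewrite [leRHS]mulrCA; apply: ler_wpM2l.
  by rewrite divr_ge0 ?mulr_ge0 ?ltW//; lra.
have qt1 : 0 <= 1 - q * t.
  have : q * t <= 1 * 1 by apply: ler_pM; lra.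
  lra.
(* The difference of the two sides is exactly [v * (1 - q ^+ 2)]. Of the two factors [q] gained, one
   is visible in the difference of the images and the other is the bound [t' <= q]. *)
have B : (1 - v) * (1 - q * t) <= D - q ^+ 2 * v.
  have : 0 <= v * (1 - q ^+ 2) by apply: mulr_ge0; lra.
  by rewrite /D; lra.
have Kq : 0 <= K * q ^+ (2 * m) by rewrite mulr_ge0 ?exprn_ge0// ltW.
apply: (@le_trans _ _ (K * q ^+ (2 * m.+1) * ((1 - v) * (1 - q * t)))); last first.
  by apply: ler_wpM2l => //; rewrite mulr_ge0 ?exprn_ge0// ltW.
apply: (@le_trans _ _ (q * (1 - v) * (K * q ^+ (2 * m) * (q * (1 - q * t))))).
  apply: ler_wpM2l; first by rewrite mulr_ge0//; lra.
  by apply: le_trans IH' _; apply: ler_wpM2l => //; exact: ler_wpM2r.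
by rewrite mulnSr exprD expr2 le_eqVlt; apply/orP; left; apply/eqP; ring.
Qed.

Lemma passage_cauchy m x : passage w m x - passage w m.+1 x <=
  (c * (1 - q ^+ 2))^-1 * q ^+ (2 * m).
Proof.
have [hq0 hq1 hc0] := And3 q0 q1 c0.
apply: le_trans (passage_contract m x) _.
rewrite -[leRHS]mulr1; apply: ler_wpM2l.
  rewrite mulr_ge0 ?exprn_ge0 ?invr_ge0 ?mulr_ge0// ?ltW// subr_gt0.
  by rewrite exprn_ilt1// ltW.
have /andP[h1 h2] := passage_ge0 m.+1 x.
have /andP[h3 h4] := passage_ge0 m x.
have : 0 <= q * passage w m x by rewrite mulr_ge0// ltW.
have : q * passage w m x <= 1 * 1 by apply: ler_pM; lra.
move=> h5 h6; rewrite -[leRHS]mulr1; apply: ler_pM; lra.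
Qed.

End environment.

Definition passage_cost (w : int -> R) m x : R := - ln (passage w m x).

Lemma passage_cost_bounds (w : int -> R) m x :
  (forall x, c <= w x <= 1 - c) ->
  - ln q <= passage_cost w m x <= - ln (q * c).
Proof.
move=> wc; have /andP[h1 h2] := passage_bounds wc m x.
have h0 := passage_gt0 wc m x.
have qc0 : 0 < q * c by exact: mulr_gt0.
by rewrite /passage_cost !lerN2 !ler_ln ?posrE// h1 h2.
Qed.

End passage_factors.

Definition primitive (R : realType) (s : int -> R) (y : int) : R :=
  match y with
  | Posz n => \sum_(i < n) s i%:Z
  | Negz n => - \sum_(i < n.+1) s (Negz i)
  end.

Lemma primitiveS (R : realType) (s : int -> R) y :
  primitive s (y + 1) = primitive s y + s y.
Proof.
case: y => [n|[|n]].
- by rewrite -PoszD addn1 /= big_ord_recr.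
- by rewrite /= big_ord0 big_ord1 addNr.
- rewrite (_ : Negz n.+1 + 1 = Negz n); last by lia.
  by rewrite /= [X in _ = - X + _]big_ord_recr/= opprD subrK.
Qed.

Section passage_harmonic.
Context (R : realType) (q c : R).
Hypotheses (q0 : 0 < q) (q1 : q < 1) (c0 : 0 < c).
Variable w : int -> R.
Hypothesis wc : forall x, c <= w x <= 1 - c.
Variable m : nat.

Definition harm (y : int) : R := expR (primitive (passage_cost q w m.+1) y).

(** For the untruncated transforms [harm] would be an exact eigenfunction with factor [q^-1]. The
    defect arises because depth [m.+1] at [x] uses depth [m] at [x - 1], whereas [harm] carries
    depth [m.+1] there. It is nonnegative by [passage_mono], so the upper bound [ev_harm_le] is free
    of error; [passage_cauchy] makes it small, which gives [ev_harm_ge]. *)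
Lemma harm_step x :
  w x * harm (x + 1) + (1 - w x) * harm (x - 1) =
  (q^-1 - (1 - w x) * (passage q w m (x - 1) - passage q w m.+1 (x - 1))) * harm x.
Proof.
have g1 := passage_gt0 q0 q1 c0 wc m.+1 x.
have g2 := passage_gt0 q0 q1 c0 wc m.+1 (x - 1).
have E1 : harm (x + 1) = harm x / passage q w m.+1 x.
  by rewrite /harm primitiveS expRD /passage_cost expRN lnK ?posrE.
have E2 : harm (x - 1) = harm x * passage q w m.+1 (x - 1).
  have := primitiveS (passage_cost q w m.+1) (x - 1); rewrite subrK => E.
  rewrite /harm E expRD /passage_cost expRN lnK ?posrE// divfK//.
  exact: lt0r_neq0.
rewrite E1 E2.
have E3 : (passage q w m.+1 x)^-1 = (1 - q * (1 - w x) * passage q w m (x - 1)) / (q * w x).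
  by rewrite [passage q w m.+1 x]/= /passage_map invf_div.
have /andP[v0 v1] := wc x.
have v0' : 0 < w x by apply: lt_le_trans v0.
by rewrite E3; field; rewrite !lt0r_neq0.
Qed.

Let w01 (t : nat) x : 0 <= w x <= 1.
Proof. by have hc0 := c0; have := wc x; lra. Qed.

Lemma ev_harm_le s n x : ev (fun=> w) s n harm x <= q^-1 ^+ n * harm x.
Proof.
apply: ev_super => [//||t y]; first by rewrite invr_ge0 ltW.
rewrite harm_step; apply: ler_wpM2r; first exact: expR_ge0.
rewrite lerBlDr lerDl mulr_ge0//; first by have := w01 0 y; lra.
by rewrite subr_ge0 (passage_mono q0 q1 c0 wc).
Qed.

Lemma ev_harm_ge s n x (eta : R) : 0 <= q^-1 - eta ->
  (c * (1 - q ^+ 2))^-1 * q ^+ (2 * m) <= eta ->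
  (q^-1 - eta) ^+ n * harm x <= ev (fun=> w) s n harm x.
Proof.
move=> eta1 etam; apply: ev_sub => // t y.
rewrite harm_step; apply: ler_wpM2r; first exact: expR_ge0.
rewrite lerD2l lerN2.
have h := le_trans (passage_cauchy q0 q1 c0 wc m (y - 1)) etam.
have h' : 0 <= passage q w m (y - 1) - passage q w m.+1 (y - 1).
  by rewrite subr_ge0 (passage_mono q0 q1 c0 wc).
rewrite -[leRHS]mul1r; apply: ler_pM => //; have := w01 0 y; lra.
Qed.

End passage_harmonic.

Lemma depends_on_passage (R : realType) (q : R) m x :
  depends_on (fun z : int => (x - m%:Z < z) && (z <= x))
    (fun w : int -> R => passage q w m x).
Proof.
move=> w w' /=; elim: m x => //= m IH x ww'.
rewrite (ww' x); last by lia.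
by rewrite (IH (x - 1))// => z h; apply: ww'; lia.
Qed.

Lemma measurable_passage (R : realType) d (T : measurableType d)
    (W : T -> int -> R) (q c : R) m x :
  0 < q -> q < 1 -> 0 < c -> (forall u y, c <= W u y <= 1 - c) ->
  (forall y, measurable_fun setT (W ^~ y)) ->
  measurable_fun setT (fun u => passage q (W u) m x).
Proof.
move=> q0 q1 c0 Wc mW; elim: m x => [|m IH] x /=; first exact: measurable_cst.
pose D u := 1 - q * (1 - W u x) * passage q (W u) m (x - 1).
have D0 u : 0 <= D u.
  have := passage_map_den q0 q1 c0 (Wc u x) (passage_ge0 q0 q1 c0 (Wc u) m (x - 1)).
  by move=> /andP[/ltW].
rewrite (_ : (fun u => _) = (fun u => q * W u x * D u `^ (-1))); last first.
  by apply/funext => u; rewrite powR_inv1.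
apply: measurable_funM.
  by apply: measurable_funM => //; exact: mW.
apply: (measurableT_comp (measurable_powR _)).
apply: measurable_funB => //; apply: measurable_funM => //.
by apply: measurable_funM => //; apply: measurable_funB => //; exact: mW.
Qed.

(** * Walks in clipped environments *)

(* Clipping makes every environment elliptic, so that estimates hold for all
   environments; for almost every environment it changes nothing. *)
Definition clip (R : realType) (c u : R) : R := Num.max c (Num.min u (1 - c)).

Lemma clip_itv (R : realType) (c u : R) : c <= 2^-1 -> c <= clip c u <= 1 - c.
Proof.
move=> c2; rewrite /clip le_max lexx/= ge_max ge_min lexx orbT andbT.
by lra.
Qed.

Lemma clip_id (R : realType) (c u : R) : c <= u <= 1 - c -> clip c u = u.
Proof. by move=> /andP[cu uc]; rewrite /clip min_l// max_r. Qed.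

Lemma clip_reflect (R : realType) (c u : R) : c <= 2^-1 ->
  clip c (1 - u) = 1 - clip c u.
Proof.
move=> c2; rewrite /clip.
have [h|h] := leP u c.
  have -> : Num.min (1 - u) (1 - c) = 1 - c by apply: min_r; lra.
  have -> : Num.min u (1 - c) = u by apply: min_l; lra.
  by rewrite max_r ?max_l//; lra.
have [h'|h'] := leP u (1 - c).
  have -> : Num.min (1 - u) (1 - c) = 1 - u by apply: min_l; lra.
  by rewrite !max_r//; lra.
have -> : Num.min (1 - u) (1 - c) = 1 - u by apply: min_l; lra.
by rewrite max_l ?max_r//; lra.
Qed.

Lemma measurable_clip (R : realType) (c : R) :
  measurable_fun setT (clip c : measurableTypeR R -> measurableTypeR R).
Proof. by apply: measurable_maxr => //; exact: measurable_minr. Qed.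

Definition clip_env (R : realType) (c : R) (w : env R) : int -> R :=
  fun x => clip c (w x).

Definition sev (R : realType) (c : R) (w : env R) (n : nat) (f : int -> R) x : R :=
  ev (fun=> clip_env c w) 0 n f x.

Definition shift_env (R : realType) (x : int) (w : env R) : env R :=
  fun y => w (y + x).

Lemma measurable_clip_env (R : realType) (c : R) y :
  measurable_fun setT (fun w : env R => clip_env c w y).
Proof.
exact: (measurableT_comp (@measurable_clip R c)
         (@measurable_coord int _ (measurableTypeR R) y)).
Qed.

Lemma measurable_sev (R : realType) (c : R) n f x :
  measurable_fun setT (fun w : env R => sev c w n f x).
Proof. by apply: measurable_ev => _ y; exact: measurable_clip_env. Qed.

Lemma sev_shift (R : realType) (c : R) w n (f : int -> R) x z :
  sev c (shift_env z w) n (fun y => f (y + z)) x = sev c w n f (x + z).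
Proof. by rewrite /sev ev_translate. Qed.

Lemma depends_on_sev (R : realType) (c : R) n f x :
  depends_on (fun z : int => `|z - x| <= n%:Z)
    (fun w : env R => sev c w n f x).
Proof.
move=> w w' ww'; apply: ev_congr => t y tn yx.
by rewrite /clip_env ww'//; lia.
Qed.

Lemma measurable_shift_env (R : realType) (z : int) :
  measurable_fun setT (@shift_env R z).
Proof. by apply: measurable_to_fspace => i; exact: measurable_coord. Qed.

Section sev_bounds.
Context (R : realType) (c : R) (w : env R).
Hypotheses (c0 : 0 < c) (c2 : c <= 2^-1).

Lemma clip_env_itv x : c <= clip_env c w x <= 1 - c.
Proof. exact: clip_itv. Qed.

Lemma clip_env01 (t : nat) x : 0 <= clip_env c w x <= 1.
Proof. by have := clip_env_itv x; have := c0; lra. Qed.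

Lemma sev_ge0 n f x : (forall y, 0 <= f y) -> 0 <= sev c w n f x.
Proof. by move=> f0; apply: ev_ge0 => //; exact: clip_env01. Qed.

Lemma sev_indic_ge0 n (A : set int) x : 0 <= sev c w n \1_A x.
Proof. by apply: sev_ge0 => y; rewrite indicE. Qed.

Lemma sev_indic_le1 n (A : set int) x : sev c w n \1_A x <= 1.
Proof. by apply: ev_indic_le1; exact: clip_env01. Qed.

Lemma sev_elliptic a b x :
  c ^+ (a + b) <= sev c w (a + b) \1_[set x + a%:Z - b%:Z] x.
Proof.
by apply: ev_elliptic; [exact: clip_env01|exact: ltW|move=> *; exact: clip_env_itv].
Qed.

Lemma sev_add n m f x : sev c w (n + m) f x = sev c w n (sev c w m f) x.
Proof.
rewrite /sev ev_add; congr ev; apply/funext => y.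
exact: ev_congr.
Qed.

Lemma sev_ge_at n f x y : (forall z, 0 <= f z) ->
  sev c w n \1_[set y] x * f y <= sev c w n f x.
Proof. by move=> f0; apply: ev_ge_at => //; exact: clip_env01. Qed.

Lemma sev_le n f g x :
  (forall a b, (a + b)%N = n -> f (x + a%:Z - b%:Z) <= g (x + a%:Z - b%:Z)) ->
  sev c w n f x <= sev c w n g x.
Proof. by move=> fg; apply: ev_le => //; exact: clip_env01. Qed.

End sev_bounds.

Lemma integral_prob_cst (R : realType) d (T : measurableType d)
  (P : probability T R) (k : R) : (\int[P]_w k%:E = k%:E)%E.
Proof.
transitivity (k%:E * P setT)%E; first exact: integral_cst.
by rewrite probability_setT mule1.
Qed.

Section static_law.
Context (R : realType) (alpha : probability (measurableTypeR R) R).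
Context (mu : probability (env R) R) (muN : probability (env_seq R) R).
Hypothesis muE : is_product_law alpha mu.
Hypothesis muNE : is_product_law mu muN.

Lemma shift_env_law z A : measurable A -> mu (shift_env z @^-1` A) = mu A.
Proof.
move=> mA.
have mS := @measurable_shift_env R z.
pose S : {mfun env R >-> env R} := HB.pack (shift_env z) (isMeasurableFun.Build _ _ _ _ _ mS).
apply: (product_law_unique (P := distribution mu S) _ muE mA).
apply: (product_law_map (f := id) (s := fun y => y + z) (s' := fun y => y - z) muE) => //.
by move=> y /=; rewrite addrK.
Qed.

Lemma integral_shift_env z (F : env R -> R) :
  measurable_fun setT F -> (forall w, 0 <= F w) ->
  (\int[mu]_w (F (shift_env z w))%:E = \int[mu]_w (F w)%:E)%E.
Proof.
move=> mF F0; have mFE : measurable_fun setT (EFin \o F) by exact/measurable_EFinP.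
have F0E : {in setT, forall w, (0 <= (EFin \o F) w)%E} by move=> w _; rewrite lee_fin.
have := ge0_integral_pushforward (@measurable_shift_env R z) mu measurableT mFE F0E.
rewrite preimage_setT => <-; apply: eq_measure_integral => [|? A mA _]; first exact: measurable_shift_env.
exact: shift_env_law.
Qed.

Lemma integral_env_coord k (F : env R -> R) :
  measurable_fun setT F -> (forall w, 0 <= F w) ->
  (\int[muN]_Om (F (Om k))%:E = \int[mu]_w (F w)%:E)%E.
Proof.
move=> mF F0; have mFE : measurable_fun setT (EFin \o F) by exact/measurable_EFinP.
have F0E : {in setT, forall w, (0 <= (EFin \o F) w)%E} by move=> w _; rewrite lee_fin.
have := ge0_integral_pushforward (@measurable_coord nat _ (env R) k) muN
  measurableT mFE F0E.
rewrite preimage_setT => <-; apply: eq_measure_integral => [|? A mA _]; first exact: measurable_coord.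
exact: (product_law_coord _ muNE mA).
Qed.

End static_law.

(** Multiply by [expR (- x) >= 1 - x]: the product [(1 + x + 2 x^2) * (1 - x)] equals
    [1 + x^2 * (1 - 2 x)]. *)
Lemma expR_le_quadratic (R : realType) (x : R) : x <= 2^-1 ->
  expR x <= 1 + x + 2 * x ^+ 2.
Proof.
move=> x2; have h := expR_ge1Dx (- x).
have Q : 1 <= (1 + x + 2 * x ^+ 2) * expR (- x).
  apply: (@le_trans _ _ ((1 + x + 2 * x ^+ 2) * (1 - x))).
    have : 0 <= x ^+ 2 * (1 - 2 * x) by rewrite mulr_ge0 ?sqr_ge0//; lra.
    by rewrite !expr2; lra.
  by apply: ler_wpM2l => //; rewrite expr2; nra.
by have := ler_peMl (expR_ge0 x) Q; rewrite -mulrA -expRD addNr expR0 mulr1.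
Qed.

Section small_exponential_moment.
Context (R : realType) (d : measure_display) (T : measurableType d).
Variable P : probability T R.

Lemma bounded_integrable (f : T -> R) (B : R) : measurable_fun setT f ->
  (forall w, `|f w| <= B) -> P.-integrable setT (EFin \o f).
Proof.
move=> mf fB; apply: measurable_bounded_integrable => //.
  by apply: (@le_lt_trans _ _ 1%E); [exact: probability_le1|exact: ltry].
exists B; split; first exact: num_real.
by move=> M BM w _; apply: le_trans (fB w) (ltW BM).
Qed.

(* [exp (t * f) <= 1 + t * f + 2 * t ^ 2 * B ^ 2] for [t * B <= 1 / 2]. *)
Lemma small_exponential_moment (f : T -> R) (B d0 : R) : measurable_fun setT f ->
  (forall w, `|f w| <= B) -> 0 < d0 -> (\int[P]_w (f w)%:E <= (- d0)%:E)%E ->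
  exists2 t, 0 < t <= 1 & (\int[P]_w (expR (t * f w))%:E <= 1)%E.
Proof.
move=> mf fB0 d00 fd.
pose B1 := Num.max B 1.
have B1p : 1 <= B1 by rewrite le_max lexx orbT.
have fB w : `|f w| <= B1 by rewrite le_max fB0.
(* The second bound gives [t * B1 <= 1 / 2], the range of the quadratic estimate; the first makes
   the quadratic term at most the linear gain [t * d0]. Taking [B1 >= 1] ensures [t <= 1]. *)
pose t := Num.min (d0 / (2 * B1 ^+ 2)) (2^-1 / B1).
have B0 : 0 < B1 by lra.
have B20 : 0 < 2 * B1 ^+ 2 by rewrite mulr_gt0// exprn_gt0.
have t0 : 0 < t by rewrite lt_min !divr_gt0.
have t1 : t * (2 * B1 ^+ 2) <= d0 by rewrite -ler_pdivlMr// ge_min lexx.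
have t2 : t * B1 <= 2^-1 by rewrite -ler_pdivlMr// ge_min lexx orbT.
have tB : t * 1 <= t * B1 by apply: ler_wpM2l => //; exact: ltW.
exists t; first by rewrite t0/=; lra.
have key w : expR (t * f w) <= 1 + 2 * t ^+ 2 * B1 ^+ 2 + t * f w.
  have tf : t * f w <= 2^-1.
    apply: le_trans t2; apply: ler_wpM2l; first exact: ltW.
    exact: le_trans (ler_norm _) (fB w).
  apply: (le_trans (expR_le_quadratic tf)).
  have : f w ^+ 2 <= B1 ^+ 2.
    by rewrite -[f w ^+ 2]ger0_norm ?sqr_ge0// normrX lerXn2r ?nnegrE// ltW.
  rewrite exprMn => /(ler_wpM2l (sqr_ge0 t)); lra.
have it : P.-integrable setT (fun w => (t * f w)%:E).
  apply: (@bounded_integrable (fun w => t * f w) (t * B1)).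
    exact: measurable_funM.
  by move=> w; rewrite normrM gtr0_norm// ler_pM2l.
apply: (@le_trans _ _ (\int[P]_w (1 + 2 * t ^+ 2 * B1 ^+ 2 + t * f w)%:E)%E).
  apply: ge0_le_integral => //.
  - apply/measurable_EFinP; apply: measurableT_comp => //; exact: measurable_funM.
  - apply/measurable_EFinP; apply: measurable_funD => //; exact: measurable_funM.
  - by move=> w _; rewrite lee_fin.
under eq_integral do rewrite EFinD.
rewrite integralD//=; last exact: finite_measure_integrable_cst.
rewrite integral_prob_cst.
under eq_integral do rewrite EFinM.
rewrite integralZl//; last exact: bounded_integrable mf fB.
apply: (@le_trans _ _ ((1 + 2 * t ^+ 2 * B1 ^+ 2)%:E + t%:E * (- d0)%:E)%E).
  by apply: leeD => //; apply: lee_wpmul2l => //; rewrite lee_fin ltW.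
rewrite -EFinM -EFinD lee_fin.
have : t * (t * (2 * B1 ^+ 2)) <= t * d0 by apply: ler_wpM2l => //; exact: ltW.
nra.
Qed.

(** The unions over [k >= n] of the bad events decrease to a null set. This trades the random time
    after which a bound holds for a deterministic one, at the price of a small exceptional
    probability. *)
Lemma ae_eventually_measure (G : nat -> set T) (e : R) :
  (forall n, measurable (G n)) -> 0 < e ->
  {ae P, forall w, \forall n \near \oo, G n w} ->
  \forall n \near \oo, (P (~` G n) <= e%:E)%E.
Proof.
move=> mG e0 [N [mN PN GN]].
pose F n := ~` G n.
have mF n : measurable (F n) by exact: measurableC.
have mU n : measurable (\bigcup_(k >= n) F k) by exact: bigcup_measurable.
have PL0 : P (lim_sup_set F) = 0%E.
  apply: (subset_measure0 _ mN _ PN).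
    by apply: bigcap_measurable.
  move=> w wF; apply: GN => -[k _ kG].
  by have [n /= kn] := wF k I; apply; exact: kG.
have : P (\bigcup_(k >= n) F k) @[n --> \oo] --> 0%E.
  rewrite -PL0; apply: lim_sup_set_cvg => //.
  by apply: (@le_lt_trans _ _ 1%E); [exact: probability_le1|exact: ltry].
move=> /fine_cvgP[_ /cvgrPdist_le /(_ e e0)].
apply: filterS => n; rewrite sub0r normrN => h.
have fU : P (\bigcup_(k >= n) F k) \is a fin_num by exact: fin_num_measure.
apply: (@le_trans _ _ (P (\bigcup_(k >= n) F k))).
  apply: le_measure; [by rewrite inE; exact: mF|by rewrite inE|].
  by move=> w Fw; exists n => /=.
rewrite -(fineK fU) lee_fin; apply: le_trans h; exact: ler_norm.
Qed.

End small_exponential_moment.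

(** * Moment bounds for the static walk from above *)

Lemma ae_prob_ex (R : realType) d (T : measurableType d) (P : probability T R)
    (A : set T) : {ae P, forall w, A w} -> exists w, A w.
Proof.
have P1 : (1 <= P setT)%E by rewrite probability_setT.
have pf : ProperFilter (almost_everywhere P).
  by apply: ae_properfilter_algebraOfSetsType; exact: lt_le_trans lte01 P1.
by move=> /filter_ex.
Qed.

Lemma near_forall_lt (P : nat -> nat -> Prop) K :
  (forall j, \forall n \near \oo, P j n) ->
  \forall n \near \oo, forall j, (j < K)%N -> P j n.
Proof.
move=> hP; elim: K => [|K IH]; first by apply: nearW.
by apply: filterS2 IH (hP K) => n h h' j; rewrite ltnS leq_eqVlt => /predU1P[->|/h].
Qed.

Lemma natr_le_expR (R : realType) (x : R) (n : nat) : 0 < x ->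
  n%:R + 1 <= (1 + x^-1) * expR (x * n%:R).
Proof.
move=> x0; have xV : 0 < x^-1 by rewrite invr_gt0.
apply: (@le_trans _ _ ((1 + x^-1) * (1 + x * n%:R))).
  have -> : (1 + x^-1) * (1 + x * n%:R) = 1 + x * n%:R + x^-1 + n%:R.
    by field; exact: lt0r_neq0.
  have : 0 <= x * n%:R by rewrite mulr_ge0// ltW.
  lra.
by apply: ler_wpM2l; [lra|exact: expR_ge1Dx].
Qed.

Lemma near_natr_gt (R : realType) (x : R) : \forall n \near \oo, x < n%:R.
Proof.
exists (Num.truncn `|x|).+1 => // n /= h.
have /andP[_ h1] := truncn_itv (normr_ge0 x).
by apply: le_lt_trans (ler_norm x) _; apply: lt_le_trans h1 _; rewrite ler_nat.
Qed.

Lemma walk_range_le (a b n : nat) : (a + b)%N = n -> 0 + a%:Z - b%:Z <= n%:Z.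
Proof. by lia. Qed.

Section shifted_sums.
Context (R : realType) (alpha : probability (measurableTypeR R) R).
Context (mu : probability (env R) R).
Hypothesis muE : is_product_law alpha mu.

(** Windows of radius [m] around sites at least [M = 2m + 1] apart are disjoint. Dividing the
    exponent of a single term by [M] pays for the dependence, uniformly in the number of terms. *)
Lemma exp_moment_shifted_sums (f : env R -> R) (m : nat) (B d0 : R) :
  measurable_fun setT f -> (forall w, `|f w| <= B) ->
  depends_on (fun z : int => `|z| <= m%:Z) f ->
  0 < d0 -> (\int[mu]_w (f w)%:E <= (- d0)%:E)%E ->
  exists2 t, 0 < t <= 1 & forall N,
   (\int[mu]_w (expR (t * \sum_(i < N) f (shift_env i%:Z w)))%:E <= 1)%E.
Proof.
move=> mf fB fm d00 fd.
have [t /andP[t0 t1] tE] := small_exponential_moment mf fB d00 fd.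
pose M := m.*2.+1.
have M1 : 1 <= M%:R :> R by rewrite ler1n.
have M0 : 0 < M%:R :> R by rewrite ltr0n.
exists (t / M%:R).
  rewrite divr_gt0//= ler_pdivrMr// mul1r.
  exact: le_trans t1 M1.
move=> N; under eq_integral do rewrite mulr_sumr.
pose g (i : nat) (w : env R) := t / M%:R * f (shift_env i%:Z w).
have mfs i : measurable_fun setT (fun w => f (shift_env i w)).
  by apply: (measurableT_comp mf); exact: measurable_shift_env.
apply: (@integral_exp_dependent_sum _ _ _ _ _ _ muE g
    (fun i z => `|z - i%:Z| <= m%:Z) M N) => //.
- by move=> i; exact: measurable_funM.
- move=> i w w' ww'; congr (_ * _); apply: fm => z zm; apply: ww' => /=.
  by rewrite addrK.
- by move=> i j x; rewrite /M => ij; apply/negP => /andP[]; lia.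
- move=> i; rewrite (eq_integral (fun w => (expR (t * f (shift_env i%:Z w)))%:E)).
    have mE : measurable_fun setT (fun w => expR (t * f w)).
      by apply: measurableT_comp => //; exact: measurable_funM.
    have E0 w : 0 <= expR (t * f w) by exact: expR_ge0.
    by rewrite (integral_shift_env muE i%:Z mE E0).
  move=> w _; rewrite /g; congr (expR _)%:E.
  by field; exact: lt0r_neq0.
Qed.

End shifted_sums.

Section static_upper.
Context (R : realType) (alpha : probability (measurableTypeR R) R).
Context (mu : probability (env R) R).
Hypothesis muE : is_product_law alpha mu.
Variables (c : R) (I : R -> \bar R).
Hypotheses (c0 : 0 < c) (c2 : c <= 2^-1).
Hypothesis static_upper : forall u a : R, 0 <= u -> (a%:E < I u)%E ->
  {ae mu, forall w, \forall n \near \oo,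
    sev c w n \1_[set z : int | u * n%:R <= z%:~R] 0 <= expR (- (a * n%:R))}.

Variables s r0 eps : R.
Hypotheses (s0 : 0 <= s) (r00 : 0 <= r0) (eps0 : 0 < eps).
Hypothesis line : forall u, 0 <= u -> ((s * u - r0)%:E <= I u)%E.

Let q := expR (- (r0 + eps)).

Let q0 : 0 < q. Proof. exact: expR_gt0. Qed.

Let q1 : q < 1.
Proof.
by have [h1 h2] := conj r00 eps0; rewrite /q expR_lt1; lra.
Qed.

Let qV : q^-1 = expR (r0 + eps). Proof. by rewrite /q expRN invrK. Qed.

Variable m : nat.
Let cost (w : env R) (i : int) := passage_cost q (clip_env c w) m.+1 i.

Let cost_bounds w i : 0 <= cost w i <= - ln (q * c).
Proof.
have := passage_cost_bounds q0 q1 c0 m.+1 i (@clip_env_itv _ c w c2).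
move=> /andP[h ->]; rewrite andbT; apply: le_trans h.
by rewrite lerNr oppr0 ln_le0// ltW.
Qed.

Let cost_shift w (i : nat) : cost w i%:Z = cost (shift_env i%:Z w) 0.
Proof.
rewrite /cost /passage_cost; congr (- ln _).
have gen k x z : passage q (clip_env c w) k (x + z) =
    passage q (clip_env c (shift_env z w)) k x.
  elim: k x => //= k IH x.
  by rewrite -IH /clip_env /shift_env addrAC.
by rewrite -gen add0r.
Qed.

Let depends_cost : depends_on (fun z : int => `|z| <= m.+1%:Z) (fun w => cost w 0).
Proof.
move=> w w' ww'; rewrite /cost /passage_cost; congr (- ln _).
apply: depends_on_passage => z zm; rewrite /clip_env ww'//.
by move: zm => /=; lia.
Qed.

Let measurable_cost : measurable_fun setT (fun w => cost w 0).
Proof.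
rewrite /cost /passage_cost.
apply: (@measurableT_comp _ _ _ _ _ _ (@GRing.opp R)) => //.
apply: measurableT_comp => //.
apply: (measurable_passage _ _ q0 q1 c0) => [w y|y]; first exact: clip_env_itv.
exact: measurable_clip_env.
Qed.

Let integrable_cost : mu.-integrable setT (EFin \o (fun w => cost w 0)).
Proof.
apply: (@bounded_integrable _ _ _ _ _ (- ln (q * c))) => // w.
by have /andP[h1 h2] := cost_bounds w 0; rewrite ger0_norm.
Qed.

Let lam := fine (\int[mu]_w (cost w 0)%:E)%E.

Let lamE : (\int[mu]_w (cost w 0)%:E)%E = lam%:E.
Proof. by rewrite /lam fineK//; exact: integrable_fin_num. Qed.

Let bound_affine (k1 k2 : R) w :
  `|k1 + k2 * cost w 0| <= `|k1| + `|k2| * - ln (q * c).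
Proof.
apply: (le_trans (ler_normD _ _)); rewrite lerD2l normrM.
have /andP[h1 h2] := cost_bounds w 0.
by apply: ler_wpM2l => //; rewrite ger0_norm.
Qed.

Let affine_moment (k1 k2 : R) : k1 + k2 * lam < 0 ->
  exists2 t, 0 < t <= 1 & forall N,
   (\int[mu]_w (expR (t * \sum_(i < N) (k1 + k2 * cost w i%:Z)))%:E <= 1)%E.
Proof.
move=> neg; pose f w := k1 + k2 * cost w 0.
have mf : measurable_fun setT f.
  by apply: measurable_funD => //; exact: measurable_funM.
have fE : (\int[mu]_w (f w)%:E = (k1 + k2 * lam)%:E)%E.
  rewrite /f; under eq_integral do rewrite EFinD EFinM.
  rewrite integralD//=; last 2 first.
  - exact: finite_measure_integrable_cst.
  - exact: integrableZl.
  by rewrite integral_prob_cst integralZl// lamE -EFinM -EFinD.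
have d0 : 0 < - (k1 + k2 * lam) by rewrite oppr_gt0.
have fm : depends_on (fun z : int => `|z| <= m.+1%:Z) f.
  by move=> w w' ww'; rewrite /f (depends_cost ww').
have [|t t01 tN] := exp_moment_shifted_sums muE mf (bound_affine k1 k2) fm d0.
  by rewrite fE opprK.
exists t; first exact: t01.
move=> N; apply: le_trans (tN N); rewrite le_eqVlt; apply/orP; left.
apply/eqP; apply: eq_integral => w _; congr (expR (_ * _))%:E.
by apply: eq_bigr => i _; rewrite /f cost_shift.
Qed.

Let measurable_sum_cost (k1 k2 : R) N :
  measurable_fun setT (fun w => \sum_(i < N) (k1 + k2 * cost w i%:Z)).
Proof.
apply: measurable_sum => i; apply: measurable_funD => //.
apply: measurable_funM => //.
rewrite (_ : (fun w => cost w i%:Z) = (fun w => cost w 0) \o shift_env i%:Z).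
  by apply: (measurableT_comp measurable_cost); exact: measurable_shift_env.
by apply/funext => w; exact: cost_shift.
Qed.

(** The terms [cost - (s + ka)] have negative mean. The extra slack [ka * n] makes the bound uniform
    over [N <= n], small [N] included: it yields the decay [exp (- t * ka * n)], half of which
    absorbs the [n + 1] values of [N]. *)
Let cost_growth (ka : R) : 0 < ka -> lam <= s ->
  {ae mu, forall w, \forall n \near \oo, forall N, (N <= n)%N ->
    \sum_(i < N) cost w i%:Z <= s * N%:R + ka * N%:R + ka * n%:R}.
Proof.
move=> ka0 lams.
have [|t /andP[t0 _] tN] := @affine_moment (- (s + ka)) 1; first by lra.
pose F n w := \sum_(N < n.+1)
  expR (t * \sum_(i < N) (- (s + ka) + 1 * cost w i%:Z)) * expR (- (t * ka * n%:R)).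
have x0 : 0 < t * ka / 2 by rewrite divr_gt0// mulr_gt0.
have mE N n : measurable_fun setT (fun w =>
    expR (t * \sum_(i < N) (- (s + ka) + 1 * cost w i%:Z)) * expR (- (t * ka * n%:R))).
  apply: measurable_funM => //; apply: measurableT_comp => //.
  by apply: measurable_funM => //; exact: measurable_sum_cost.
have mF n : measurable_fun setT (F n).
  by apply: measurable_sum => N; exact: mE.
have F0 n w : 0 <= F n w by apply: sumr_ge0 => N _; rewrite mulr_ge0// expR_ge0.
have E0 (N n : nat) w : (0 <= (expR (t * \sum_(i < N) (- (s + ka) + 1 * cost w i%:Z)) *
    expR (- (t * ka * n%:R)))%:E)%E by rewrite lee_fin mulr_ge0// expR_ge0.
have FC n : (\int[mu]_w (F n w)%:E <=
    ((1 + (t * ka / 2)^-1) * expR (- (t * ka / 2 * n%:R)))%:E)%E.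
  rewrite /F; under eq_integral do rewrite -sumEFin.
  rewrite ge0_integral_sum//; last by move=> N; exact/measurable_EFinP.
  apply: (@le_trans _ _ (\sum_(N < n.+1) (expR (- (t * ka * n%:R)))%:E)%E).
    apply: lee_sum => N _.
    under eq_integral do rewrite mulrC EFinM.
    have mEx : measurable_fun setT (fun w =>
        (expR (t * \sum_(i < N) (- (s + ka) + 1 * cost w i%:Z)))%:E).
      apply/measurable_EFinP; apply: measurableT_comp => //.
      by apply: measurable_funM => //; exact: measurable_sum_cost.
    rewrite ge0_integralZl ?lee_fin ?expR_ge0//.
    by rewrite -[leRHS]mule1; apply: lee_wpmul2l; rewrite ?lee_fin ?expR_ge0.
  rewrite sumEFin lee_fin.
  rewrite (_ : \sum_(N < n.+1) _ = (n%:R + 1) * expR (- (t * ka * n%:R))); last first.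
    by rewrite sumr_const card_ord natr1 mulr_natl.
  have -> : expR (- (t * ka * n%:R)) =
      expR (- (t * ka / 2 * n%:R)) * expR (- (t * ka / 2 * n%:R)).
    by rewrite -expRD; congr expR; field.
  rewrite mulrA ler_wpM2r ?expR_ge0// expRN ler_pdivrMr ?expR_gt0//.
  exact: natr_le_expR.
apply: filterS (ae_eventually_le1 mF F0 x0 FC) => w.
apply: filterS => n Fn N Nn.
have := Fn; rewrite /F (bigD1 (Ordinal (Nn : (N < n.+1)%N)))//= => Fn'.
have rest : 0 <= \sum_(i < n.+1 | i != Ordinal (Nn : (N < n.+1)%N))
    expR (t * \sum_(j < i) (- (s + ka) + 1 * cost w j%:Z)) * expR (- (t * ka * n%:R)).
  by apply: sumr_ge0 => i _; rewrite mulr_ge0// expR_ge0.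
have : expR (t * \sum_(i < N) (- (s + ka) + 1 * cost w i%:Z)) *
    expR (- (t * ka * n%:R)) <= 1 by lra.
have SE : \sum_(i < N) (- (s + ka) + 1 * cost w i%:Z) =
    N%:R * - (s + ka) + \sum_(i < N) cost w i%:Z.
  rewrite big_split/= sumr_const card_ord mulr_natl; congr (_ + _).
  by apply: eq_bigr => i _; rewrite mul1r.
rewrite -expRD expR_le1 SE => h.
have : t * (N%:R * - (s + ka) + \sum_(i < N) cost w i%:Z - ka * n%:R) <= 0.
  by apply: le_trans h; lra.
rewrite pmulr_rle0//; lra.
Qed.

Let harm0 w : harm q (clip_env c w) m 0 = 1.
Proof. by rewrite /harm /= big_ord0 expR0. Qed.

Let harmE w (N : nat) :
  harm q (clip_env c w) m N%:Z = expR (\sum_(i < N) cost w i%:Z).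
Proof. by []. Qed.

Let harm_neg w (k : nat) : harm q (clip_env c w) m (Negz k) <= 1.
Proof.
rewrite /harm expR_le1 /= oppr_le0; apply: sumr_ge0 => i _.
by have /andP[] := cost_bounds w (Negz i).
Qed.

(* Up to a small error, [q^-n * harm 0] is the expectation of [harm] after [n]
   steps, and [harm y] is about [exp (lam * y)].  If [lam <= s], the upper bound of
   the static LDP makes that expectation about [exp (r0 * n)] at most, although
   [q^-1 = exp (r0 + eps)]. *)
Lemma passage_rate_gt :
  (c * (1 - q ^+ 2))^-1 * q ^+ (2 * m) <= q^-1 - expR (r0 + eps - eps / 4) ->
  s < lam.
Proof.
have [hs0 hr0 he0] := And3 s0 r00 eps0.
move=> mK; rewrite ltNge; apply/negP => lams.
(* Error budget: [eps / 8] for the mesh [1 / G] of speeds, [eps / 8] for staying below the line,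
   [eps / 4] for the fluctuation [E] of the costs. The upper estimate is then
   [(G + 2) * exp ((r0 + eps / 2) * n)], the lower one [exp ((r0 + 3 * eps / 4) * n)], and they
   conflict once [exp (eps / 4 * n)] exceeds [G + 2]. *)
have ka0 : 0 < eps / 8 by lra.
pose G := (Num.truncn (s / (eps / 8))).+1.
have G0 : 0 < G%:R :> R by rewrite ltr0n.
have sG : s / G%:R <= eps / 8.
  rewrite ler_pdivrMr// mulrC -ler_pdivrMr//; apply/ltW.
  by have /andP[] := truncn_itv (divr_ge0 hs0 (ltW ka0)).
pose u (j : nat) : R := j%:R / G%:R.
have u0 j : 0 <= u j by rewrite divr_ge0.
pose b (j : nat) : R := s * u j - r0 - eps / 8.
have bI j : ((b j)%:E < I (u j))%E.
  by apply: lt_le_trans (line (u0 j)); rewrite lte_fin /b; lra.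
have S2 := ae_foralln (fun j => static_upper (u0 j) (bI j)).
have [w [wS wC]] : exists w, (forall j, \forall n \near \oo,
    sev c w n \1_[set z : int | u j * n%:R <= z%:~R] 0 <= expR (- (b j * n%:R))) /\
    (\forall n \near \oo, forall N, (N <= n)%N ->
    \sum_(i < N) cost w i%:Z <= s * N%:R + eps / 8 * N%:R + eps / 8 * n%:R).
  exact: ae_prob_ex (filterI S2 (cost_growth ka0 lams)).
have near_n : \forall n \near \oo, [/\ (forall j, (j < G.+1)%N ->
    sev c w n \1_[set z : int | u j * n%:R <= z%:~R] 0 <= expR (- (b j * n%:R))),
    (forall N, (N <= n)%N ->
    \sum_(i < N) cost w i%:Z <= s * N%:R + eps / 8 * N%:R + eps / 8 * n%:R),
    (0 < n)%N & (G.+2)%:R / (eps / 4) < n%:R :> R].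
  apply: filter_app (near_forall_lt G.+1 wS); apply: filter_app wC.
  apply: filter_app (near_natr_gt ((G.+2)%:R / (eps / 4))).
  by exists 1%N => // n /= n0 h1 h2 h3; split.
have [n [nS nC n0 nG]] := filter_ex near_n.
have n0' : 0 < n%:R :> R by rewrite ltr0n.
pose E : R := expR (eps / 4 * n%:R).
have E0 : 0 < E by exact: expR_gt0.
(* On the layer [u j * n <= y < u j.+1 * n] the coefficient dominates [exp (s * y)]. Indicators of
   whole half-lines suffice as all terms are nonnegative, and [y <= n] limits the layers to
   [G + 1]. *)
pose step (j : nat) (y : int) : R :=
  expR (s * (n%:R * ((j%:R + 1) / G%:R))) * \1_[set z : int | u j * n%:R <= z%:~R] y.
have step0 j y : 0 <= step j y by rewrite mulr_ge0 ?expR_ge0// indicE.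
have dom y : y <= n%:Z ->
    harm q (clip_env c w) m y <= E * (1 + \sum_(j < G.+1) step j y).
  have E1 : 1 <= E by rewrite -expR0 ler_expR mulr_ge0//; lra.
  case: y => [N|k] yn; last first.
    apply: (le_trans (harm_neg w k)); rewrite -[leLHS]mul1r; apply: ler_pM => //.
    by rewrite lerDl; apply: sumr_ge0 => j _; exact: step0.
  have Nn : (N <= n)%N by rewrite -lez_nat.
  have Nn' : N%:R <= n%:R :> R by rewrite ler_nat.
  rewrite harmE.
  apply: (@le_trans _ _ (E * expR (s * N%:R))).
    rewrite /E -expRD ler_expR; apply: (le_trans (nC N Nn)).
    have : eps / 8 * N%:R <= eps / 8 * n%:R by apply: ler_wpM2l => //; lra.
    by lra.
  rewrite ler_pM2l//.
  pose j := Num.truncn (N%:R / n%:R * G%:R : R).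
  have x0 : 0 <= N%:R / n%:R * G%:R :> R by rewrite mulr_ge0 ?divr_ge0// ltW.
  have /andP[j1 j2] := truncn_itv x0; rewrite -/j in j1 j2.
  have jG : (j < G.+1)%N.
    rewrite ltnS -(ler_nat R); apply: (le_trans j1).
    by rewrite ler_piMl ?(ltW G0)// ler_pdivrMr// mul1r.
  rewrite (bigD1 (Ordinal jG))//= /step indicE mem_set ?mulr1; last first.
    rewrite /= /u mulrAC ler_pdivrMr// -ler_pdivlMr//.
    by rewrite mulrAC.
  have h : s * N%:R <= s * (n%:R * ((j%:R + 1) / G%:R)).
    apply: ler_wpM2l => //; rewrite natr1.
    have -> : n%:R * (j.+1%:R / G%:R) = j.+1%:R * (n%:R / G%:R) :> R by ring.
    rewrite -ler_pdivrMr ?divr_gt0//; apply/ltW; apply: le_lt_trans j2.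
    by rewrite invf_div mulrA mulrAC.
  have := h; rewrite -ler_expR => h'.
  have rest : 0 <= \sum_(i < G.+1 | i != Ordinal jG) step i N.
    by apply: sumr_ge0 => i _; exact: step0.
  by apply: le_trans h' _; rewrite addrCA lerDl addr_ge0.
have wc := @clip_env_itv _ c w c2.
have eta0 : 0 <= q^-1 - (q^-1 - expR (r0 + eps - eps / 4)).
  by rewrite opprB addrC subrK expR_ge0.
have lo := ev_harm_ge q0 q1 c0 wc 0 n 0 eta0 mK.
have up : sev c w n (harm q (clip_env c w) m) 0 <=
    E * (1 + \sum_(j < G.+1) expR (s * (n%:R * ((j%:R + 1) / G%:R))) *
      sev c w n \1_[set z : int | u j * n%:R <= z%:~R] 0).
  have -> : E * (1 + \sum_(j < G.+1) expR (s * (n%:R * ((j%:R + 1) / G%:R))) *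
      sev c w n \1_[set z : int | u j * n%:R <= z%:~R] 0) =
      sev c w n (fun y => E * (1 + \sum_(j < G.+1) step j y)) 0.
    rewrite /sev evZ evD ev_cst ev_sum; congr (_ * (_ + _)).
    by apply: eq_bigr => j _; rewrite evZ.
  by apply: sev_le => // x y xyn; apply: dom; exact: walk_range_le.
have T j : (j < G.+1)%N -> expR (s * (n%:R * ((j%:R + 1) / G%:R))) *
    sev c w n \1_[set z : int | u j * n%:R <= z%:~R] 0 <=
    expR ((r0 + eps / 4) * n%:R).
  move=> jG; apply: (@le_trans _ _ (expR (s * (n%:R * ((j%:R + 1) / G%:R))) *
      expR (- (b j * n%:R)))).
    by apply: ler_wpM2l; [exact: expR_ge0|exact: nS].
  rewrite -expRD ler_expR /b /u.
  have -> : s * (n%:R * ((j%:R + 1) / G%:R)) + - ((s * (j%:R / G%:R) - r0 - eps / 8) * n%:R) =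
      (s / G%:R + r0 + eps / 8) * n%:R.
    by field; exact: lt0r_neq0.
  by apply: ler_wpM2r; [exact: ltW|lra].
have : expR ((r0 + eps - eps / 4) * n%:R) <=
    E * (1 + G.+1%:R * expR ((r0 + eps / 4) * n%:R)).
  have <- : (q^-1 - (q^-1 - expR (r0 + eps - eps / 4))) ^+ n * harm q (clip_env c w) m 0 =
      expR ((r0 + eps - eps / 4) * n%:R).
    by rewrite harm0 mulr1 opprB addrC subrK expRM_natr.
  apply: (le_trans lo); apply: (le_trans up); rewrite ler_pM2l// lerD2l.
  apply: (@le_trans _ _ (\sum_(j < G.+1) expR ((r0 + eps / 4) * n%:R))).
    by apply: ler_sum => j _; exact: T.
  by rewrite sumr_const card_ord mulr_natl.
have X1 : 1 <= expR ((r0 + eps / 4) * n%:R).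
  rewrite -[leLHS]expR0 ler_expR; apply: mulr_ge0 => //.
  by apply: addr_ge0 => //; lra.
have -> : expR ((r0 + eps - eps / 4) * n%:R) =
    E * (E * expR ((r0 + eps / 4) * n%:R)).
  by rewrite /E -!expRD; congr expR; field.
rewrite ler_pM2l//; set X := expR _ in X1 *.
move=> h; have : E * X <= (G.+2)%:R * X.
  have -> : (G.+2)%:R * X = X + (G.+1)%:R * X by rewrite -natr1 mulrDl mul1r addrC.
  by apply: (le_trans h); rewrite lerD2r.
rewrite ler_pM2r; last by lra.
apply/negP; rewrite -ltNge.
apply: lt_le_trans (expR_ge1Dx _).
by move: nG; rewrite ltr_pdivrMr ?divr_gt0// mulrC; lra.
Qed.

(** Keeping only the end point [y] in the bound for [harm] gives [P(Z_T = y) <= q^-T / harm y].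
    Hence [exp (s * y) * P(Z_T = y)] is at most [exp ((r0 + eps) * T)] times the exponential of a
    sum of the terms [s - cost], whose mean [s - lam] is negative. *)
Lemma static_upper_moment_aux : s < lam ->
  exists2 t, 0 < t <= 1 & forall (T : nat) (y : int),
    (\int[mu]_w ((expR (s * y%:~R) * sev c w T \1_[set y] 0) `^ t)%:E <=
     (expR (t * (r0 + eps) * T%:R))%:E)%E.
Proof.
have [hs0 hr0 he0] := And3 s0 r00 eps0.
move=> slam; have [|t /andP[t0 t1] tN] := @affine_moment s (- 1); first by lra.
exists t; first by rewrite t0.
move=> T y.
have rT : 0 <= t * (r0 + eps) * T%:R.
  by rewrite !mulr_ge0 ?(ltW t0)//; lra.
have mP : measurable_fun setT (fun w =>
    ((expR (s * y%:~R) * sev c w T \1_[set y] 0) `^ t)%:E).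
  apply/measurable_EFinP; apply: (measurableT_comp (measurable_powR _)).
  by apply: measurable_funM => //; exact: measurable_sev.
(* At negative [y] the quantity is at most 1 because [0 <= s]; the costs are needed only to the
   right of the origin. *)
case: y mP => [N|k] mP; last first.
  apply: (@le_trans _ _ (\int[mu]_w 1%:E)%E); last first.
    by rewrite integral_prob_cst lee_fin (le_trans _ (expR_ge1Dx _))// lerDl.
  apply: ge0_le_integral => // w _; rewrite lee_fin ?powR_ge0//.
  apply: (@le_trans _ _ (1 `^ t)); last by rewrite powR1.
  apply: ge0_ler_powR; rewrite ?nnegrE ?(ltW t0)//.
    by rewrite mulr_ge0 ?expR_ge0 ?sev_indic_ge0.
  rewrite -[leRHS]mul1r; apply: ler_pM; rewrite ?expR_ge0 ?sev_indic_ge0 ?sev_indic_le1//.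
  rewrite expR_le1 NegzE mulrNz mulrN oppr_le0 mulr_ge0//.
pose H w := expR (t * \sum_(i < N) (s + - 1 * cost w i%:Z)).
have mH : measurable_fun setT H.
  apply: (measurableT_comp (@measurable_expR R)); apply: measurable_funM => //.
have mHE : measurable_fun setT (EFin \o H) by exact/measurable_EFinP.
have HE0 w : (0 <= (H w)%:E)%E by rewrite lee_fin expR_ge0.
apply: (@le_trans _ _ (\int[mu]_w ((expR (t * (r0 + eps) * T%:R))%:E * (H w)%:E))%E);
  last first.
  rewrite ge0_integralZl ?lee_fin ?expR_ge0//.
  rewrite -[leRHS]mule1; apply: lee_wpmul2l; first by rewrite lee_fin expR_ge0.
  exact: tN.
have mHk : measurable_fun setT
    (fun w => ((expR (t * (r0 + eps) * T%:R))%:E * (H w)%:E)%E).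
  exact: measurable_funeM.
apply: ge0_le_integral => //; first by move=> w _; rewrite lee_fin powR_ge0.
move=> w _; rewrite -EFinM lee_fin.
have wc := @clip_env_itv _ c w c2.
have h0 y : 0 <= harm q (clip_env c w) m y by exact: expR_ge0.
have := le_trans (sev_ge_at w c0 c2 T 0 N%:Z h0)
  (ev_harm_le q0 q1 c0 wc m 0 T 0).
rewrite harm0 mulr1 harmE qV -expRM_natl => hP.
have -> : expR (t * (r0 + eps) * T%:R) * H w =
    (expR (T%:R * (r0 + eps)) * expR (\sum_(i < N) (s + - 1 * cost w i%:Z))) `^ t.
  by rewrite /H -!expRD -expRM; congr expR; ring.
apply: ge0_ler_powR; rewrite ?nnegrE ?(ltW t0)//.
  by rewrite mulr_ge0 ?expR_ge0 ?sev_indic_ge0.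
have -> : \sum_(i < N) (s + - 1 * cost w i%:Z) = s * N%:R - \sum_(i < N) cost w i%:Z.
  rewrite big_split/= sumr_const card_ord mulr_natr -sumrN; congr (_ + _).
  by apply: eq_bigr => i _; rewrite mulN1r.
rewrite expRD mulrCA expRN -pmulrn; apply: ler_wpM2l; first exact: expR_ge0.
by rewrite ler_pdivlMr ?expR_gt0.
Qed.

End static_upper.

Lemma near_geometric_le (R : realType) (r K e : R) : 0 < r -> 0 <= K -> 0 < e ->
  exists m : nat, K * expR (- r) ^+ (2 * m) <= e.
Proof.
move=> r0 K0 e0.
have [m mK] := filter_ex (near_natr_gt (K / (e * r))).
exists m; rewrite -expRM_natl natrM mulrN expRN ler_pdivrMr ?expR_gt0//.
apply: (@le_trans _ _ (e * (1 + 2 * m%:R * r))); last first.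
  by rewrite ler_pM2l// expR_ge1Dx.
have : K <= m%:R * (e * r) by apply: ltW; rewrite -ltr_pdivrMr ?mulr_gt0.
have : 0 <= m%:R * (e * r) by rewrite mulr_ge0// mulr_ge0// ltW.
lra.
Qed.

Lemma static_upper_moment (R : realType) (alpha : probability (measurableTypeR R) R)
    (mu : probability (env R) R) (c : R) (I : R -> \bar R) (s r0 eps : R) :
  is_product_law alpha mu -> 0 < c -> c <= 2^-1 ->
  (forall u a : R, 0 <= u -> (a%:E < I u)%E ->
    {ae mu, forall w, \forall n \near \oo,
      sev c w n \1_[set z : int | u * n%:R <= z%:~R] 0 <= expR (- (a * n%:R))}) ->
  0 <= s -> 0 <= r0 -> 0 < eps ->
  (forall u, 0 <= u -> ((s * u - r0)%:E <= I u)%E) ->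
  exists2 t, 0 < t <= 1 & forall (T : nat) (y : int),
    (\int[mu]_w ((expR (s * y%:~R) * sev c w T \1_[set y] 0) `^ t)%:E <=
     (expR (t * (r0 + eps) * T%:R))%:E)%E.
Proof.
move=> muE c0 c2 S2 s0 r00 eps0 line.
have r0' : 0 < r0 + eps by lra.
have q1 : expR (- (r0 + eps)) ^+ 2 < 1.
  by rewrite exprn_ilt1 ?expR_ge0// expR_lt1 oppr_lt0.
have K0 : 0 <= (c * (1 - expR (- (r0 + eps)) ^+ 2))^-1.
  by rewrite invr_ge0 mulr_ge0 ?ltW// subr_gt0.
(* The truncation depth [m] is chosen to make the defect of [harm] smaller than this gap, which
   costs [eps / 4] in the growth rate. *)
have eta0 : 0 < (expR (- (r0 + eps)))^-1 - expR (r0 + eps - eps / 4).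
  by rewrite expRN invrK subr_gt0 ltr_expR; lra.
have [m mK] := near_geometric_le r0' K0 eta0.
apply: (static_upper_moment_aux muE c0 c2 s0 r00 eps0 (m := m)).
exact: (passage_rate_gt muE c0 c2 S2 s0 r00 eps0 line).
Qed.

(** * Convex rate functions and lines below them *)

Lemma closed_sublevel (R : realType) (I : R -> \bar R) :
  (forall a : R, compact [set x | (I x <= a%:E)%E]) ->
  forall a : R, closed [set x | (I x <= a%:E)%E].
Proof. by move=> Ic a; apply: compact_closed => //; exact: Rhausdorff. Qed.

Section convex_rate.
Context (R : realType) (I : R -> \bar R).
Hypotheses (I0 : forall x, (0 <= I x)%E) (Icvx : econvex I).
Hypothesis Iclosed : forall a : R, closed [set x | (I x <= a%:E)%E].
Hypotheses (Izero : I 0 = 0%E) (Ione : (I 1 < +oo)%E).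

Lemma rate_fin (x : R) : 0 <= x <= 1 -> I x = (fine (I x))%:E.
Proof.
move=> x01; rewrite fineK// ge0_fin_numE//.
have := Icvx 1 0 x01; rewrite mulr1 mulr0 addr0 Izero mule0 adde0 => /le_lt_trans.
by apply; rewrite lte_mul_pinfty// ?lee_fin ?fin_numE//; case/andP: x01.
Qed.

Lemma rate_mono (x y : R) : 0 <= x <= y -> (I x <= I y)%E.
Proof.
move=> /andP[x0 xy]; have [->//|xy'] := eqVneq x y.
have y0 : 0 < y by lra.
have t01 : 0 <= x / y <= 1 by apply/andP; split; [rewrite divr_ge0// ltW|rewrite ler_pdivrMr// mul1r].
have := Icvx y 0 t01; rewrite mulr0 addr0 divfK ?gt_eqF// Izero mule0 adde0.
move=> /le_trans; apply; rewrite -[leRHS]mul1e.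
by apply: lee_wpmul2r => //; rewrite lee_fin; case/andP: t01.
Qed.

Lemma rate_gt_left (x a : R) : 0 < x -> (a%:E < I x)%E ->
  exists2 y : R, 0 < y < x & (a%:E < I y)%E.
Proof.
move=> x0 ax; have := @Iclosed a; rewrite -openC => /(_ x).
have xC : (~` [set x | (I x <= a%:E)%E]) x by rewrite /=; apply/negP; rewrite -ltNge.
rewrite /interior => /(_ xC) /nbhs_ballP[e /= e0 eb].
exists (Num.max (x / 2) (x - e / 2)).
  by rewrite lt_max gt_max !divr_gt0//=; lra.
rewrite ltNge; apply/negP; apply: eb; rewrite /ball /= ltr_distlC.
set m := Num.max _ _.
have h1 : x - e / 2 <= m by rewrite le_max lexx orbT.
have h2 : m <= x by rewrite ge_max; lra.
by lra.
Qed.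

(** A supporting line at [x] itself could be vertical at [x = 1]. Instead [s] is the slope of the
    chord from [y] to [x], with [y < x] so close that [a < I y], and the line passes through height
    [a] at [x]. Left of [y] and right of [x] convexity puts [I] above the extended chord; in between
    monotonicity gives [a < I y <= I u]. *)
Lemma rate_supporting_line (x a : R) : 0 < x <= 1 -> (a%:E < I x)%E ->
  exists s r : R, [/\ 0 <= s, s * x - r = a &
    forall u, 0 <= u -> ((s * u - r)%:E <= I u)%E].
Proof.
move=> /andP[x0 x1] ax; have [y /andP[y0 yx] ay] := rate_gt_left x0 ax.
have Ix : I x = (fine (I x))%:E by apply: rate_fin; lra.
have Iy : I y = (fine (I y))%:E by apply: rate_fin; lra.
have yfx : fine (I y) <= fine (I x).
  by rewrite -lee_fin -Ix -Iy; apply: rate_mono; lra.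
move: ax ay; rewrite Ix Iy !lte_fin => ax ay.
set fx := fine (I x) in Ix ax yfx; set fy := fine (I y) in Iy ay yfx.
pose s := (fx - fy) / (x - y).
have xy0 : 0 < x - y by lra.
have s0 : 0 <= s by apply: divr_ge0; lra.
have sE : s * (x - y) = fx - fy by rewrite divfK// gt_eqF.
exists s, (s * x - a); split=> //; first by ring.
move=> u u0; have [Iu|Iu] := eqVneq (I u) +oo%E; first by rewrite Iu leey.
have Iu' : I u = (fine (I u))%:E by rewrite fineK// ge0_fin_numE// ltey.
rewrite Iu' lee_fin; set fu := fine (I u).
have [uy|yu] := leP u y.
  have [uy'|uy'] := eqVneq u y.
    have -> : fu = fy by rewrite /fu uy'.
    by rewrite uy'; lra.
  have xu : 0 < x - u by lra.
  pose t := (y - u) / (x - u).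
  have t01 : 0 <= t <= 1.
    by apply/andP; split; [apply: divr_ge0; lra|rewrite ler_pdivrMr//; lra].
  have := Icvx x u t01; rewrite Ix Iu' -!EFinM -EFinD.
  have -> : t * x + (1 - t) * u = y by rewrite /t; field; rewrite gt_eqF.
  rewrite Iy lee_fin -/fx -/fy -/fu => h.
  have tE : t * (x - u) = y - u by rewrite divfK// gt_eqF.
  have h' : (x - u) * fy <= (x - u) * (t * fx + (1 - t) * fu) by rewrite ler_pM2l.
  have E : (x - u) * (t * fx + (1 - t) * fu) = (y - u) * fx + (x - y) * fu.
    transitivity (t * (x - u) * fx + (x - u - t * (x - u)) * fu); first by ring.
    by rewrite tE; ring.
  have h2 : (x - y) * (fx - s * (x - u)) <= (x - y) * fu.
    have -> : (x - y) * (fx - s * (x - u)) = (x - y) * fx - (s * (x - y)) * (x - u) by ring.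
    rewrite sE; rewrite E in h'; lra.
  by move: h2; rewrite ler_pM2l//; lra.
have [ux|xu] := ltP u x.
  have : (I y <= I u)%E by apply: rate_mono; lra.
  rewrite Iy Iu' lee_fin -/fy -/fu => h.
  have : 0 <= s * (x - u) by rewrite mulr_ge0//; lra.
  lra.
have uy : 0 < u - y by lra.
pose t := (x - y) / (u - y).
have t01 : 0 <= t <= 1.
    by apply/andP; split; [apply: divr_ge0; lra|rewrite ler_pdivrMr//; lra].
have := Icvx u y t01; rewrite Iy Iu' -!EFinM -EFinD.
have -> : t * u + (1 - t) * y = x by rewrite /t; field; rewrite gt_eqF.
rewrite Ix lee_fin -/fx -/fy -/fu => h.
have tE : t * (u - y) = x - y by rewrite divfK// gt_eqF.
have h' : (u - y) * fx <= (u - y) * (t * fu + (1 - t) * fy) by rewrite ler_pM2l.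
have E : (u - y) * (t * fu + (1 - t) * fy) = (x - y) * fu + (u - x) * fy.
  transitivity (t * (u - y) * fu + (u - y - t * (u - y)) * fy); first by ring.
  by rewrite tE; ring.
have h2 : (x - y) * (fx + s * (u - x)) <= (x - y) * fu.
  have -> : (x - y) * (fx + s * (u - x)) = (x - y) * fx + (s * (x - y)) * (u - x) by ring.
  rewrite sE; rewrite E in h'; lra.
by move: h2; rewrite ler_pM2l//; lra.
Qed.

Lemma rate_line_intercept_ge0 (s r : R) :
  (forall u, 0 <= u -> ((s * u - r)%:E <= I u)%E) -> 0 <= r.
Proof. by move=> /(_ 0 (lexx _)); rewrite Izero mulr0 sub0r lee_fin oppr_le0. Qed.

End convex_rate.

(** * Moment bounds for the static walk from below *)

Section chaining.
Context (R : realType) (c : R).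
Hypotheses (c0 : 0 < c) (c2 : c <= 2^-1).

Lemma sev_shift_at (w : env R) n x y :
  sev c w n \1_[set x + y] x = sev c (shift_env x w) n \1_[set y] 0.
Proof.
rewrite -[X in sev _ _ _ _ X = _]add0r -sev_shift; congr sev.
apply/funext => z; rewrite !indicE; congr (_%:R); congr nat_of_bool.
by apply/idP/idP; rewrite !inE /=; [rewrite addrC => /addrI|move=> ->; rewrite addrC].
Qed.

Lemma sev_chain (w : env R) n m x y z :
  sev c w n \1_[set y] x * sev c w m \1_[set z] y <= sev c w (n + m) \1_[set z] x.
Proof.
by rewrite sev_add; apply: sev_ge_at => // u; apply: sev_indic_ge0.
Qed.

Lemma sev_blocks (w : env R) (L d J : nat) :
  \prod_(i < J) sev c (shift_env (i * d)%N%:Z w) L \1_[set d%:Z] 0 <=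
  sev c w (J * L) \1_[set (J * d)%N%:Z] 0.
Proof.
elim: J => [|J IH]; first by rewrite big_ord0 !mul0n /sev /= indicE mem_set.
rewrite big_ord_recr /= mulSnr.
apply: le_trans (sev_chain w (J * L) L 0 (J * d)%N%:Z _).
apply: ler_pM => //.
- by apply: prodr_ge0 => i _; exact: sev_indic_ge0.
- exact: sev_indic_ge0.
by rewrite -sev_shift_at mulSnr PoszD.
Qed.

End chaining.

Section one_block.
Context (R : realType) (c : R).
Hypotheses (c0 : 0 < c) (c2 : c <= 2^-1).

Lemma sev_elliptic_even (w : env R) (K D : nat) : (D <= K)%N ->
  c ^+ (2 * K) <= sev c w (2 * K) \1_[set (2 * D)%N%:Z] 0.
Proof.
move=> DK; have := sev_elliptic w c0 c2 (K + D) (K - D) 0.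
have -> : (K + D + (K - D) = 2 * K)%N by lia.
by have -> : 0 + (K + D)%N%:Z - (K - D)%N%:Z = (2 * D)%N%:Z by lia.
Qed.

(** With [x] steps up among [2E] the walk is at [2 * (x - E)], at distance [2 * |D + E - x|] from
    the target. Even durations and an even target remove the parity obstruction, and ellipticity
    pays [c ^ (2j)] for the correction. *)
Lemma sev_window_le (w : env R) (E j D : nat) (v e : R) :
  (forall x y : nat, (x + y = 2 * E)%N ->
    `|(x%:Z - y%:Z)%:~R - v * (2 * E)%:R| <= e ->
    `|(D%:Z + E%:Z) - x%:Z| <= j%:Z) ->
  c ^+ (2 * j) * sev c w (2 * E) \1_[set z : int | `|z%:~R - v * (2 * E)%:R| <= e] 0 <=
  sev c w (2 * E + 2 * j) \1_[set (2 * D)%N%:Z] 0.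
Proof.
move=> h; rewrite sev_add /sev -evZ; apply: sev_le => // x y xy.
rewrite indicE; have [|_] := boolP (_ \in _); last first.
  by rewrite mulr0; exact: sev_indic_ge0.
rewrite inE /= add0r mulr1 => /(h _ _ xy) => {}h.
have [a [b [ab abz]]] : exists a b : nat, (a + b = 2 * j)%N /\
    x%:Z - y%:Z + a%:Z - b%:Z = (2 * D)%N%:Z.
  exists (absz (j%:Z + D%:Z + E%:Z - x%:Z)%R), (absz (j%:Z - D%:Z - E%:Z + x%:Z)%R).
  by lia.
by have := sev_elliptic w c0 c2 a b (x%:Z - y%:Z); rewrite ab abz.
Qed.

End one_block.

Lemma dist_le_of_bounds (D E x j : nat) : (D + E <= j + x)%N -> (x <= j + D + E)%N ->
  `|D%:Z + E%:Z - x%:Z| <= j%:Z.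
Proof. by lia. Qed.

Lemma expR_ln_exp (R : realType) (c : R) n : 0 < c -> c ^+ n = expR (n%:R * ln c).
Proof. by move=> c0; rewrite expRM_natl lnK ?posrE. Qed.

Section static_lower.
Context (R : realType) (alpha : probability (measurableTypeR R) R).
Context (mu : probability (env R) R) (c v a1 a delta : R).
Hypotheses (muE : is_product_law alpha mu) (c0 : 0 < c) (c2 : c <= 2^-1).
Hypotheses (v0 : 0 < v) (v1 : v < 1) (a10 : 0 <= a1) (a1a : a1 < a).
Hypothesis delta0 : 0 < delta.
Hypothesis static_lower : forall e : R, 0 < e ->
  {ae mu, forall w, \forall n \near \oo, expR (- (a1 * n%:R)) <=
    sev c w n \1_[set z : int | `|z%:~R - v * n%:R| <= e * n%:R] 0}.

Let l := - ln c.

Let l0 : 0 < l.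
Proof.
have := c2; have := c0; rewrite /l oppr_gt0 => h1 h2; apply: ln_lt0.
by rewrite h1/=; lra.
Qed.

(* In a typical environment the LDP and ellipticity give the bound with room to
   spare; in the remaining ones the integrand is at most [c^-1]. *)
Lemma good_block : exists L d : nat, [/\ (0 < d <= L)%N, (0 < L)%N,
  `|d%:R - v * L%:R| <= delta * L%:R,
  (forall w : env R, c ^+ L <= sev c w L \1_[set d%:Z] 0) &
  (\int[mu]_w (expR (- ln (sev c w L \1_[set d%:Z] 0) / L%:R))%:E <= (expR a)%:E)%E].
Proof.
have [hc0 hc2 hv0] := And3 c0 c2 v0; have [hv1 ha10 ha1a] := And3 v1 a10 a1a.
have [hd hl] := conj delta0 l0.
pose a2 := (a1 + a) / 2.
have a12 : 0 < a2 - a1 by rewrite /a2; lra.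
have a2a : a2 < a by rewrite /a2; lra.
(* A fraction [1 / k] of the block is spent on correcting the end point, at cost [l] per step; this
   must fit between [a1] and [a2]. *)
have [k [k2 kl]] : exists k : nat, (1 < k)%N /\ l <= (a2 - a1) * k%:R.
  exists (Num.truncn (l / (a2 - a1))).+2; split=> //.
  rewrite mulrC -ler_pdivrMr//.
  have /andP[_ /ltW h] := truncn_itv (divr_ge0 (ltW hl) (ltW a12)).
  by apply: le_trans h _; rewrite ler_nat.
have k1 : 1 <= k%:R :> R by rewrite ler1n ltnW.
(* After the free part the walk is within [(1 - v) * j] of [2 * v * E], which lies [2 * v * j]
   before the ideal target. With 2 more for rounding, this fits into [2j] steps exactly when
   [2 <= (1 - v) * j], one of the conditions imposed on [j] below. *)
pose e := (1 - v) / (2 * k%:R).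
have e0 : 0 < e by rewrite divr_gt0 ?mulr_gt0//; lra.
(* The admissible probability of bad environments: the integrand is at most [expR l] there and
   [expR a2] elsewhere, so that the mean is at most [expR a2 + expR l * p0 = expR a]. *)
pose p0 := (expR a - expR a2) * expR (- l).
have p00 : 0 < p0 by rewrite mulr_gt0 ?expR_gt0// subr_gt0 ltr_expR.
pose Gd n := [set w : env R | expR (- (a1 * n%:R)) <=
    sev c w n \1_[set z : int | `|z%:~R - v * n%:R| <= e * n%:R] 0].
have mG n : measurable (Gd n).
  rewrite -[X in measurable X]setTI; apply: measurable_fun_ler => //.
  exact: measurable_sev.
have [N _ hN] := ae_eventually_measure mG p00 (static_lower e0).
have [j [jN jv jvk jd]] : exists j : nat, [/\ (N <= j)%N, 2 <= (1 - v) * j%:R,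
    1 <= v * j%:R & 1 <= delta * j%:R].
  have hv : 0 < 1 - v by lra.
  have : \forall j \near \oo, [/\ (N <= j)%N, 2 <= (1 - v) * j%:R,
    1 <= v * j%:R & 1 <= delta * j%:R].
    apply: filter_app (near_natr_gt (2 / (1 - v))).
    apply: filter_app (near_natr_gt (1 / v)).
    apply: filter_app (near_natr_gt (1 / delta)).
    exists N => // n /= Nn h1 h2 h3; split=> //.
    - by rewrite mulrC -ler_pdivrMr// ltW.
    - by rewrite mulrC -ler_pdivrMr// ltW.
    - by rewrite mulrC -ler_pdivrMr// ltW.
  by move=> /filter_ex.
have j0 : (0 < j)%N.
  by rewrite lt0n; apply/eqP => j0; move: jv; rewrite j0 mulr0; lra.
have j0' : 0 < j%:R :> R by rewrite ltr0n.
(* The block of length [L = 2kj] consists of [2E] free steps and [2j] correcting steps. *)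
have [E [EkE jE]] : exists E, (E + j = k * j)%N /\ (j <= E)%N.
  exists (k.-1 * j)%N; rewrite -mulSnr prednK ?(ltnW k2)//; split=> //.
  by rewrite leq_pmull// -ltnS prednK// ltnW.
pose x := v * (k * j)%:R.
have x0 : 0 <= x by rewrite mulr_ge0// ltW.
pose D := Num.truncn x.
have /andP[D1 D2] : D%:R <= x < D.+1%:R := truncn_itv x0.
rewrite -natr1 in D2.
have kj : (k * j)%:R = k%:R * j%:R :> R by rewrite natrM.
have Er : E%:R = k%:R * j%:R - j%:R :> R by rewrite -kj -EkE natrD addrK.
have jk : j%:R <= k%:R * j%:R :> R by rewrite ler_peMl// ltW.
have xj : 1 <= x.
  by apply: le_trans jvk _; rewrite /x kj; apply: ler_wpM2l => //; exact: ltW.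
have D0 : (0 < D)%N by rewrite -(ltr_nat R); lra.
have Dkj : (D <= k * j)%N.
  rewrite -(ler_nat R); apply: (le_trans D1); rewrite /x ler_piMl//; exact: ltW.
pose L := (2 * (k * j))%N.
have LE : L = (2 * E + 2 * j)%N by rewrite -mulnDr EkE.
have L0 : (0 < L)%N by rewrite /L !muln_gt0 j0 (ltnW k2).
have L0' : 0 < L%:R :> R by rewrite ltr0n.
have Lr : L%:R = 2 * (k%:R * j%:R) :> R by rewrite /L natrM kj.
have lbd (w : env R) : c ^+ L <= sev c w L \1_[set (2 * D)%N%:Z] 0.
  exact: sev_elliptic_even.
exists L, (2 * D)%N; split=> //.
- by rewrite muln_gt0 D0 leq_mul2l Dkj orbT.
- rewrite natrM Lr ler_norml.
  have : 1 <= delta * (k%:R * j%:R).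
    by apply: le_trans jd _; apply: ler_wpM2l => //; exact: ltW.
  by move: D1 D2; rewrite /x kj; lra.
pose W n := [set z : int | `|z%:~R - v * n%:R| <= e * n%:R].
have good w : Gd (2 * E)%N w -> expR (- (a2 * L%:R)) <= sev c w L \1_[set (2 * D)%N%:Z] 0.
  move=> Gw; rewrite LE.
  apply: le_trans (sev_window_le hc0 hc2 w (E := E) (j := j) (D := D) (v := v)
    (e := e * (2 * E)%:R) _); last first.
    move=> y z yz; rewrite ler_norml => /andP[h1 h2].
    have zE : z%:R = 2 * E%:R - y%:R :> R by rewrite -(natrM _ 2) -yz natrD addrAC subrr add0r.
    rewrite rmorphB/= -!pmulrn zE natrM in h1 h2.
    have eE : e * (2 * E%:R) <= (1 - v) * j%:R.
      have -> : (1 - v) * j%:R = e * (2 * (k%:R * j%:R)).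
        by rewrite /e; field; rewrite lt0r_neq0//; lra.
      apply: ler_wpM2l; first exact: ltW.
      by rewrite Er; lra.
    have B1 : D%:R + E%:R - y%:R <= j%:R :> R.
      move: h1 h2 D1 D2 eE jv; rewrite /x kj Er.
      have : v * (2 * (k%:R * j%:R - j%:R)) = 2 * (v * (k%:R * j%:R)) - 2 * (v * j%:R) by ring.
      lra.
    have B2 : y%:R - E%:R - D%:R <= j%:R :> R.
      move: h1 h2 D1 D2 eE jv; rewrite /x kj Er.
      have : v * (2 * (k%:R * j%:R - j%:R)) = 2 * (v * (k%:R * j%:R)) - 2 * (v * j%:R) by ring.
      lra.
    have C1 : (D + E <= j + y)%N by rewrite -(ler_nat R) !natrD -lerBlDr.
    have C2 : (y <= j + D + E)%N by rewrite -(ler_nat R) !natrD -!lerBlDr.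
    exact: dist_le_of_bounds.
  apply: le_trans (_ : c ^+ (2 * j) * expR (- (a1 * (2 * E)%:R)) <= _); last first.
    by apply: ler_wpM2l; [exact/exprn_ge0/ltW|exact: Gw].
  rewrite expR_ln_exp// -expRD ler_expR -LE Lr !natrM Er.
  have : ln c = - l by rewrite /l opprK.
  move=> ->; have : l * j%:R <= (a2 - a1) * k%:R * j%:R by apply: ler_wpM2r => //; exact: ltW.
  have : 0 <= a1 * j%:R by rewrite mulr_ge0// ltW.
  lra.
have PG : (mu (~` Gd (2 * E)%N) <= p0%:E)%E.
  apply: hN => /=; apply: (leq_trans jN).
  by apply: (leq_trans jE); rewrite leq_pmull.
have mGC : measurable (~` Gd (2 * E)%N) by exact: measurableC.
have mP : measurable_fun setT (fun w : env R => sev c w L \1_[set (2 * D)%N%:Z] 0).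
  exact: measurable_sev.
apply: (@le_trans _ _ (\int[mu]_w ((expR a2)%:E + (expR l)%:E * (\1_(~` Gd (2 * E)%N) w)%:E))%E).
  apply: ge0_le_integral => //.
  - apply/measurable_EFinP; apply: (measurableT_comp (@measurable_expR R)).
    apply: measurable_funM => //.
    apply: (@measurableT_comp _ _ _ _ _ _ (@GRing.opp R)) => //.
    exact: (measurableT_comp (@measurable_ln R)).
  - apply: emeasurable_funD => //; apply: measurable_funeM.
    by apply/measurable_EFinP; exact: measurable_indic.
  - move=> w _; rewrite -EFinM -EFinD lee_fin.
    have P0 : 0 < sev c w L \1_[set (2 * D)%N%:Z] 0.
      by apply: lt_le_trans (lbd w); rewrite exprn_gt0.
    rewrite indicE; have [Gw|Gw] := pselect (Gd (2 * E)%N w).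
      rewrite memNset; last by move=> /(_ Gw).
      rewrite mulr0 addr0 ler_expR ler_pdivrMr// lerNl.
      by rewrite -ler_expR lnK ?posrE//; exact: good.
    rewrite mem_set// mulr1; apply: ler_wpDl; first exact: expR_ge0.
    rewrite ler_expR ler_pdivrMr// lerNl -ler_expR [leRHS]lnK ?posrE//.
    apply: le_trans (lbd w); rewrite expR_ln_exp// ler_expR /l.
    by rewrite mulNr opprK mulrC.
have mI : measurable_fun setT (fun w : env R => (\1_(~` Gd (2 * E)%N) w : R)%:E).
  by apply/measurable_EFinP; exact: measurable_indic.
have mIl : measurable_fun setT (fun w : env R =>
    ((expR l)%:E * (\1_(~` Gd (2 * E)%N) w)%:E)%E) by exact: measurable_funeM.
have Il0 (w : env R) : (0 <= (expR l)%:E * (\1_(~` Gd (2 * E)%N) w)%:E)%E.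
  by rewrite mule_ge0// lee_fin ?expR_ge0.
have el0 : (0 <= (expR l)%:E)%E by rewrite lee_fin expR_ge0.
have ea0 : (0 <= (expR a2)%:E)%E by rewrite lee_fin expR_ge0.
rewrite ge0_integralD// integral_prob_cst ge0_integralZl//.
rewrite integral_indic// setIT.
apply: (@le_trans _ _ ((expR a2)%:E + (expR l)%:E * p0%:E)%E).
  by apply: leeD2l; apply: lee_wpmul2l => //; rewrite lee_fin expR_ge0.
rewrite -EFinM -EFinD lee_fin /p0 mulrCA -expRD subrr expR0 mulr1.
by rewrite addrCA subrr addr0.
Qed.

End static_lower.

Lemma uphalf_half_add r : (uphalf r + half r = r)%N.
Proof. by lia. Qed.

Lemma uphalf_half_sub r (x : int) :
  x + (uphalf r)%:Z - (half r)%:Z = x + (r %% 2)%N%:Z.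
Proof. by lia. Qed.

Lemma far_windows (i j d L : nat) (x : int) : (0 < d)%N -> (i + L.*2.+1 <= j)%N ->
  `|x - (i * d)%N%:Z| <= L%:Z -> `|x - (j * d)%N%:Z| <= L%:Z -> False.
Proof.
move=> d0 ij h1 h2.
have : (i * d + L.*2.+1 <= j * d)%N.
  apply: leq_trans (_ : ((i + L.*2.+1) * d <= _)%N); last by rewrite leq_mul2r ij orbT.
  by rewrite mulnDl leq_add2l leq_pmulr.
by move: h1 h2; set a := (i * d)%N; set b := (j * d)%N; lia.
Qed.

Section block_paths.
Context (R : realType) (alpha : probability (measurableTypeR R) R).
Context (mu : probability (env R) R) (c v a delta : R).
Hypotheses (muE : is_product_law alpha mu) (c0 : 0 < c) (c2 : c <= 2^-1).
Hypotheses (v0 : 0 < v) (v1 : v < 1) (a0 : 0 <= a) (delta0 : 0 < delta).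
Variables L d : nat.
Hypotheses (d0 : (0 < d)%N) (dL : (d <= L)%N).
Hypothesis dv : `|d%:R - v * L%:R| <= delta * L%:R.
Hypothesis lbd : forall w : env R, c ^+ L <= sev c w L \1_[set d%:Z] 0.
Hypothesis block_moment :
  (\int[mu]_w (expR (- ln (sev c w L \1_[set d%:Z] 0) / L%:R))%:E <= (expR a)%:E)%E.

Let L0 : (0 < L)%N. Proof. exact: leq_trans dL. Qed.
Let L0' : 0 < L%:R :> R. Proof. by rewrite ltr0n. Qed.

(* End point after [T] steps: [T %/ L] blocks, then a remainder spent in place. *)
Definition block_target (T : nat) : int := (T %/ L * d + (T %% L) %% 2)%N.

Let block (w : env R) (i : nat) : R :=
  sev c (shift_env (i * d)%N%:Z w) L \1_[set d%:Z] 0.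

Let block_gt0 w i : 0 < block w i.
Proof. by apply: lt_le_trans (lbd _); rewrite exprn_gt0. Qed.

Let remainder_le (w : env R) (r : nat) (x : int) :
  c ^+ r <= sev c w r \1_[set x + (r %% 2)%N%:Z] x.
Proof.
have := sev_elliptic w c0 c2 (uphalf r) (half r) x.
by rewrite uphalf_half_add uphalf_half_sub.
Qed.

Lemma block_target_prob (w : env R) (T : nat) :
  (\prod_(i < T %/ L) block w i) * c ^+ (T %% L) <=
  sev c w T \1_[set block_target T] 0.
Proof.
rewrite [X in sev c w X _ _](divn_eq T L).
apply: le_trans (sev_chain c0 c2 w (T %/ L * L) (T %% L) 0 (T %/ L * d)%N%:Z _).
apply: ler_pM.
- by apply: prodr_ge0 => i _; exact/ltW.
- by rewrite exprn_ge0// ltW.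
- exact: sev_blocks.
- by rewrite /block_target PoszD; exact: remainder_le.
Qed.

Lemma block_target_elliptic (w : env R) (T : nat) :
  c ^+ T <= sev c w T \1_[set block_target T] 0.
Proof.
apply: le_trans (block_target_prob w T).
rewrite [X in c ^+ X](divn_eq T L) exprD; apply: ler_wpM2r; first by rewrite exprn_ge0// ltW.
have -> : c ^+ (T %/ L * L) = \prod_(i < T %/ L) c ^+ L.
  by rewrite prodr_const card_ord -exprM mulnC.
by apply: ler_prod => i _; apply/andP; split; [exact/exprn_ge0/ltW|exact: lbd].
Qed.

Lemma block_target_dist (T : nat) :
  `|(block_target T)%:~R - v * T%:R| <= delta * T%:R + L.+1%:R.
Proof.
have [hv0 hv1 hd0] := And3 v0 v1 delta0.
pose J := (T %/ L)%N; pose r := (T %% L)%N.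
have TE : T%:R = J%:R * L%:R + r%:R :> R by rewrite {1}(divn_eq T L) natrD natrM.
have YE : (block_target T)%:~R = J%:R * d%:R + (r %% 2)%N%:R :> R.
  by rewrite /block_target -pmulrn natrD natrM.
have -> : (block_target T)%:~R - v * T%:R =
    J%:R * (d%:R - v * L%:R) + ((r %% 2)%N%:R - v * r%:R).
  by rewrite YE TE; ring.
apply: (le_trans (ler_normD _ _)); apply: lerD.
  rewrite normrM ger0_norm//; apply: (@le_trans _ _ (J%:R * (delta * L%:R))).
    exact: ler_wpM2l.
  have : 0 <= delta * r%:R by rewrite mulr_ge0// ltW.
  by rewrite TE; lra.
have r1 : (r %% 2)%N%:R <= 1 :> R by rewrite -[leRHS]/(1%:R) ler_nat -ltnS ltn_pmod.
have r2 : r%:R <= L%:R :> R by rewrite ler_nat ltnW// ltn_pmod.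
have r0 : 0 <= (r %% 2)%N%:R :> R by [].
have : 0 <= v * r%:R by rewrite mulr_ge0// ltW.
have : v * r%:R <= 1 * r%:R by apply: ler_wpM2r => //; exact: ltW.
rewrite -natr1 ler_norml; lra.
Qed.

Let M := L.*2.+1.
Let M0 : 0 < M%:R :> R. Proof. by rewrite ltr0n. Qed.

Let g (i : nat) (w : env R) : R := (- ln (block w i) / L%:R - a) / M%:R.

Let measurable_block i : measurable_fun setT (block ^~ i).
Proof.
have ms : measurable_fun setT (fun w : env R => sev c w L \1_[set d%:Z] 0).
  exact: measurable_sev.
by apply: (measurableT_comp ms); exact: measurable_shift_env.
Qed.

Let measurable_g i : measurable_fun setT (g i).
Proof.
apply: measurable_funM => //; apply: measurable_funB => //.
apply: measurable_funM => //.
apply: (@measurableT_comp _ _ _ _ _ _ (@GRing.opp R)) => //.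
exact: (measurableT_comp (@measurable_ln R)).
Qed.

Let g_moment N : (\int[mu]_w (expR (\sum_(i < N) g i w))%:E <= 1)%E.
Proof.
apply: (@integral_exp_dependent_sum _ _ _ _ _ _ muE g
  (fun i z => `|z - (i * d)%N%:Z| <= L%:Z) M N) => //.
- move=> i w w' ww'; rewrite /g /block; congr ((- ln _ / _ - _) / _).
  apply: depends_on_sev => z zL; apply: ww' => /=.
  by move: zL; rewrite subr0 addrK.
- by move=> i j x ij; apply/negP => /andP[]; exact: far_windows.
- move=> i; pose F (w : env R) := expR (- ln (sev c w L \1_[set d%:Z] 0) / L%:R - a).
  have mF : measurable_fun setT F.
    apply: (measurableT_comp (@measurable_expR R)); apply: measurable_funB => //.
    apply: measurable_funM => //.
    apply: (@measurableT_comp _ _ _ _ _ _ (@GRing.opp R)) => //.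
    apply: (measurableT_comp (@measurable_ln R)); exact: measurable_sev.
  rewrite (eq_integral (fun w => (F (shift_env (i * d)%N%:Z w))%:E)); last first.
    move=> w _; congr (expR _)%:E; rewrite /g mulrC divfK//.
    exact: lt0r_neq0.
  rewrite (integral_shift_env muE _ mF); last by move=> w; exact: expR_ge0.
  have mX : measurable_fun setT (fun w : env R =>
      (expR (- ln (sev c w L \1_[set d%:Z] 0) / L%:R))%:E).
    apply/measurable_EFinP; apply: (measurableT_comp (@measurable_expR R)).
    apply: measurable_funM => //.
    apply: (@measurableT_comp _ _ _ _ _ _ (@GRing.opp R)) => //.
    apply: (measurableT_comp (@measurable_ln R)); exact: measurable_sev.
  rewrite (eq_integral (fun w : env R => (expR (- a))%:E *
      (expR (- ln (sev c w L \1_[set d%:Z] 0) / L%:R))%:E)%E); last first.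
    by move=> w _; rewrite -EFinM -expRD /F addrC.
  have X0 (w : env R) : (0 <= (expR (- ln (sev c w L \1_[set d%:Z] 0) / L%:R))%:E)%E.
    by rewrite lee_fin expR_ge0.
  have ea0 : (0 <= (expR (- a))%:E)%E by rewrite lee_fin expR_ge0.
  rewrite ge0_integralZl//; apply: le_trans (lee_wpmul2l ea0 block_moment) _.
  by rewrite -EFinM -expRD addNr expR0.
Qed.

Lemma block_target_moment : exists t C : R, [/\ 0 < t, 0 < C &
  forall T, (\int[mu]_w ((sev c w T \1_[set block_target T] 0) `^ (- t))%:E <=
    (C * expR (t * a * T%:R))%:E)%E].
Proof.
have [ha0 hc0 hc2] := And3 a0 c0 c2.
(* The factor [1 / L] is the exponent in [block_moment]; [1 / M] is the price of dependence, since
   blocks with indices less than [M] apart may read common sites. *)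
pose t : R := (M%:R * L%:R)^-1.
have t0 : 0 < t by rewrite invr_gt0 mulr_gt0.
have lc0 : 0 < - ln c by rewrite oppr_gt0 ln_lt0// hc0; lra.
(* This is [c] to the power [- t * L], the worst cost of the fewer than [L] steps left after the
   last full block. *)
pose C : R := expR (t * (L%:R * - ln c)).
exists t, C; split=> [//||T]; first exact: expR_gt0.
pose J := (T %/ L)%N; pose r := (T %% L)%N.
pose H w := expR (\sum_(i < J) g i w).
have mH : measurable_fun setT H.
  by apply: (measurableT_comp (@measurable_expR R)); exact: measurable_sum.
have mHE : measurable_fun setT (EFin \o H) by exact/measurable_EFinP.
have K0 : 0 <= C * expR (t * a * T%:R) by rewrite mulr_ge0 ?expR_ge0.
apply: (@le_trans _ _ (\int[mu]_w ((C * expR (t * a * T%:R))%:E * (H w)%:E))%E);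
  last first.
  have HE0 w : (0 <= (H w)%:E)%E by rewrite lee_fin expR_ge0.
  rewrite ge0_integralZl ?lee_fin//.
  by rewrite -[leRHS]mule1; apply: lee_wpmul2l => //; exact: g_moment.
have mHk : measurable_fun setT (fun w => ((C * expR (t * a * T%:R))%:E * (H w)%:E)%E).
  exact: measurable_funeM.
have mP : measurable_fun setT (fun w : env R =>
    ((sev c w T \1_[set block_target T] 0) `^ (- t))%:E).
  apply/measurable_EFinP; apply: (measurableT_comp (measurable_powR _)).
  exact: measurable_sev.
apply: ge0_le_integral => //; first by move=> w _; rewrite lee_fin powR_ge0.
move=> w _; rewrite -EFinM lee_fin.
have B0 : 0 < (\prod_(i < J) block w i) * c ^+ r.
  by rewrite mulr_gt0 ?exprn_gt0//; apply: prodr_gt0 => i _; exact: block_gt0.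
have P0 := lt_le_trans B0 (block_target_prob w T).
apply: (@le_trans _ _ (((\prod_(i < J) block w i) * c ^+ r) `^ (- t))).
  rewrite !powRN lef_pV2 ?posrE ?powR_gt0//.
  apply: ge0_ler_powR; rewrite ?nnegrE ?(ltW t0) ?(ltW B0) ?(ltW P0)//.
  exact: block_target_prob.
have pE : (\prod_(i < J) block w i) * c ^+ r =
    expR (\sum_(i < J) ln (block w i) + r%:R * ln c).
  rewrite expRD expR_sum expR_ln_exp//; congr (_ * _).
  by apply: eq_bigr => i _; rewrite lnK ?posrE.
rewrite pE -expRM /H /C -!expRD ler_expR.
have gE : \sum_(i < J) g i w = - t * \sum_(i < J) ln (block w i) - t * a * (J%:R * L%:R).
  have -> : t * a * (J%:R * L%:R) = \sum_(i < J) a / M%:R.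
    rewrite sumr_const card_ord -[RHS]mulr_natl /t.
    by field; rewrite !lt0r_neq0.
  rewrite mulr_sumr -sumrB; apply: eq_bigr => i _; rewrite /g /t.
  by field; rewrite !lt0r_neq0.
rewrite gE.
have TE : T%:R = J%:R * L%:R + r%:R :> R by rewrite {1}(divn_eq T L) natrD natrM.
have rL : r%:R <= L%:R :> R by rewrite ler_nat ltnW// ltn_pmod.
have h1 : 0 <= t * a * r%:R by rewrite !mulr_ge0// ltW.
have h2 : t * (r%:R * - ln c) <= t * (L%:R * - ln c).
  by rewrite ler_pM2l// ler_pM2r.
rewrite TE; lra.
Qed.

End block_paths.

Lemma static_lower_moment (R : realType) (alpha : probability (measurableTypeR R) R)
    (mu : probability (env R) R) (c v a1 a delta : R) :
  is_product_law alpha mu -> 0 < c -> c <= 2^-1 -> 0 < v -> v < 1 -> 0 <= a1 -> a1 < a ->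
  0 < delta ->
  (forall e : R, 0 < e ->
    {ae mu, forall w, \forall n \near \oo, expR (- (a1 * n%:R)) <=
      sev c w n \1_[set z : int | `|z%:~R - v * n%:R| <= e * n%:R] 0}) ->
  exists (t C : R) (Y : nat -> int), [/\ 0 < t, 0 < C,
    forall T, `|(Y T)%:~R - v * T%:R| <= delta * T%:R + C,
    forall (w : env R) T, c ^+ T <= sev c w T \1_[set Y T] 0 &
    forall T, (\int[mu]_w ((sev c w T \1_[set Y T] 0) `^ (- t))%:E <=
      (C * expR (t * a * T%:R))%:E)%E].
Proof.
move=> muE c0 c2 v0 v1 a10 a1a delta0 S1.
have [L [d [/andP[d0 dL] L0 dv lbd mom]]] :=
  good_block c0 c2 v0 v1 a10 a1a delta0 S1.
have a0 : 0 <= a by lra.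
have [t [C [t0 C0 tC]]] := block_target_moment muE c0 c2 a0 d0 dL lbd mom.
exists t, (Num.max C L.+1%:R), (block_target L d); split=> //.
- by rewrite lt_max C0.
- move=> T; apply: (le_trans (block_target_dist v0 v1 delta0 d0 dL dv T)).
  by rewrite lerD2l le_max lexx orbT.
- by move=> w T; exact: block_target_elliptic.
- move=> T; apply: (le_trans (tC T)); rewrite lee_fin ler_wpM2r ?expR_ge0//.
  by rewrite le_max lexx.
Qed.

(** * The cooling walk *)

(** The shares [x / (x + y)] and [y / (x + y)] are at most 1, hence at most their own powers of
    order [t <= 1]; they add up to 1. *)
Lemma powR_add_le (R : realType) (x y t : R) : 0 <= x -> 0 <= y -> 0 < t <= 1 ->
  (x + y) `^ t <= x `^ t + y `^ t.
Proof.
move=> x0 y0 /andP[t0 t1].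
have [xy|xy] := eqVneq (x + y) 0.
  by rewrite xy powR0 ?gt_eqF// addr_ge0// powR_ge0.
have s0 : 0 < x + y by rewrite lt_neqAle eq_sym xy addr_ge0.
have part z : 0 <= z -> z <= x + y -> z / (x + y) * (x + y) `^ t <= z `^ t.
  move=> z0 zs; have [->|zN0] := eqVneq z 0; first by rewrite !mul0r powR_ge0.
  have q0 : 0 < z / (x + y) by rewrite divr_gt0// lt_neqAle eq_sym zN0.
  have q1 : z / (x + y) <= 1 by rewrite ler_pdivrMr// mul1r.
  rewrite -[X in _ <= X `^ _](divfK xy z) (powRM _ (ltW q0) (ltW s0)).
  by apply: ler_wpM2r; [exact: powR_ge0|apply: ger1_powR => //; apply/andP].
have -> : (x + y) `^ t = x / (x + y) * (x + y) `^ t + y / (x + y) * (x + y) `^ t.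
  by rewrite -mulrDl -mulrDl divff// mul1r.
by apply: lerD; apply: part => //; rewrite ?lerDl ?lerDr.
Qed.

Lemma powR_sum_le (R : realType) (J : Type) (r : seq J) (F : J -> R) (t : R) :
  (forall j, 0 <= F j) -> 0 < t <= 1 ->
  (\sum_(j <- r) F j) `^ t <= \sum_(j <- r) F j `^ t.
Proof.
move=> F0 t01; elim: r => [|j r IH].
  by rewrite !big_nil powR0// gt_eqF//; case/andP: t01.
rewrite !big_cons; apply: (le_trans (powR_add_le _ _ t01)) => //.
  exact: sumr_ge0.
by rewrite lerD2l.
Qed.

Lemma prodr_ge1 (R : realType) (J : Type) (r : seq J) (F : J -> R) :
  (forall j, 1 <= F j) -> 1 <= \prod_(j <- r) F j.
Proof. by move=> F1; elim/big_ind: _ => // x y x1 y1; exact: mulr_ege1. Qed.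

Section cooling_maps.
Variable tau : nat -> nat.
Hypothesis tau_cooling : cooling_map tau.

Lemma cooling_le m n : (m <= n)%N -> (tau m <= tau n)%N.
Proof.
case: tau_cooling => _ h; rewrite leq_eqVlt => /predU1P[->//|/h].
exact: ltnW.
Qed.

Definition block_of (n : nat) := (ell tau n).-1.

Lemma block_of_lt n k : (n < tau k)%N -> (block_of n < k)%N.
Proof.
move=> nk; have [h1 /(_ k nk) h2] := ellP n tau_cooling.
rewrite /block_of; case: (ell tau n) h1 h2 => [|j] //=.
by case: tau_cooling => ->.
Qed.

Lemma block_of_ge n k : (tau k <= n)%N -> (k <= block_of n)%N.
Proof.
move=> kn; have [h1 _] := ellP n tau_cooling.
have : (k < ell tau n)%N.
  rewrite ltnNge; apply/negP => /cooling_le h.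
  by have := leq_ltn_trans (leq_trans h kn) h1; rewrite ltnn.
by rewrite /block_of; case: (ell tau n).
Qed.

Lemma block_ofE n k : (tau k <= n < tau k.+1)%N -> block_of n = k.
Proof.
move=> /andP[h1 h2]; apply/eqP; rewrite eqn_leq block_of_ge// andbT.
by rewrite -ltnS block_of_lt.
Qed.

Lemma block_of_itv n : (tau (block_of n) <= n < tau (block_of n).+1)%N.
Proof.
have [h1 h2] := ellP n tau_cooling; rewrite /block_of.
case E : (ell tau n) h1 h2 => [|j] h1 h2; first by move: h1; case: tau_cooling => ->.
rewrite /= h1 andbT leqNgt; apply/negP => /h2.
by rewrite ltnn.
Qed.

Hypothesis tau_cvg : (fun k => (tau k.+1 - tau k)%N) @ \oo --> \oo.

(** Here the divergence of the block lengths is used. A long enough block satisfies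
    [B T <= exp (eta * T)] without a constant, the finitely many earlier blocks are collected in
    [D], and the incomplete last block, which may be short, contributes one factor [C1]. *)
Lemma prod_blocks_le (R : realType) (B : nat -> R) (eta : R) : 0 < eta ->
  (forall T, 1 <= B T) ->
  (forall e, 0 < e -> exists C : R, forall T, B T <= C * expR (e * T%:R)) ->
  exists2 C : R, 0 < C & forall K n, (tau K <= n)%N ->
    (\prod_(j < K) B (tau j.+1 - tau j)%N) * B (n - tau K)%N <= C * expR (eta * n%:R).
Proof.
move=> eta0 B1 Bsub.
have eta20 : 0 < eta / 2 by rewrite divr_gt0.
have [C2 hC2] := Bsub _ eta20; have [C1 hC1] := Bsub _ eta0.
have B0 T : 0 < B T by exact: lt_le_trans (B1 T).
have C20 : 0 < C2.
  by have := lt_le_trans (B0 0%N) (hC2 0%N); rewrite mulr0 expR0 mulr1.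
have C10 : 0 < C1.
  by have := lt_le_trans (B0 0%N) (hC1 0%N); rewrite mulr0 expR0 mulr1.
(* Half of the rate [eta] bounds [B T] up to the constant [C2], and for [T >= T0] the other half
   absorbs [C2]. *)
have [T0 _ hT0] := near_natr_gt (C2 / (eta / 2)).
have large T : (T0 <= T)%N -> B T <= expR (eta * T%:R).
  move=> /hT0 /= h; apply: (le_trans (hC2 T)).
  have -> : eta * T%:R = eta / 2 * T%:R + eta / 2 * T%:R by field.
  rewrite expRD ler_wpM2r ?expR_ge0//; apply: le_trans (expR_ge1Dx _).
  by move: h; rewrite ltr_pdivrMr// mulrC; lra.
have [j0 _ hj0] : \forall k \near \oo, (T0 <= tau k.+1 - tau k)%N.
  exact: (tau_cvg (nbhs_infty_ge T0)).
pose D := \prod_(j < j0) B (tau j.+1 - tau j)%N.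
have D1 : 1 <= D by exact: prodr_ge1.
have main K : \prod_(j < K) B (tau j.+1 - tau j)%N <= D * expR (eta * (tau K)%:R).
  have [Kj|jK] := leqP K j0.
    apply: (@le_trans _ _ D); last first.
      rewrite ler_peMr//; first by lra.
      by apply: le_trans (expR_ge1Dx _); rewrite lerDl mulr_ge0// ltW.
    rewrite /D -!(big_mkord xpredT (fun j => B (tau j.+1 - tau j)%N)).
    rewrite [leRHS](big_cat_nat (leq0n K) Kj)//=.
    by rewrite ler_peMr ?prodr_ge1//; apply: prodr_ge0 => j _; exact/ltW.
  elim: K jK => // K IH; rewrite ltnS leq_eqVlt => jK.
  have hK : \prod_(j < K) B (tau j.+1 - tau j)%N <= D * expR (eta * (tau K)%:R).
    move: jK => /predU1P[<-|/IH//].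
    rewrite -/D ler_peMr//; first by lra.
    by apply: le_trans (expR_ge1Dx _); rewrite lerDl mulr_ge0// ltW.
  have jK' : (j0 <= K)%N by move: jK => /predU1P[->//|/ltnW].
  rewrite big_ord_recr /=.
  have tS : (tau K <= tau K.+1)%N by exact: cooling_le.
  have -> : eta * (tau K.+1)%:R = eta * (tau K)%:R + eta * (tau K.+1 - tau K)%N%:R.
    by rewrite -mulrDr -natrD subnKC.
  rewrite expRD mulrA; apply: ler_pM => //.
  - by apply: prodr_ge0 => j _; exact: ltW.
  - exact: ltW.
  - by apply: large; exact: hj0.
exists (D * C1); first by rewrite mulr_gt0//; lra.
move=> K n Kn.
have -> : D * C1 * expR (eta * n%:R) =
    D * expR (eta * (tau K)%:R) * (C1 * expR (eta * (n - tau K)%N%:R)).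
  have -> : eta * n%:R = eta * (tau K)%:R + eta * (n - tau K)%N%:R.
    by rewrite -mulrDr -natrD subnKC.
  by rewrite expRD; ring.
apply: ler_pM => //; first by apply: prodr_ge0 => j _; exact: ltW.
exact: ltW.
Qed.

End cooling_maps.

Section cooling_walk.
Context (R : realType) (c : R) (tau : nat -> nat).
Hypotheses (c0 : 0 < c) (c2 : c <= 2^-1) (tau_cooling : cooling_map tau).
Implicit Types Om : env_seq R.

Definition cool_env Om (n : nat) : int -> R := clip_env c (Om (block_of tau n)).

Definition cev Om (s n : nat) (f : int -> R) x : R := ev (cool_env Om) s n f x.

Lemma cool_env01 Om t x : 0 <= cool_env Om t x <= 1.
Proof. exact: clip_env01. Qed.

Lemma cev_ge0 Om s n f x : (forall y, 0 <= f y) -> 0 <= cev Om s n f x.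
Proof. by move=> f0; apply: ev_ge0 => // t y; exact: cool_env01. Qed.

Lemma cev_block Om k T f x : (tau k + T <= tau k.+1)%N ->
  cev Om (tau k) T f x = sev c (Om k) T f x.
Proof.
move=> kT; apply: ev_congr => t y tT _.
rewrite /cool_env (block_ofE tau_cooling (k := k))//.
by rewrite leq_addr/=; apply: leq_trans kT; rewrite ltn_add2l.
Qed.

Lemma measurable_cev s n f x : measurable_fun setT (fun Om => cev Om s n f x).
Proof.
apply: measurable_ev => t y.
exact: (measurableT_comp (@measurable_clip_env R c y)
         (@measurable_coord nat _ (env R) (block_of tau t))).
Qed.

Lemma depends_on_cev_after k s n f x : (tau k <= s)%N ->
  depends_on (fun i => (k <= i)%N) (fun Om => cev Om s n f x).
Proof.
move=> ks Om Om' h; apply: ev_congr => t y _ _; rewrite /cool_env h//.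
by apply: block_of_ge => //; apply: leq_trans ks (leq_addr _ _).
Qed.

End cooling_walk.

(** * Upper bound for the cooling walk: fractional moments block by block *)

Section cooling_upper.
Context (R : realType) (alpha : probability (measurableTypeR R) R).
Context (mu : probability (env R) R) (muN : probability (env_seq R) R).
Context (c : R) (tau : nat -> nat) (s t rho : R).
Hypotheses (muE : is_product_law alpha mu) (muNE : is_product_law mu muN).
Hypotheses (c0 : 0 < c) (c2 : c <= 2^-1) (tau_cooling : cooling_map tau).
Hypotheses (t01 : 0 < t <= 1).
Hypothesis static_moment : forall (T : nat) (y : int),
  (\int[mu]_w ((expR (s * y%:~R) * sev c w T \1_[set y] 0) `^ t)%:E <=
   (expR (t * rho * T%:R))%:E)%E.

(** Subadditivity of the power [t] separates the [2T + 1] displacements. In each term the factor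
    from block [k] is independent of [F], which reads only later environments, and shift invariance
    makes its moment independent of the starting site [x]. *)
Let block_step (F : env_seq R -> int -> R) (M : R) k T (x : int) :
  (forall y, measurable_fun setT (F ^~ y)) -> (forall Om y, 0 <= F Om y) ->
  (forall y, depends_on (fun i => (k.+1 <= i)%N) (F ^~ y)) ->
  (forall y, (\int[muN]_Om (F Om y `^ t)%:E <= M%:E)%E) ->
  (\int[muN]_Om ((sev c (Om k) T (fun y => expR (s * (y - x)%:~R) * F Om y) x) `^ t)%:E
   <= (T.*2.+1%:R * expR (t * rho * T%:R) * M)%:E)%E.
Proof.
move=> mF F0 FJ FM.
pose A (z : int) (w : env R) := (expR (s * z%:~R) * sev c w T \1_[set z] 0) `^ t.
have mA z : measurable_fun setT (A z).
  apply: (measurableT_comp (measurable_powR _)).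
  by apply: measurable_funM => //; exact: measurable_sev.
have mAs z : measurable_fun setT (fun Om : env_seq R => A z (shift_env x (Om k))).
  apply: (measurableT_comp (mA z)).
  apply: (measurableT_comp (@measurable_shift_env R x)).
  exact: (@measurable_coord nat _ (env R) k).
have mFt y : measurable_fun setT (fun Om => F Om y `^ t).
  exact: (measurableT_comp (measurable_powR _) (mF y)).
have A0 z w : 0 <= A z w by exact: powR_ge0.
have Ft0 y Om : 0 <= F Om y `^ t by exact: powR_ge0.
have bound Om : (sev c (Om k) T (fun y => expR (s * (y - x)%:~R) * F Om y) x) `^ t <=
    \sum_(z <- disps T) A z (shift_env x (Om k)) * F Om (x + z) `^ t.
  rewrite /sev ev_disps; last exact: clip_env01.
  apply: le_trans (powR_sum_le _ _ t01) _.
    move=> z; rewrite mulr_ge0 ?mulr_ge0 ?expR_ge0//; exact: sev_indic_ge0.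
  apply: ler_sum => z _; rewrite /A -powRM ?F0//; last first.
    by rewrite mulr_ge0 ?expR_ge0// sev_indic_ge0.
  rewrite -sev_shift_at (_ : x + z - x = z); last by rewrite addrC addKr.
  by rewrite mulrCA mulrA.
have mAF z : measurable_fun setT
    (fun Om : env_seq R => (A z (shift_env x (Om k)) * F Om (x + z) `^ t)%:E).
  by apply/measurable_EFinP; exact: measurable_funM.
have AF0 z (Om : env_seq R) :
    (0 <= (A z (shift_env x (Om k)) * F Om (x + z) `^ t)%:E)%E.
  by rewrite lee_fin mulr_ge0.
have each z : (\int[muN]_Om (A z (shift_env x (Om k)) * F Om (x + z) `^ t)%:E <=
    (expR (t * rho * T%:R) * M)%:E)%E.
  rewrite (product_law_indep muNE (J := fun i => i == k))//; last 2 first.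
  - by move=> w w' h; rewrite /A h.
  - by move=> w w' h; rewrite (FJ _ w w')// => i ki; apply: h => /=; rewrite gtn_eqF.
  rewrite EFinM; apply: lee_pmul => //.
  + by apply: integral_ge0 => Om _; rewrite lee_fin.
  + by apply: integral_ge0 => Om _; rewrite lee_fin.
  rewrite (integral_env_coord muNE k (F := fun w => A z (shift_env x w))) //.
    by rewrite (integral_shift_env muE x (mA z) (A0 z)); exact: static_moment.
  by apply: (measurableT_comp (mA z)); exact: measurable_shift_env.
have mW : measurable_fun setT (fun Om : env_seq R =>
    ((sev c (Om k) T (fun y => expR (s * (y - x)%:~R) * F Om y) x) `^ t)%:E).
  apply/measurable_EFinP; apply: (measurableT_comp (measurable_powR _)).
  rewrite (_ : (fun _ => _) = (fun Om : env_seq R => \sum_(z <- disps T)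
    sev c (Om k) T \1_[set x + z] x * (expR (s * (x + z - x)%:~R) * F Om (x + z)))).
    apply: measurable_sum => z; apply: measurable_funM.
      apply: (measurableT_comp (@measurable_sev R c T \1_[set x + z] x)).
      exact: (@measurable_coord nat _ (env R) k).
    by apply: measurable_funM.
  by apply/funext => Om; rewrite /sev ev_disps//; exact: clip_env01.
apply: (@le_trans _ _ (\int[muN]_Om (\sum_(z <- disps T)
    (A z (shift_env x (Om k)) * F Om (x + z) `^ t)%:E))%E).
  apply: ge0_le_integral => //.
  - by move=> Om _; rewrite lee_fin powR_ge0.
  - exact: emeasurable_sum.
  - by move=> Om _; rewrite sumEFin lee_fin; exact: bound.
rewrite ge0_integral_sum//.
apply: (@le_trans _ _ (\sum_(z <- disps T) (expR (t * rho * T%:R) * M)%:E)%E).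
  by apply: lee_sum => z _; exact: each.
rewrite sumEFin lee_fin big_const_seq count_predT size_disps iter_addr_0.
by rewrite mulr_natl mulrnAl.
Qed.

(** The exponential moment of the displacement accumulated from time [tau k] to [n]. Measuring it
    relative to the current site [x] allows a moment bound uniform in [x], as the backward induction
    over blocks requires. *)
Definition cweight (n k : nat) (x : int) (Om : env_seq R) : R :=
  cev c tau Om (tau k) (n - tau k) (fun y => expR (s * (y - x)%:~R)) x.

Let cweight_rec n k x Om : (tau k.+1 <= n)%N ->
  cweight n k x Om = sev c (Om k) (tau k.+1 - tau k)
    (fun y => expR (s * (y - x)%:~R) * cweight n k.+1 y Om) x.
Proof.
move=> kn; have kk1 : (tau k <= tau k.+1)%N by exact: cooling_le.
rewrite /cweight; have -> : (n - tau k = (tau k.+1 - tau k) + (n - tau k.+1))%N.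
  by rewrite addnC addnBA// subnK.
rewrite /cev ev_add subnKC//.
rewrite -/(cev c tau Om (tau k) _ _ x) cev_block ?subnKC//.
congr sev; apply/funext => y; rewrite -evZ; congr ev.
apply/funext => u; rewrite -expRD; congr expR.
by rewrite -mulrDr -rmorphD/= [y - x + _]addrC subrKA.
Qed.

Lemma cweight_moment n K m k (x : int) : (k + m = K)%N -> (tau K <= n < tau K.+1)%N ->
  (\int[muN]_Om (cweight n k x Om `^ t)%:E <=
   ((\prod_(k <= j < K) (tau j.+1 - tau j).*2.+1%:R) * (n - tau K).*2.+1%:R *
    expR (t * rho * (n - tau k)%N%:R))%:E)%E.
Proof.
move=> + /andP[Kn nK]; elim: m k x => [|m IH] k x kK.
  rewrite addn0 in kK; rewrite kK big_geq// mul1r.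
  have E Om : cweight n K x Om = sev c (Om K) (n - tau K)
      (fun y => expR (s * (y - x)%:~R) * 1) x.
    rewrite /cweight cev_block//; last by rewrite subnKC// ltnW.
    by congr sev; apply/funext => y; rewrite mulr1.
  under eq_integral do rewrite E.
  rewrite -[X in (_ <= X%:E)%E]mulr1; apply: (@block_step (fun _ _ => 1)) => //.
  by move=> _; rewrite powR1 integral_prob_cst.
have kK' : (k.+1 + m)%N = K by rewrite addSnnS.
have k1n : (tau k.+1 <= n)%N.
  by apply: leq_trans Kn; apply: cooling_le => //; rewrite -kK' leq_addr.
have kk1 : (tau k <= tau k.+1)%N by exact: cooling_le.
under eq_integral do rewrite cweight_rec//.
apply: (le_trans (@block_step (fun Om y => cweight n k.+1 y Om) _ k _ x
  _ _ _ (fun y => IH k.+1 y kK'))).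
- by move=> y; exact: measurable_cev.
- by move=> Om y; apply: cev_ge0 => // z; exact: expR_ge0.
- by move=> y; exact: depends_on_cev_after.
rewrite lee_fin le_eqVlt; apply/orP; left; apply/eqP.
have -> : (n - tau k)%N%:R = (tau k.+1 - tau k)%N%:R + (n - tau k.+1)%N%:R :> R.
  by rewrite -natrD addnC addnBA// subnK.
rewrite [in RHS]big_ltn; last by rewrite -kK' leq_addr.
by rewrite mulrDr expRD; ring.
Qed.

End cooling_upper.

Lemma odd_subexponential (R : realType) (e : R) : 0 < e ->
  exists C : R, forall T : nat, T.*2.+1%:R <= C * expR (e * T%:R).
Proof.
move=> e0; exists (2 * (1 + e^-1)) => T; rewrite -mulrA.
apply: (@le_trans _ _ (2 * (T%:R + 1))); last by rewrite ler_pM2l// natr_le_expR.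
by rewrite -natr1 -muln2 natrM; lra.
Qed.

(** Exponential Markov inequality for the walk ([1 <= exp (s * (y - v * n))] on the half-line, as
    [0 <= s]), then for the environment with the moment of order [t]. Half of the loss [t * eps]
    absorbs the polynomial factors of the blocks, the other half makes the series converge. *)
Lemma cooling_upper_ae (R : realType) (alpha : probability (measurableTypeR R) R)
    (mu : probability (env R) R) (muN : probability (env_seq R) R)
    (c : R) (tau : nat -> nat) (s t rho v eps : R) :
  is_product_law alpha mu -> is_product_law mu muN -> 0 < c -> c <= 2^-1 ->
  cooling_map tau -> (fun k => (tau k.+1 - tau k)%N) @ \oo --> \oo ->
  0 <= s -> 0 < t <= 1 -> 0 < eps ->
  (forall (T : nat) (y : int),
    (\int[mu]_w ((expR (s * y%:~R) * sev c w T \1_[set y] 0) `^ t)%:E <=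
     (expR (t * rho * T%:R))%:E)%E) ->
  {ae muN, forall Om, \forall n \near \oo,
    cev c tau Om 0 n \1_[set z : int | v * n%:R <= z%:~R] 0 <=
    expR (- ((s * v - rho - eps) * n%:R))}.
Proof.
move=> muE muNE c0 c2 tau_cooling tau_cvg s0 t01 eps0 mom.
have /andP[t0 t1] := t01.
pose A n := [set z : int | v * n%:R <= z%:~R].
pose k := s * v - rho - eps.
pose f n Om := (expR (k * n%:R) * cev c tau Om 0 n \1_(A n) 0) `^ t.
have mf n : measurable_fun setT (f n).
  apply: (measurableT_comp (measurable_powR _)).
  by apply: measurable_funM => //; exact: measurable_cev.
have f0 n Om : 0 <= f n Om by exact: powR_ge0.
have P0 n Om : 0 <= cev c tau Om 0 n \1_(A n) 0.
  by apply: cev_ge0 => // y; rewrite indicE.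
have te0 : 0 < t * eps / 2 by rewrite divr_gt0// mulr_gt0.
have B1 (T : nat) : 1 <= T.*2.+1%:R :> R by rewrite ler1n.
have [C C0 hC] := prod_blocks_le tau_cooling tau_cvg te0 B1 (@odd_subexponential R).
have fC n : (\int[muN]_Om (f n Om)%:E <= (C * expR (- (t * eps / 2 * n%:R)))%:E)%E.
  pose K := block_of tau n.
  have Kn : (tau K <= n < tau K.+1)%N by exact: block_of_itv.
  have := cweight_moment muE muNE c0 c2 tau_cooling t01 mom 0 (add0n K) Kn.
  set W := cweight c tau s n 0 0 => hW.
  have tau0 : tau 0%N = 0%N by case: tau_cooling.
  have fW Om : f n Om <= expR (- (t * (rho + eps) * n%:R)) * W Om `^ t.
    have W0 : 0 <= W Om by apply: cev_ge0 => // y; exact: expR_ge0.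
    have -> : expR (- (t * (rho + eps) * n%:R)) = expR (- ((rho + eps) * n%:R)) `^ t.
      by rewrite -expRM; congr expR; ring.
    rewrite -powRM ?expR_ge0//; apply: ge0_ler_powR; rewrite ?nnegrE ?(ltW t0)//.
    - by rewrite mulr_ge0 ?expR_ge0.
    - by rewrite mulr_ge0 ?expR_ge0.
    have -> : expR (- ((rho + eps) * n%:R)) =
        expR (k * n%:R) * expR (- (s * (v * n%:R))).
      by rewrite -expRD; congr expR; rewrite /k; ring.
    rewrite -mulrA ler_pM2l ?expR_gt0// /W /cweight tau0 subn0 /cev -evZ.
    apply: ev_le => [u y|x y _]; first exact: cool_env01.
    rewrite indicE; have [|_] := boolP (_ \in _); last by rewrite mulr_ge0 ?expR_ge0.
    rewrite inE /= => h; rewrite -expRD; apply: le_trans (expR_ge1Dx _).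
    rewrite lerDl subr0 addrC -mulrBr mulr_ge0// subr_ge0.
    exact: h.
  have mW : measurable_fun setT (fun Om => (W Om `^ t)%:E).
    apply/measurable_EFinP; apply: (measurableT_comp (measurable_powR _)).
    exact: measurable_cev.
  have W0E Om : (0 <= (W Om `^ t)%:E)%E by rewrite lee_fin powR_ge0.
  have k0 : (0 <= (expR (- (t * (rho + eps) * n%:R)))%:E)%E by rewrite lee_fin expR_ge0.
  apply: (@le_trans _ _ (\int[muN]_Om
      ((expR (- (t * (rho + eps) * n%:R)))%:E * (W Om `^ t)%:E))%E).
    have mkW : measurable_fun setT (fun Om =>
        ((expR (- (t * (rho + eps) * n%:R)))%:E * (W Om `^ t)%:E)%E).
      exact: measurable_funeM.
    apply: ge0_le_integral => //; first by move=> Om _; rewrite lee_fin.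
      exact/measurable_EFinP.
    by move=> Om _; rewrite -EFinM lee_fin; exact: fW.
  rewrite ge0_integralZl//; apply: le_trans (lee_wpmul2l k0 hW) _.
  rewrite -EFinM lee_fin tau0 subn0 big_mkord.
  have := hC K n; case/andP: Kn => Kn _ => /(_ Kn).
  set Pi := _ * _ => hP.
  have -> : C * expR (- (t * eps / 2 * n%:R)) =
      expR (- (t * (rho + eps) * n%:R)) * (C * expR (t * eps / 2 * n%:R) *
      expR (t * rho * n%:R)).
    by rewrite [RHS]mulrC -!mulrA -!expRD; congr (_ * expR _); field.
  by rewrite ler_pM2l ?expR_gt0// ler_pM2r ?expR_gt0.
apply: filterS (ae_eventually_le1 mf f0 te0 fC) => Om.
apply: filterS => n fn1.
have : expR (k * n%:R) * cev c tau Om 0 n \1_(A n) 0 <= 1.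
  rewrite leNgt; apply/negP => h.
  have := @gt0_ltr_powR _ t t0 1 (expR (k * n%:R) * cev c tau Om 0 n \1_(A n) 0).
  rewrite !nnegrE ler01 mulr_ge0 ?expR_ge0// => /(_ isT isT h).
  by rewrite powR1 ltNge fn1.
by rewrite expRN -ler_pdivlMl ?expR_gt0// mulr1.
Qed.

(** * Lower bound for the cooling walk: routes through waypoints *)

Section cooling_lower.
Context (R : realType) (alpha : probability (measurableTypeR R) R).
Context (mu : probability (env R) R) (muN : probability (env_seq R) R).
Context (c : R) (tau : nat -> nat).
Hypotheses (muE : is_product_law alpha mu) (muNE : is_product_law mu muN).
Hypotheses (c0 : 0 < c) (c2 : c <= 2^-1) (tau_cooling : cooling_map tau).
Variables (Y : nat -> int).

(* The walk is forced through [waypoint j] at time [tau j], and [leg n Om j] is the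
   probability of the part of this route inside the [j]-th block. *)
Definition waypoint (k : nat) : int := \sum_(j < k) Y (tau j.+1 - tau j)%N.

Definition endpoint (n : nat) : int :=
  waypoint (block_of tau n) + Y (n - tau (block_of tau n))%N.

Definition dur (n j : nat) : nat :=
  if (j < block_of tau n)%N then (tau j.+1 - tau j)%N else (n - tau j)%N.

Definition leg (n : nat) (Om : env_seq R) (j : nat) : R :=
  sev c (shift_env (waypoint j) (Om j)) (dur n j) \1_[set Y (dur n j)] 0.

Lemma leg_chain n Om :
  \prod_(j < (block_of tau n).+1) leg n Om j <= cev c tau Om 0 n \1_[set endpoint n] 0.
Proof.
have cle k l z y x : cev c tau Om 0 k \1_[set z] x * cev c tau Om k l \1_[set y] z <=
    cev c tau Om 0 (k + l) \1_[set y] x.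
  rewrite [leRHS]/cev ev_add add0n; apply: ev_ge_at => [u w|w].
    exact: cool_env01.
  by apply: cev_ge0 => // u; rewrite indicE.
have leg0 j : 0 <= leg n Om j by exact: sev_indic_ge0.
have tau0 : tau 0%N = 0%N by case: tau_cooling.
have main k : (k <= block_of tau n)%N ->
    \prod_(j < k) leg n Om j <= cev c tau Om 0 (tau k) \1_[set waypoint k] 0.
  elim: k => [_|k IH kn].
    by rewrite big_ord0 /cev tau0 /= indicE mem_set// /waypoint /= big_ord0.
  have kk1 : (tau k <= tau k.+1)%N by exact: cooling_le.
  rewrite big_ord_recr/= -[X in cev _ _ _ _ X](subnKC kk1).
  apply: le_trans (cle _ _ (waypoint k) _ _).
  apply: ler_pM => //; first by apply: prodr_ge0 => j _; exact: leg0.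
    by apply: IH; exact: ltnW.
  rewrite cev_block ?subnKC// /leg /dur kn -sev_shift_at.
  by rewrite /waypoint big_ord_recr.
have /andP[Kn nK] := block_of_itv tau_cooling n.
rewrite big_ord_recr/= -[X in cev _ _ _ _ X](subnKC Kn).
apply: le_trans (cle _ _ (waypoint (block_of tau n)) _ _).
apply: ler_pM => //; first by apply: prodr_ge0 => j _; exact: leg0.
  exact: main.
by rewrite cev_block ?subnKC// 1?ltnW// /leg /dur ltnn -sev_shift_at.
Qed.

Variables (t C a v delta : R).
Hypotheses (t0 : 0 < t) (C1 : 1 <= C).
Hypothesis Yc : forall (w : env R) T, c ^+ T <= sev c w T \1_[set Y T] 0.
Hypothesis Ymom : forall T,
  (\int[mu]_w ((sev c w T \1_[set Y T] 0) `^ (- t))%:E <=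
    (C * expR (t * a * T%:R))%:E)%E.
Hypothesis Ydist : forall T, `|(Y T)%:~R - v * T%:R| <= delta * T%:R + C.
Hypothesis tau_cvg : (fun k => (tau k.+1 - tau k)%N) @ \oo --> \oo.

Let sum_dur n : (\sum_(j < (block_of tau n).+1) dur n j = n)%N.
Proof.
have tau0 : tau 0%N = 0%N by case: tau_cooling.
have main k : (k <= block_of tau n)%N -> (\sum_(j < k) dur n j = tau k)%N.
  elim: k => [_|k IH kn]; first by rewrite big_ord0 tau0.
  rewrite big_ord_recr/= IH 1?ltnW// /dur kn subnKC//.
  exact: cooling_le.
have /andP[Kn _] := block_of_itv tau_cooling n.
by rewrite big_ord_recr/= main// /dur ltnn subnKC.
Qed.

Let leg_gt0 n Om j : 0 < leg n Om j.
Proof. by apply: lt_le_trans (Yc _ _); rewrite exprn_gt0. Qed.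

(** The waypoints are deterministic and distinct legs use distinct environments, so the negative
    moments multiply, and shift invariance reduces each one to [Ymom]. The constant [C] is paid once
    per block. *)
Let leg_moment n :
  (\int[muN]_Om ((cev c tau Om 0 n \1_[set endpoint n] 0) `^ (- t))%:E <=
   (C ^+ (block_of tau n).+1 * expR (t * a * n%:R))%:E)%E.
Proof.
pose K := (block_of tau n).+1.
have C0 : 0 < C by exact: lt_le_trans C1.
pose F j (Om : env_seq R) :=
  (C * expR (t * a * (dur n j)%:R))^-1 * (leg n Om j) `^ (- t).
have k0 j : 0 < C * expR (t * a * (dur n j)%:R) by rewrite mulr_gt0 ?expR_gt0.
have mY T : measurable_fun setT (fun w : env R => (sev c w T \1_[set Y T] 0) `^ (- t)).
  by apply: (measurableT_comp (measurable_powR _)); exact: measurable_sev.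
have mYs T z : measurable_fun setT
    (fun w : env R => (sev c (shift_env z w) T \1_[set Y T] 0) `^ (- t)).
  by apply: (measurableT_comp (mY T)); exact: measurable_shift_env.
have ml j : measurable_fun setT (fun Om => (leg n Om j) `^ (- t)).
  by apply: (measurableT_comp (mYs _ _)); exact: (@measurable_coord nat _ (env R) j).
have mF j : measurable_fun setT (F j) by exact: measurable_funM.
have F0 j Om : 0 <= F j Om by rewrite mulr_ge0 ?powR_ge0// invr_ge0 ltW.
have F1 j : (\int[muN]_Om (F j Om)%:E <= 1)%E.
  rewrite /F; under eq_integral do rewrite EFinM.
  have mlE : measurable_fun setT (fun Om => ((leg n Om j) `^ (- t))%:E).
    exact/measurable_EFinP.
  have lE0 Om : (0 <= ((leg n Om j) `^ (- t))%:E)%E by rewrite lee_fin powR_ge0.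
  have kV0 : (0 <= ((C * expR (t * a * (dur n j)%:R))^-1)%:E)%E.
    by rewrite lee_fin invr_ge0 ltW.
  rewrite ge0_integralZl//.
  have -> : (\int[muN]_Om ((leg n Om j) `^ (- t))%:E =
      \int[mu]_w ((sev c w (dur n j) \1_[set Y (dur n j)] 0) `^ (- t))%:E)%E.
    have pos w : 0 <= (sev c w (dur n j) \1_[set Y (dur n j)] 0) `^ (- t).
      exact: powR_ge0.
    have <- := integral_shift_env muE (waypoint j) (mY (dur n j)) pos.
    have <- := integral_env_coord muNE j (mYs (dur n j) (waypoint j))
      (fun w => powR_ge0 _ _).
    by [].
  apply: le_trans (lee_wpmul2l kV0 (Ymom _)) _.
  by rewrite -EFinM mulVf// gt_eqF.
have prod1 : (\int[muN]_Om (\prod_(j <- iota 0 K) F j Om)%:E <= 1)%E.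
  apply: (@integral_prod_le1 _ _ _ _ _ _ muNE F (fun j => pred1 j)) => //.
  - exact: iota_uniq.
  - by move=> j Om Om' h; rewrite /F /leg h//= inE.
  - by move=> i j x _ _ ij; apply/negP => /andP[/eqP -> /eqP /esym ji]; rewrite ji eqxx in ij.
have EK Om : \prod_(j <- iota 0 K) F j Om =
    (C ^+ K * expR (t * a * n%:R))^-1 * (\prod_(j < K) leg n Om j) `^ (- t).
  rewrite -[iota 0 K]/(index_iota 0 K) big_mkord big_split/=; congr (_ * _).
    rewrite prodfV; congr (_^-1); rewrite big_split/= prodr_const card_ord -expR_sum.
    congr (_ * expR _); rewrite -mulr_sumr; congr (_ * _).
    by rewrite -natr_sum sum_dur.
  elim: (K) => [|K' IH]; first by rewrite !big_ord0 powR1.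
  rewrite !big_ord_recr/= IH powRM//; last exact: ltW.
  by apply: prodr_ge0 => j _; exact: ltW.
have Q0 : 0 < C ^+ K * expR (t * a * n%:R) by rewrite mulr_gt0 ?exprn_gt0 ?expR_gt0.
have mprod : measurable_fun setT (fun Om => (\prod_(j <- iota 0 K) F j Om)%:E).
  by apply/measurable_EFinP; exact: measurable_prod.
have pE0 Om : (0 <= (\prod_(j <- iota 0 K) F j Om)%:E)%E.
  by rewrite lee_fin; apply: prodr_ge0 => j _.
have Q0E : (0 <= (C ^+ K * expR (t * a * n%:R))%:E)%E by rewrite lee_fin ltW.
apply: (@le_trans _ _ (\int[muN]_Om ((C ^+ K * expR (t * a * n%:R))%:E *
    (\prod_(j <- iota 0 K) F j Om)%:E))%E); last first.
  rewrite ge0_integralZl//.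
  by rewrite -[leRHS]mule1; apply: lee_wpmul2l.
have mfun : measurable_fun setT (fun Om => ((C ^+ K * expR (t * a * n%:R))%:E *
    (\prod_(j <- iota 0 K) F j Om)%:E)%E) by exact: measurable_funeM.
have mce : measurable_fun setT
    (fun Om => ((cev c tau Om 0 n \1_[set endpoint n] 0) `^ (- t))%:E).
  apply/measurable_EFinP; apply: (measurableT_comp (measurable_powR _)).
  exact: measurable_cev.
apply: ge0_le_integral => //; first by move=> Om _; rewrite lee_fin powR_ge0.
move=> Om _; rewrite -EFinM lee_fin EK mulVKf ?gt_eqF//.
have L0 : 0 < \prod_(j < K) leg n Om j by apply: prodr_gt0 => j _; exact: leg_gt0.
have P0 := lt_le_trans L0 (leg_chain n Om).
rewrite !powRN lef_pV2 ?posrE ?powR_gt0//.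
by apply: ge0_ler_powR; rewrite ?nnegrE ?(ltW t0) ?(ltW L0) ?(ltW P0)//; exact: leg_chain.
Qed.

Let const_blocks (D eta : R) : 1 <= D -> 0 < eta ->
  exists2 C' : R, 0 < C' & forall n, D ^+ (block_of tau n).+1 <= C' * expR (eta * n%:R).
Proof.
move=> D1 eta0.
have [|C' C'0 hC'] := prod_blocks_le (B := fun=> D) tau_cooling tau_cvg eta0 (fun=> D1).
  move=> e e0; exists D => T; rewrite ler_peMr//; first by lra.
  by apply: le_trans (expR_ge1Dx _); rewrite lerDl mulr_ge0// ltW.
exists C' => // n; have /andP[Kn _] := block_of_itv tau_cooling n.
by have := hC' _ _ Kn; rewrite prodr_const card_ord -exprSr.
Qed.

Let endpoint_dist n :
  `|(endpoint n)%:~R - v * n%:R| <= delta * n%:R + C * (block_of tau n).+1%:R.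
Proof.
have -> : (endpoint n)%:~R - v * n%:R =
    \sum_(j < (block_of tau n).+1) ((Y (dur n j))%:~R - v * (dur n j)%:R).
  rewrite sumrB -mulr_sumr -natr_sum sum_dur -rmorph_sum/=; congr (_%:~R - _).
  rewrite /endpoint /waypoint big_ord_recr/= /dur ltnn; congr (_ + _).
  by apply: eq_bigr => j _; rewrite ltn_ord.
apply: (le_trans (ler_norm_sum _ _ _)).
apply: (@le_trans _ _ (\sum_(j < (block_of tau n).+1) (delta * (dur n j)%:R + C))).
  by apply: ler_sum => j _; exact: Ydist.
by rewrite big_split/= -mulr_sumr -natr_sum sum_dur sumr_const card_ord -[C *+ _]mulr_natr.
Qed.

(** A bound on the mean of [P ^ (- t)] makes small values of [P] unlikely. Of the width [2 * delta],
    one [delta] comes from the targets [Y] and the other covers their additive error [C] in each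
    block. *)
Lemma cooling_lower_ae eps : 0 < eps -> 0 < delta ->
  {ae muN, forall Om, \forall n \near \oo,
    expR (- ((a + eps) * n%:R)) <=
    cev c tau Om 0 n \1_[set z : int | `|z%:~R - v * n%:R| <= 2 * delta * n%:R] 0}.
Proof.
move=> eps0 delta0.
have [hC ht] := conj C1 t0.
have te0 : 0 < t * eps / 2 by rewrite divr_gt0// mulr_gt0.
pose P n Om := cev c tau Om 0 n \1_[set endpoint n] 0.
have P0 n Om : 0 < P n Om.
  apply: lt_le_trans (leg_chain n Om); apply: prodr_gt0 => j _; exact: leg_gt0.
pose f n Om := expR (- (t * (a + eps) * n%:R)) * P n Om `^ (- t).
have mPt n : measurable_fun setT (fun Om => P n Om `^ (- t)).
  by apply: (measurableT_comp (measurable_powR _)); exact: measurable_cev.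
have mf n : measurable_fun setT (f n) by exact: measurable_funM.
have f0 n Om : 0 <= f n Om by rewrite mulr_ge0 ?expR_ge0 ?powR_ge0.
have [D D0 hD] := const_blocks C1 te0.
have fC n : (\int[muN]_Om (f n Om)%:E <= (D * expR (- (t * eps / 2 * n%:R)))%:E)%E.
  rewrite /f; under eq_integral do rewrite EFinM.
  have mPE : measurable_fun setT (fun Om => (P n Om `^ (- t))%:E) by exact/measurable_EFinP.
  have PE0 Om : (0 <= (P n Om `^ (- t))%:E)%E by rewrite lee_fin powR_ge0.
  have k0 : (0 <= (expR (- (t * (a + eps) * n%:R)))%:E)%E by rewrite lee_fin expR_ge0.
  rewrite ge0_integralZl//; apply: le_trans (lee_wpmul2l k0 (leg_moment n)) _.
  rewrite -EFinM lee_fin.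
  have -> : D * expR (- (t * eps / 2 * n%:R)) =
      expR (- (t * (a + eps) * n%:R)) * (D * expR (t * eps / 2 * n%:R) *
      expR (t * a * n%:R)).
    by rewrite [RHS]mulrC -!mulrA -!expRD; congr (_ * expR _); field.
  by rewrite ler_pM2l ?expR_gt0// ler_pM2r ?expR_gt0.
(* Applying [const_blocks] to the constant [expR 1] and taking logarithms bounds the number of
   blocks itself by a small multiple of [n] plus a constant. *)
have Cx : \forall n \near \oo, C * (block_of tau n).+1%:R <= delta * n%:R.
  have e0 : 0 < delta / (2 * C) by rewrite divr_gt0 ?mulr_gt0//; lra.
  have e1 : 1 <= expR 1 :> R by apply: le_trans (expR_ge1Dx _); lra.
  have [D' D'0 hD'] := const_blocks e1 e0.
  apply: filterS (near_natr_gt (2 * C * ln D' / delta)) => n hn.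
  have := hD' n; rewrite -expRM_natl mulr1 -[X in X * _]lnK ?posrE// -expRD ler_expR => h.
  apply: (@le_trans _ _ (C * (ln D' + delta / (2 * C) * n%:R))).
    by rewrite ler_pM2l//; lra.
  have -> : C * (ln D' + delta / (2 * C) * n%:R) = C * ln D' + delta / 2 * n%:R.
    by field; rewrite gt_eqF//; lra.
  by move: hn; rewrite ltr_pdivrMr// => hn; lra.
apply: filterS (ae_eventually_le1 mf f0 te0 fC) => Om fOm.
near=> n.
have fn1 : f n Om <= 1 by near: n.
have Cn : C * (block_of tau n).+1%:R <= delta * n%:R by near: n.
apply: (@le_trans _ _ (P n Om)).
  rewrite -(ler_ln (x := expR _)) ?posrE ?expR_gt0// expRK.
  have : ln (f n Om) <= 0 by rewrite ln_le0.
  rewrite /f lnM ?posrE ?expR_gt0 ?powR_gt0// expRK ln_powR => h.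
  rewrite -(ler_pM2l ht); lra.
rewrite /P /cev; apply: ev_le => [u y|x' y _]; first exact: cool_env01.
rewrite !indicE; have [|_] := boolP (_ \in [set endpoint n]); last by [].
rewrite inE /= => ->; rewrite mem_set//=.
apply: (le_trans (endpoint_dist n)); lra.
Unshelve. all: by end_near. Qed.

End cooling_lower.

(** * Large deviations in terms of eventual bounds *)

Lemma limn_esup_lt_near (R : realType) (u : (\bar R)^nat) (b : \bar R) :
  (limn_esup u < b)%E -> \forall n \near \oo, (u n < b)%E.
Proof.
rewrite /limn_esup limf_esupE => /ereal_inf_lt[_ [V VF <-] Vb].
apply: filterS VF => n Vn; apply: le_lt_trans Vb.
by apply: ereal_sup_ubound; exists n.
Qed.

Lemma limn_esup_le_near (R : realType) (u : (\bar R)^nat) (b : \bar R) :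
  (\forall n \near \oo, (u n <= b)%E) -> (limn_esup u <= b)%E.
Proof.
move=> ub; rewrite /limn_esup limf_esupE.
apply: (@le_trans _ _ (ereal_sup [set u n | n in [set n | (u n <= b)%E]])).
  by apply: ereal_inf_lbound; exists [set n | (u n <= b)%E].
by apply: ge_ereal_sup => _ [n /= un <-].
Qed.

Section log_rates.
Context (R : realType).

Lemma log_rate_le (n : nat) (r b : R) : (0 < n)%N -> 0 <= r ->
  (((n%:R^-1)%:E * lne r%:E <= (- b)%:E)%E = (r <= expR (- (b * n%:R)))).
Proof.
move=> n0; have n0' : 0 < n%:R :> R by rewrite ltr0n.
rewrite le_eqVlt => /predU1P[<-|r0].
  by rewrite expR_ge0 le0_lneNy// gt0_muleNy ?leNye// lte_fin invr_gt0.
have rE : r = expR (ln r) by rewrite lnK ?posrE.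
by rewrite lne_EFin// -EFinM lee_fin ler_pdivrMl// mulrN mulrC [in RHS]rE ler_expR.
Qed.

Lemma log_rate_ge (n : nat) (r b : R) : (0 < n)%N -> 0 <= r ->
  (((- b)%:E <= (n%:R^-1)%:E * lne r%:E)%E = (expR (- (b * n%:R)) <= r)).
Proof.
move=> n0; have n0' : 0 < n%:R :> R by rewrite ltr0n.
rewrite le_eqVlt => /predU1P[<-|r0].
  rewrite le0_lneNy// gt0_muleNy ?lte_fin ?invr_gt0// leNgt ltNye/=.
  by apply/esym/negbTE; rewrite -ltNge expR_gt0.
have rE : r = expR (ln r) by rewrite lnK ?posrE.
by rewrite lne_EFin// -EFinM lee_fin ler_pdivlMl// mulrN mulrC [in RHS]rE ler_expR.
Qed.

(** As [r n <= 1], the limit superior is at most 0, so only levels [b >= 0] have to be tested. Such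
    levels exclude the origin from the closed sets considered later. *)
Lemma limn_esup_log_rate_le (r : nat -> R) (m : \bar R) :
  (forall n, 0 <= r n) -> (forall n, r n <= 1) ->
  (forall b : R, 0 <= b -> (b%:E < m)%E ->
     \forall n \near \oo, r n <= expR (- (b * n%:R))) ->
  (0 <= m)%E ->
  (limn_esup (fun n => (n%:R^-1)%:E * lne (r n)%:E) <= - m)%E.
Proof.
move=> r0 r1 rb m0.
have X_le (b : R) : (\forall n \near \oo, r n <= expR (- (b * n%:R))) ->
    (limn_esup (fun n => (n%:R^-1)%:E * lne (r n)%:E) <= (- b)%:E)%E.
  move=> h; apply: limn_esup_le_near.
  apply: filterS2 (nbhs_infty_gt 0) h => n n0 hn.
  by rewrite log_rate_le.
set X := limn_esup _ in X_le *.
have X0 : (X <= 0)%E.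
  rewrite -[0%E]oppe0 -EFinN; apply: X_le; apply: nearW => n.
  by rewrite mul0r oppr0 expR0.
rewrite leeNr leNgt; apply/negP => Xm.
have [y XE] : exists y : R, X = (- y)%:E.
  case: X X0 Xm {X_le} => [x|//|]; first by exists (- x); rewrite opprK.
  by rewrite /= ltNge leey.
move: Xm X0; rewrite XE -EFinN opprK lee_fin oppr_le0 => ym y0.
have [b [yb bm]] : exists b : R, y < b /\ (b%:E < m)%E.
  case: m ym {rb m0} => [z yz|_|//]; last by exists (y + 1); rewrite ltry ltrDl.
  move: yz; rewrite lte_fin => yz.
  by exists ((y + z) / 2); rewrite lte_fin; split; lra.
have := X_le b (rb b (le_trans y0 (ltW yb)) bm).
by rewrite XE lee_fin lerN2 leNgt yb.
Qed.

Lemma le_limn_einf_log_rate (r : nat -> R) (m : \bar R) :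
  (forall n, 0 <= r n) -> (0 <= m)%E ->
  (forall b : R, (m < b%:E)%E ->
     \forall n \near \oo, expR (- (b * n%:R)) <= r n) ->
  (- m <= limn_einf (fun n => (n%:R^-1)%:E * lne (r n)%:E))%E.
Proof.
move=> r0 m0 rb; rewrite /limn_einf leeN2.
case: m m0 rb => [y y0 rb|_ _|//]; last by rewrite leey.
apply/lee_addgt0Pr => e e0; apply: limn_esup_le_near.
have yb : (y%:E < (y + e)%:E)%E by rewrite lte_fin ltrDl.
apply: filterS2 (nbhs_infty_gt 0) (rb _ yb) => n n0 hn.
by rewrite leeNl -EFinD -EFinN log_rate_ge.
Qed.

Lemma near_log_rate_le (r : nat -> R) (m : \bar R) (b : R) :
  (forall n, 0 <= r n) ->
  (limn_esup (fun n => (n%:R^-1)%:E * lne (r n)%:E) <= - m)%E -> (b%:E < m)%E ->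
  \forall n \near \oo, r n <= expR (- (b * n%:R)).
Proof.
move=> r0 h bm.
have {}h : (limn_esup (fun n => (n%:R^-1)%:E * lne (r n)%:E) < (- b)%:E)%E.
  by apply: le_lt_trans h _; rewrite EFinN lteN2.
apply: filterS2 (nbhs_infty_gt 0) (limn_esup_lt_near h) => n n0 /ltW.
by rewrite log_rate_le.
Qed.

Lemma near_log_rate_ge (r : nat -> R) (m : \bar R) (b : R) :
  (forall n, 0 <= r n) ->
  (- m <= limn_einf (fun n => (n%:R^-1)%:E * lne (r n)%:E))%E -> (m < b%:E)%E ->
  \forall n \near \oo, expR (- (b * n%:R)) <= r n.
Proof.
move=> r0; rewrite /limn_einf leeN2 => h mb.
have {}h := le_lt_trans h mb.
apply: filterS2 (nbhs_infty_gt 0) (limn_esup_lt_near h) => n n0 /ltW.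
by rewrite leeNl -EFinN log_rate_ge.
Qed.

End log_rates.

Definition speed_set (R : realType) (n : nat) (A : set R) : set int :=
  [set z | A (z%:~R / n%:R)].

Lemma speed_law (R : realType) (p : nat -> int -> R) (Q : probability traj R) n
    (A : set R) : walk_law p Q ->
  distribution Q (@speed R n) A = (ev p 0 n \1_(speed_set n A) 0)%:E.
Proof. by move=> pQ; exact: walk_law_ev. Qed.

Section walk_LDP_criteria.
Context (R : realType) (p : nat -> int -> R) (I : R -> \bar R).
Hypothesis p01 : forall t x, 0 <= p t x <= 1.

Let r0 (A : set R) n : 0 <= ev p 0 n \1_(speed_set n A) 0.
Proof. by apply: ev_ge0 => // y; rewrite indicE. Qed.

Let r1 (A : set R) n : ev p 0 n \1_(speed_set n A) 0 <= 1.
Proof. exact: ev_indic_le1. Qed.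

(** [walk_LDP] quantifies over all laws of the walk; [walk_law_exists] supplies one from which the
    bounds can be extracted. *)
Lemma walk_LDP_near : walk_LDP p I ->
  [/\ forall x, (0 <= I x)%E, forall a : R, compact [set x | (I x <= a%:E)%E],
   forall (C : set R) (b : R), closed C -> (b%:E < ereal_inf [set I x | x in C])%E ->
     \forall n \near \oo, ev p 0 n \1_(speed_set n C) 0 <= expR (- (b * n%:R)) &
   forall (O : set R) (x b : R), open O -> O x -> (I x < b%:E)%E ->
     \forall n \near \oo, expR (- (b * n%:R)) <= ev p 0 n \1_(speed_set n O) 0].
Proof.
have [Q pQ] := walk_law_exists p01.
move=> /(_ Q pQ)[I0 Ic _ lo up]; split=> //.
- move=> C b cC bI; apply: (near_log_rate_le (r0 C)) bI.
  have := up C cC; congr (limn_esup _ <= _)%E.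
  by apply/funext => n; congr (_ * lne _)%E; exact: speed_law.
- move=> O x b oO Ox xb.
  apply: (near_log_rate_ge (m := ereal_inf [set I x | x in O]) (r0 O)).
    have := lo O oO; congr (_ <= limn_einf _)%E.
    by apply/funext => n; congr (_ * lne _)%E; exact: speed_law.
  by apply: le_lt_trans xb; apply: ereal_inf_lbound; exists x.
Qed.

Lemma walk_LDP_of_near :
  (forall x, (0 <= I x)%E) -> (forall a : R, compact [set x | (I x <= a%:E)%E]) ->
  (exists x, I x != +oo%E) ->
  (forall (C : set R) (b : R), closed C -> 0 <= b ->
     (forall x, C x -> (b%:E < I x)%E) ->
     \forall n \near \oo, ev p 0 n \1_(speed_set n C) 0 <= expR (- (b * n%:R))) ->
  (forall (O : set R) (x b : R), open O -> O x -> (I x < b%:E)%E ->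
     \forall n \near \oo, expR (- (b * n%:R)) <= ev p 0 n \1_(speed_set n O) 0) ->
  walk_LDP p I.
Proof.
move=> I0 Ic Ip up lo Q pQ; split=> //.
- move=> O oO.
  rewrite (_ : (fun n => _) =
    (fun n => (n%:R^-1)%:E * lne (ev p 0 n \1_(speed_set n O) 0)%:E)%E); last first.
    by apply/funext => n; congr (_ * lne _)%E; exact: speed_law.
  apply: (le_limn_einf_log_rate (r0 O)).
    by apply: le_ereal_inf_tmp => _ [x _ <-].
  by move=> b /ereal_inf_lt[_ [x Ox <-] xb]; exact: lo xb.
- move=> C cC.
  rewrite (_ : (fun n => _) =
    (fun n => (n%:R^-1)%:E * lne (ev p 0 n \1_(speed_set n C) 0)%:E)%E); last first.
    by apply/funext => n; congr (_ * lne _)%E; exact: speed_law.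
  apply: (limn_esup_log_rate_le (r0 C) (r1 C)); last first.
    by apply: le_ereal_inf_tmp => _ [x _ <-].
  move=> b b0 bI; apply: up => // x Cx; apply: lt_le_trans bI _.
  by apply: ereal_inf_lbound; exists x.
Qed.

End walk_LDP_criteria.

(** * Consequences of basicness *)

Lemma ae_forall_count (R : realType) d (S : measurableType d) (P : probability S R)
    (T : countType) (A : T -> set S) :
  (forall x, {ae P, forall w, A x w}) -> {ae P, forall w, forall x, A x w}.
Proof.
move=> hA; have h n : {ae P, forall w, forall x : T, unpickle n = Some x -> A x w}.
  case: (unpickle n) => [x|]; last exact: aeW.
  by apply: filterS (hA x) => w Aw y [<-].
by apply: filterS (ae_foralln h) => w hw x; apply: (hw (pickle x)); rewrite pickleK.
Qed.

Section support.
Context (R : realType) (alpha : probability (measurableTypeR R) R).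

(* The complement of the support is a union of null rational intervals. *)
Lemma msupport_full (A : set R) : measurable A -> msupport alpha `<=` A ->
  alpha (~` A) = 0%E.
Proof.
move=> mA sA.
pose itv (pq : rat * rat) : set R := [set x | ratr pq.1 < x < ratr pq.2].
have itvE pq : itv pq = `]ratr pq.1, ratr pq.2[%classic.
  by apply/seteqP; split=> x /=; rewrite in_itv.
have mitv pq : measurable (itv pq) by rewrite itvE.
pose F (n : nat) : set R :=
  if unpickle n is Some pq then
    if alpha (itv pq) == 0%E then itv pq else set0 else set0.
have FE pq : alpha (itv pq) = 0%E -> F (pickle pq) = itv pq.
  by move=> pq0; rewrite /F pickleK pq0 eqxx.
have F0 k : alpha.-negligible (F k).
  rewrite /F; case: (unpickle k) => [pq|]; last exact: negligible_set0.
  case: eqP => h; last exact: negligible_set0.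
  by exists (itv pq); split=> //; exact: mitv.
have [B [mB B0 FB]] := negligible_bigcup F0.
apply: (subset_measure0 _ mB _ B0); first exact: measurableC.
move=> x xA; have : ~ msupport alpha x by move=> /sA.
move=> /existsNP[V] /not_implyP[oV] /not_implyP[Vx] /negP; rewrite -leNgt => V0.
have /nbhs_ballP[e /= e0 eV] := open_nbhs_nbhs (conj oV Vx).
have [p /andP[p1 p2]] : exists p : rat, x - e < ratr p < x.
  have [|p] := @rat_in_itvoo R (x - e) x; first by rewrite ltrBlDr ltrDl.
  by rewrite in_itv => h; exists p.
have [q /andP[q1 q2]] : exists q : rat, x < ratr q < x + e.
  have [|q] := @rat_in_itvoo R x (x + e); first by rewrite ltrDl.
  by rewrite in_itv => h; exists q.
have pq0 : alpha (itv (p, q)) = 0%E.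
  apply/eqP; rewrite -measure_le0; apply: le_trans V0.
  apply: le_measure; rewrite ?inE; [exact: mitv|exact: open_measurable|].
  move=> y /andP[/= y1 y2]; apply: eV; rewrite /ball/= ltr_norml.
  by apply/andP; split; lra.
apply: FB; exists (pickle (p, q)); first exact: I.
by rewrite FE//= /itv /= p2 q1.
Qed.

Lemma basic_constants : basic alpha -> exists c p : R,
  [/\ 0 < c, c <= 2^-1, alpha (~` `[c, 1 - c]%classic) = 0%E, 2^-1 < p < 1 &
   (0 < alpha [set u | (p < u)%R])%E /\ (0 < alpha [set u | (u < 1 - p)%R])%E].
Proof.
move=> [_ [c c0 sc] /andP[hinf hsup]].
pose S := [set rho p | p in msupport alpha].
have rho0 x : msupport alpha x -> 0 < x /\ x <= 1 - c.
  by move=> /sc /=; rewrite in_itv/= => /andP[h1 h2]; split=> //; exact: lt_le_trans h1.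
(* A set without a supremum has [sup] equal to 0 by convention, which is incompatible with
   [1 < sup]; in particular the support is nonempty. *)
have [hs _] : has_sup S.
  apply: contrapT => /sup_out h; move: hsup; rewrite -/S h.
  by rewrite ltNge ler01.
have [_ [x1 x1s <-] h1] := inf_lt hs hinf.
have [_ [x2 x2s <-] h2] := sup_gt hs hsup.
have [x10 x11] := rho0 _ x1s; have [x20 x21] := rho0 _ x2s.
have x1h : 2^-1 < x1.
  by move: h1; rewrite /rho ltr_pdivrMr// mul1r; lra.
have x2h : x2 < 2^-1.
  by move: h2; rewrite /rho ltr_pdivlMr// mul1r; lra.
have := sc _ x1s; rewrite /= in_itv/= => /andP[x1c x1c'].
(* Nestedness gives support points [x2 < 1 / 2 < x1]. Half of the smaller gap keeps [x1] in the open
   set [u > p] and [x2] in the open set [u < 1 - p], so both have positive mass. *)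
pose p := 2^-1 + Num.min (x1 - 2^-1) (2^-1 - x2) / 2.
have m1 : Num.min (x1 - 2^-1) (2^-1 - x2) <= x1 - 2^-1 by rewrite ge_min lexx.
have m2 : Num.min (x1 - 2^-1) (2^-1 - x2) <= 2^-1 - x2 by rewrite ge_min lexx orbT.
have m3 : 0 < Num.min (x1 - 2^-1) (2^-1 - x2) by rewrite lt_min; lra.
exists c, p; split=> //.
- lra.
- apply: msupport_full => //.
- by rewrite /p; lra.
split.
- apply: x1s; last by rewrite /= /p; lra.
  exact: open_gt.
- apply: x2s; last by rewrite /= /p; lra.
  exact: open_lt.
Qed.

End support.

Section elliptic_ae.
Context (R : realType) (alpha : probability (measurableTypeR R) R).
Context (mu : probability (env R) R) (muN : probability (env_seq R) R) (c : R).
Hypotheses (muE : is_product_law alpha mu) (muNE : is_product_law mu muN).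
Hypothesis alphac : alpha (~` `[c, 1 - c]%classic) = 0%E.

Lemma elliptic_ae : {ae mu, forall w : env R, forall x, c <= w x <= 1 - c}.
Proof.
have each x : {ae mu, forall w : env R, c <= w x <= 1 - c}.
  exists [set w : env R | (~` `[c, 1 - c]%classic) (w x)]; split.
  - by have := @measurable_coord int _ (measurableTypeR R) x measurableT
      (~` `[c, 1 - c]%classic) (measurableC (measurable_itv _)); rewrite setTI.
  - by rewrite (product_law_coord x muE)//; exact: measurableC.
  - by move=> w /= h; rewrite in_itv/=.
exact: ae_forall_count each.
Qed.

Lemma ae_env_coord (A : set (env R)) k : {ae mu, forall w, A w} ->
  {ae muN, forall Om : env_seq R, A (Om k)}.
Proof.
move=> [N [mN N0 AN]]; exists [set Om : env_seq R | N (Om k)]; split.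
- by have := @measurable_coord nat _ (env R) k measurableT N mN; rewrite setTI.
- by rewrite (product_law_coord k muNE).
- by move=> Om /= h; exact: AN.
Qed.

Lemma elliptic_seq_ae :
  {ae muN, forall Om : env_seq R, forall k x, c <= (Om k : env R) x <= 1 - c}.
Proof.
apply: ae_foralln => k.
exact: (@ae_env_coord [set w : env R | forall x, c <= w x <= 1 - c] k elliptic_ae).
Qed.

End elliptic_ae.

Section trap.
Context (R : realType) (alpha : probability (measurableTypeR R) R).
Context (mu : probability (env R) R).
Hypothesis muE : is_product_law alpha mu.

Definition trapping (p : R) (K : nat) (w : int -> R) :=
  (forall x : int, 0 < x <= K%:Z -> w x < 1 - p) /\
  (forall x : int, - K%:Z <= x < 0 -> p < w x).

(** A trap constrains finitely many independent coordinates, hence has positive probability, and an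
    event of positive probability meets every event of full measure. *)
Lemma trap_exists (p : R) (K : nat) (A : set (env R)) :
  (0 < alpha [set u | (p < u)%R])%E -> (0 < alpha [set u | (u < 1 - p)%R])%E ->
  {ae mu, forall w, A w} -> exists2 w, A w & trapping p K w.
Proof.
move=> a1 a2 [N [mN N0 AN]].
pose B (x : int) : set R := if x < 0 then [set u | p < u] else
  if 0 < x then [set u | u < 1 - p] else setT.
have mB x : measurable (B x).
  rewrite /B; case: ifP => _; first by apply: open_measurable; exact: open_gt.
  case: ifP => _; last exact: measurableT.
  by apply: open_measurable; exact: open_lt.
have BT : fcylinder (disps K) B `<=` [set w | trapping p K w].
  move=> w h; split=> x /andP[x1 x2].
    have := h x; rewrite mem_disps; rewrite /B ltNge (ltW x1)/= x1.
    by apply; rewrite ger0_norm// ltW.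
  have := h x; rewrite mem_disps; rewrite /B x2.
  by apply; rewrite ltr0_norm// lerNl.
have Bpos : (0 < mu (fcylinder (disps K) B))%E.
  rewrite /fcylinder muE//; last exact: uniq_disps.
  elim: (disps K) => [|x r IH]; first by rewrite big_nil.
  rewrite big_cons mule_gt0// /B; case: ifP => _ //; case: ifP => _ //.
  by rewrite probability_setT.
have [w [wB wN]] : exists w, fcylinder (disps K) B w /\ ~ N w.
  apply: contrapT => /forallNP h.
  have BN : fcylinder (disps K) B `<=` N.
    by move=> w wB; apply: contrapT => wN; exact: (h w).
  have := subset_measure0 (measurable_fcylinder (disps K) mB) mN BN N0.
  by move=> E; rewrite E ltxx in Bpos.
exists w; last exact: BT.
by apply: contrapT => nA; exact/wN/AN.
Qed.

(** The function [g], equal to [1 - exp (b * (|y| - K))] inside the trap and 0 outside, lies below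
    the indicator. The choice [exp b = p / (1 - p)] gives [(1 - p) * exp b + p * exp (- b) = 1], so
    inside the trap [g] does not decrease on average away from 0. At 0 both neighbours have the
    value [1 - exp (b * (1 - K))], which is the factor lost per step. *)
Lemma trap_confinement (p b : R) (K n : nat) (w : int -> R) :
  2^-1 < p -> p < 1 -> (0 < K)%N -> (forall x, 0 <= w x <= 1) -> trapping p K w ->
  b = ln (p / (1 - p)) ->
  (1 - expR (b * (1 - K%:R))) ^+ n * (1 - expR (- (b * K%:R))) <=
  ev (fun=> w) 0 n \1_[set z : int | `|z| <= K%:Z] 0.
Proof.
move=> p2 p1 K0 w01 [trapr trapl] bE.
have bp : expR b = p / (1 - p) by rewrite bE lnK// posrE divr_gt0//; lra.
have b0 : 0 < b by rewrite -expR_gt1 bp ltr_pdivlMr; lra.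
have beta : (1 - p) * expR b + p * expR (- b) = 1.
  by rewrite expRN bp invf_div; field; apply/andP; split; apply: lt0r_neq0; lra.
have mono v : v <= 1 - p -> v * expR b + (1 - v) * expR (- b) <= 1.
  move=> vp; have : expR (- b) < expR b by rewrite ltr_expR; lra.
  move=> h; have : 0 <= (1 - p - v) * (expR b - expR (- b)) by apply: mulr_ge0; lra.
  lra.
pose g (y : int) : R := if `|y| <= K%:Z then 1 - expR (b * ((`|y|%N)%:R - K%:R)) else 0.
have gle1 y : g y <= \1_[set z : int | `|z| <= K%:Z] y.
  rewrite /g indicE; case: ifP => h.
    by rewrite mem_set// lerBlDr lerDl expR_ge0.
  by rewrite memNset//= h.
have g0 y : 0 <= g y.
  rewrite /g; case: ifP => // h; rewrite subr_ge0 expR_le1 pmulr_rle0// subr_le0 ler_nat.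
  by move: h; rewrite -abszE lez_nat.
have gE y : (`|y|%N <= K)%N -> g y = 1 - expR (b * ((`|y|%N)%:R - K%:R)).
  by move=> yK; rewrite /g -abszE lez_nat yK.
have lam01 : 0 <= 1 - expR (b * (1 - K%:R)) <= 1.
  rewrite subr_ge0 expR_le1 pmulr_rle0// subr_le0 ler1n K0/=.
  by rewrite lerBlDr lerDl expR_ge0.
have g00 : g 0 = 1 - expR (- (b * K%:R)) by rewrite gE// absz0 sub0r mulrN.
have w01' (t : nat) x : 0 <= w x <= 1 by exact: w01.
rewrite -g00; apply: (@le_trans _ _ (ev (fun=> w) 0 n g 0)); last first.
  by apply: ev_le => // a' b' _; exact: gle1.
case/andP: lam01 => lam0 lam1; apply: ev_sub => // _ y.
have /andP[wy0 wy1] := w01 y.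
have [Ky|yK] := leqP K `|y|%N.
  have -> : g y = 0.
    rewrite /g; case: ifP => // h.
    have -> : `|y|%N = K by apply/eqP; rewrite eqn_leq Ky andbT; move: h; lia.
    by rewrite subrr mulr0 expR0 subrr.
  by rewrite mulr0 addr_ge0// mulr_ge0// subr_ge0.
have [y0|y0] := eqVneq y 0.
  rewrite y0 add0r sub0r.
  have g1 : g 1 = 1 - expR (b * (1 - K%:R)) by rewrite gE.
  have gN1 : g (- 1) = 1 - expR (b * (1 - K%:R)) by rewrite gE.
  rewrite g1 gN1; set L := 1 - expR (b * (1 - K%:R)).
  have -> : w 0 * L + (1 - w 0) * L = L by ring.
  by rewrite ler_piMr// g00 lerBlDr lerDl expR_ge0.
apply: (@le_trans _ _ (g y)); first by rewrite ler_piMl.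
rewrite (gE y (ltnW yK)).
set X := expR (b * (`|y|%N%:R - K%:R)).
have X0 : 0 <= X by exact: expR_ge0.
have up (v : R) : v <= 1 - p ->
    1 - X <= v * (1 - expR b * X) + (1 - v) * (1 - expR (- b) * X).
  move=> /mono h; have : 0 <= (1 - (v * expR b + (1 - v) * expR (- b))) * X.
    by apply: mulr_ge0 => //; lra.
  lra.
have step (k : int) : `|k|%N = `|y|.+1 -> (`|y| < K)%N -> g k = 1 - expR b * X.
  move=> kE yK'; rewrite gE kE//; congr (1 - _); rewrite /X -expRD -natr1.
  by congr expR; ring.
have step' (k : int) : `|k|.+1 = `|y|%N -> g k = 1 - expR (- b) * X.
  move=> kE; rewrite gE; last by rewrite ltnW// kE ltnW.
  congr (1 - _); rewrite /X -expRD -kE -natr1.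
  by congr expR; ring.
have [yneg|ypos] := ltP y 0.
  have wp : p < w y by apply: trapl; rewrite yneg andbT; move: yK; lia.
  have -> : g (y + 1) = 1 - expR (- b) * X by apply: step'; move: yneg; lia.
  have -> : g (y - 1) = 1 - expR b * X by apply: step => //; move: yneg; lia.
  have h : 1 - w y <= 1 - p by lra.
  by rewrite [leRHS]addrC; have := up _ h; rewrite (_ : 1 - (1 - w y) = w y)//; ring.
have {}ypos : 0 < y by rewrite lt_neqAle eq_sym y0.
have wp : w y < 1 - p by apply: trapr; rewrite ypos; move: yK; lia.
have -> : g (y + 1) = 1 - expR b * X by apply: step => //; move: ypos; lia.
have -> : g (y - 1) = 1 - expR (- b) * X by apply: step'; move: ypos; lia.
by apply: up; exact: ltW.
Qed.

End trap.

(** * The rate function and deviations to the right *)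

(* Clipping is harmless almost surely, so this is the quenched static LDP. *)
Definition static_bounds (R : realType) (c : R) (I : R -> \bar R) (w : env R) :=
  (forall (C : set R) (b : R), closed C -> (b%:E < ereal_inf [set I x | x in C])%E ->
     \forall n \near \oo, sev c w n \1_(speed_set n C) 0 <= expR (- (b * n%:R))) /\
  (forall (O : set R) (x b : R), open O -> O x -> (I x < b%:E)%E ->
     \forall n \near \oo, expR (- (b * n%:R)) <= sev c w n \1_(speed_set n O) 0).

Section rate_function.
Context (R : realType) (alpha : probability (measurableTypeR R) R).
Context (mu : probability (env R) R) (c : R) (I : R -> \bar R).
Hypotheses (muE : is_product_law alpha mu) (c0 : 0 < c) (c2 : c <= 2^-1).
Hypothesis static : {ae mu, forall w, static_bounds c I w}.
Hypotheses (I0 : forall x, (0 <= I x)%E) (Icvx : econvex I).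
Hypothesis Iclosed : forall a : R, closed [set x | (I x <= a%:E)%E].

(* Since both drifts occur, a long trap around the origin has positive probability:
   staying put costs nothing on the exponential scale. *)
Lemma rate_zero (p : R) : 2^-1 < p < 1 ->
  (0 < alpha [set u | (p < u)%R])%E -> (0 < alpha [set u | (u < 1 - p)%R])%E ->
  {ae mu, forall w : env R, forall x, c <= w x <= 1 - c} -> I 0 = 0%E.
Proof.
move=> /andP[p2 p1] a1 a2 ell.
apply/eqP; rewrite eq_le I0 andbT leNgt; apply/negP => Ipos.
have [a [apos aI]] : exists a : R, 0 < a /\ (a%:E < I 0)%E.
  case: (I 0) Ipos => [y|_|//]; last by exists 1; rewrite ltry.
  by rewrite lte_fin => y0; exists (y / 2); rewrite lte_fin; split; lra.
have [e [e0 eC]] : exists e : R, 0 < e /\ forall x, `|x| <= e -> (a%:E < I x)%E.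
  have := @Iclosed a; rewrite -openC => /(_ 0).
  have xC : (~` [set x | (I x <= a%:E)%E]) 0 by rewrite /=; apply/negP; rewrite -ltNge.
  rewrite /interior => /(_ xC) /nbhs_ballP[e /= e0 eb].
  exists (e / 2); split; first by rewrite divr_gt0.
  move=> x xe; rewrite ltNge; apply/negP; apply: eb; rewrite /ball/= sub0r normrN.
  by apply: le_lt_trans xe _; rewrite ltr_pdivrMr// ltr_pMr// ltr1n.
pose b := ln (p / (1 - p)).
have b0 : 0 < b by apply: ln_gt0; rewrite ltr_pdivlMr; lra.
have ea : expR (- (a / 2)) < 1 by rewrite expR_lt1 oppr_lt0 divr_gt0.
(* For [K - 1 > y] confinement costs less than [a / 4] per step, whereas the static upper bound near
   speed 0 would force a cost of at least [a / 2]. *)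
pose y := - ln (1 - expR (- (a / 4))) / b.
have ea4 : expR (- (a / 4)) < 1 by rewrite expR_lt1 oppr_lt0 divr_gt0.
have [K [K0 yK]] : exists K : nat, (0 < K)%N /\ y < K%:R - 1.
  have [K [K0 h]] := filter_ex (filterI (nbhs_infty_gt 0) (near_natr_gt (y + 1))).
  by exists K; split=> //; rewrite ltrBrDr.
have lamK : expR (- (a / 4)) < 1 - expR (b * (1 - K%:R)).
  rewrite ltrBrDr addrC -ltrBrDr -[ltRHS]lnK; last by rewrite posrE subr_gt0.
  rewrite ltr_expR.
  have := yK; rewrite /y ltr_pdivrMr// => h; lra.
have [w [wS well] trapw] := trap_exists muE K a1 a2 (filterI static ell).
have [wU _] := wS.
have clipE : clip_env c w = w by apply/funext => x; exact: clip_id.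
have w01 x : 0 <= w x <= 1 by have := well x; have := c0; lra.
have conf n := trap_confinement n p2 p1 K0 w01 trapw erefl.
have Clo : closed [set x : R | `|x| <= e].
  rewrite (_ : [set x | _] = `[- e, e]%classic); first exact: itv_closed.
  by apply/seteqP; split=> x; rewrite /= in_itv/= ler_norml.
have Cinf : ((a / 2)%:E < ereal_inf [set I x | x in [set x : R | (`|x| <= e)%R]])%E.
  apply: (@lt_le_trans _ _ a%:E); first by rewrite lte_fin; lra.
  by apply: le_ereal_inf_tmp => _ [x xe <-]; exact/ltW/eC.
have up := wU _ _ Clo Cinf.
pose g0 := 1 - expR (- (b * K%:R)).
have g00 : 0 < g0 by rewrite subr_gt0 expR_lt1 oppr_lt0 mulr_gt0// ltr0n.
have [n [[nU nK] [n0 ng]]] := filter_ex (filterI (filterI up (near_natr_gt (K%:R / e)))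
  (filterI (nbhs_infty_gt 0) (near_natr_gt (g0^-1 / (a / 4))))).
have n0' : 0 < n%:R :> R by rewrite ltr0n.
have : (1 - expR (b * (1 - K%:R))) ^+ n * g0 <= expR (- (a / 2 * n%:R)).
  apply: le_trans (conf n) _; apply: le_trans nU.
  rewrite /sev clipE; apply: ev_le => // x z _; rewrite !indicE ler_nat.
  have [|_] := boolP (_ \in [set z : int | `|z| <= K%:Z]); last by [].
  rewrite inE /= => h; rewrite mem_set// /speed_set /= normrM normfV.
  rewrite (gtr0_norm n0') ler_pdivrMr// mulrC.
  apply: le_trans (_ : K%:R <= _); last by rewrite -ler_pdivrMr// ltW.
  by rewrite -intr_norm -[K%:R]/(K%:Z%:~R) ler_int.
apply/negP; rewrite -ltNge.
have lo : expR (- (a / 4 * n%:R)) <= (1 - expR (b * (1 - K%:R))) ^+ n.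
  rewrite -mulNr expRM_natr; apply: lerXn2r; rewrite ?nnegrE ?expR_ge0//.
    by apply: ltW; apply: lt_trans lamK; exact: expR_gt0.
  exact: ltW.
apply: (@lt_le_trans _ _ (expR (- (a / 4 * n%:R)) * g0)); last by rewrite ler_pM2r.
have -> : expR (- (a / 2 * n%:R)) = expR (- (a / 4 * n%:R)) * expR (- (a / 4 * n%:R)).
  by rewrite -expRD; congr expR; field.
rewrite ltr_pM2l ?expR_gt0// expRN invf_plt ?posrE ?expR_gt0//.
apply: lt_le_trans (expR_ge1Dx _).
by move: ng; rewrite ltr_pdivrMr ?divr_gt0// mulrC; lra.
Qed.

Hypothesis Izero : I 0 = 0%E.

(** By ellipticity the straight path to the right has probability at least [c ^ n]. If [I 1] were
    infinite, monotonicity would make [I] infinite on all of [[1, oo)], and the upper bound at rate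
    [1 - ln c] would contradict this. *)
Lemma rate_one_fin : (I 1 < +oo)%E.
Proof.
rewrite ltNge; apply/negP => Ioo.
have [w [wU _]] := ae_prob_ex static.
have b0 : ((1 - ln c)%:E < ereal_inf [set I x | x in [set x : R | (1 <= x)%R]])%E.
  apply: (@lt_le_trans _ _ +oo%E); first exact: ltry.
  apply: le_ereal_inf_tmp => _ [x /= x1 <-]; apply: (le_trans Ioo).
  by apply: (rate_mono I0 Icvx Izero); rewrite ler01.
have [n [n0 nU]] := filter_ex (filterI (nbhs_infty_gt 0) (wU _ _ (@closed_ge R 1) b0)).
have n0' : 0 < n%:R :> R by rewrite ltr0n.
have := sev_elliptic w c0 c2 n 0 0; rewrite addn0 subr0 add0r => lo.
have : c ^+ n <= expR (- ((1 - ln c) * n%:R)).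
  apply: (le_trans lo); apply: le_trans nU; apply: sev_le => // x z _.
  rewrite !indicE ler_nat; have [|_] := boolP (_ \in [set n%:Z]); last by [].
  by rewrite inE /= => ->; rewrite mem_set// /speed_set /= -pmulrn divff// gt_eqF.
apply/negP; rewrite -ltNge expR_ln_exp// ltr_expR; lra.
Qed.

(** Speeds above 1 have probability zero, while a finite rate would force a positive lower bound. *)
Lemma rate_out x : 1 < x -> I x = +oo%E.
Proof.
move=> x1; apply/eqP; rewrite eq_le leey leNgt; apply/negP => Ifin.
have [w [_ wL]] := ae_prob_ex static.
have [b xb] : exists b : R, (I x < b%:E)%E.
  exists (fine (I x) + 1); have -> : I x = (fine (I x))%:E by rewrite fineK// ge0_fin_numE.
  by rewrite lte_fin/= ltrDl.
have [n [n0 nL]] := filter_ex (filterI (nbhs_infty_gt 0) (wL _ x b (@open_gt R 1) x1 xb)).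
have n0' : 0 < n%:R :> R by rewrite ltr0n.
move: nL; apply/negP; rewrite -ltNge.
apply: le_lt_trans (expR_gt0 _).
rewrite -[leRHS](ev_cst (fun=> clip_env c w) 0 n 0 0); apply: sev_le => // y z yz.
rewrite indicE memNset// /speed_set /= ltr_pdivlMr// mul1r -[n%:R]/(n%:Z%:~R) ltr_int.
by apply/negP; rewrite -leNgt; exact: walk_range_le.
Qed.

Lemma static_upper_bound (u a : R) : 0 <= u -> (a%:E < I u)%E ->
  {ae mu, forall w, \forall n \near \oo,
    sev c w n \1_[set z : int | u * n%:R <= z%:~R] 0 <= expR (- (a * n%:R))}.
Proof.
move=> u0 au; apply: filterS static => w [wU _].
have ainf : (a%:E < ereal_inf [set I x | x in [set x : R | (u <= x)%R]])%E.
  apply: lt_le_trans au _; apply: le_ereal_inf_tmp => _ [x /= ux <-].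
  by apply: (rate_mono I0 Icvx Izero); rewrite u0.
apply: filterS2 (nbhs_infty_gt 0) (wU _ _ (@closed_ge R u) ainf) => n n0.
have n0' : 0 < n%:R :> R by rewrite ltr0n.
congr (sev _ _ _ \1__ _ <= _); apply/seteqP.
by split=> z; rewrite /speed_set /= ler_pdivlMr.
Qed.

Lemma static_lower_bound (v a e : R) : (I v < a%:E)%E -> 0 < e ->
  {ae mu, forall w, \forall n \near \oo, expR (- (a * n%:R)) <=
    sev c w n \1_[set z : int | `|z%:~R - v * n%:R| <= e * n%:R] 0}.
Proof.
move=> va e0; apply: filterS static => w [_ wL].
have oB : open (ball v e) by exact: ball_open.
have Bv : ball v e v by exact: ballxx.
apply: filterS2 (nbhs_infty_gt 0) (wL _ _ _ oB Bv va) => n n0 h.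
have n0' : 0 < n%:R :> R by rewrite ltr0n.
apply: (le_trans h); apply: sev_le => // x z _; rewrite !indicE ler_nat.
set k := 0 + _ - _; have [|_] := boolP (k \in speed_set n _); last by [].
rewrite inE /speed_set /ball /= distrC => hk; rewrite mem_set//=.
rewrite -ler_pdivrMr// -[X in _ / X](gtr0_norm n0') -normfV -normrM mulrBl mulfK ?gt_eqF//.
exact: ltW.
Qed.

End rate_function.

(* Rational parameters, so that the exceptional null sets can be collected. *)
Definition right_bounds (R : realType) (I : R -> \bar R) (F : nat -> set int -> R) :=
  (forall v a : rat, 0 < ratr v :> R -> ((ratr a)%:E < I (ratr v))%E ->
    \forall n \near \oo,
      F n [set z : int | (ratr v : R) * n%:R <= z%:~R] <= expR (- (ratr a * n%:R))) /\
  (forall v a d : rat, 0 < ratr v :> R -> ratr v < 1 :> R ->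
    (I (ratr v) < (ratr a)%:E)%E -> 0 < ratr d :> R ->
    \forall n \near \oo, expR (- (ratr a * n%:R)) <=
      F n [set z : int | `|z%:~R - (ratr v : R) * n%:R| <= ratr d * n%:R]).

Section half_cooling.
Context (R : realType) (alpha : probability (measurableTypeR R) R).
Context (mu : probability (env R) R) (muN : probability (env_seq R) R).
Context (c : R) (I : R -> \bar R) (tau : nat -> nat).
Hypotheses (muE : is_product_law alpha mu) (muNE : is_product_law mu muN).
Hypotheses (c0 : 0 < c) (c2 : c <= 2^-1).
Hypothesis static : {ae mu, forall w, static_bounds c I w}.
Hypotheses (I0 : forall x, (0 <= I x)%E) (Icvx : econvex I).
Hypothesis Iclosed : forall a : R, closed [set x | (I x <= a%:E)%E].
Hypothesis Izero : I 0 = 0%E.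
Hypotheses (tau_cooling : cooling_map tau).
Hypothesis tau_cvg : (fun k => (tau k.+1 - tau k)%N) @ \oo --> \oo.

Lemma cooling_upper_bound (v a : R) : 0 < v -> (a%:E < I v)%E ->
  {ae muN, forall Om, \forall n \near \oo,
    cev c tau Om 0 n \1_[set z : int | v * n%:R <= z%:~R] 0 <= expR (- (a * n%:R))}.
Proof.
(* Beyond speed 1 the rate is infinite and no line argument applies, but the event is empty for
   [n > 0]. *)
move=> v0 av; have [v1|v1] := ltP 1 v.
  apply: aeW => Om; apply: filterS (nbhs_infty_gt 0) => n n0.
  have n0' : 0 < n%:R :> R by rewrite ltr0n.
  apply: le_trans (expR_ge0 _).
  rewrite -[leRHS](ev_cst (cool_env c tau Om) 0 n 0 0); apply: ev_le => [t x|y z yz].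
    exact: cool_env01.
  rewrite indicE memNset//=; apply/negP; rewrite -ltNge.
  apply: (@le_lt_trans _ _ n%:R); last by rewrite ltr_pMl.
  by rewrite -[n%:R]/(n%:Z%:~R) ler_int; exact: walk_range_le.
have Ione := rate_one_fin c0 c2 static I0 Icvx Izero.
have v01 : 0 < v <= 1 by rewrite v0.
have Iv : I v = (fine (I v))%:E.
  by apply: (rate_fin I0 Icvx Izero Ione); rewrite (ltW v0).
have afv : a < fine (I v) by rewrite -lte_fin -Iv.
(* The line has height [a'] at [v]. The distance [a' - a] is [2 * eps]: one [eps] for the static
   moment bound and one for the passage to the cooling walk. *)
pose a' := (a + fine (I v)) / 2.
have a'v : (a'%:E < I v)%E by rewrite Iv lte_fin /a'; lra.
have [s [r [s0 srE line]]] := rate_supporting_line I0 Icvx Iclosed Izero Ione v01 a'v.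
have r0 := rate_line_intercept_ge0 Izero line.
pose eps := (a' - a) / 2.
have eps0 : 0 < eps by rewrite /eps /a'; lra.
have [t t01 mom] := static_upper_moment muE c0 c2
  (static_upper_bound static I0 Icvx Izero) s0 r0 eps0 line.
have -> : a = s * v - (r + eps) - eps by rewrite opprD addrA srE /eps; field.
exact: (cooling_upper_ae v muE muNE c0 c2 tau_cooling tau_cvg s0 t01 eps0 mom).
Qed.

Lemma cooling_lower_bound (v a d : R) : 0 < v -> v < 1 -> (I v < a%:E)%E -> 0 < d ->
  {ae muN, forall Om, \forall n \near \oo, expR (- (a * n%:R)) <=
    cev c tau Om 0 n \1_[set z : int | `|z%:~R - v * n%:R| <= d * n%:R] 0}.
Proof.
move=> v0 v1 va d0.
have Iv : I v = (fine (I v))%:E.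
  by rewrite fineK// ge0_fin_numE//; apply: lt_trans va _; exact: ltry.
have fva : fine (I v) < a by rewrite -lte_fin -Iv.
have f0 : 0 <= fine (I v) by rewrite fine_ge0.
set y := fine (I v) in Iv fva f0.
(* One third each for the static lower bound, for its moment version, and for the passage to the
   cooling walk. *)
pose a1 := y + (a - y) / 3; pose a2 := y + 2 * (a - y) / 3; pose eps := (a - y) / 3.
have va1 : (I v < a1%:E)%E by rewrite Iv lte_fin /a1; lra.
have a10 : 0 <= a1 by rewrite /a1; lra.
have a12 : a1 < a2 by rewrite /a1 /a2; lra.
have eps0 : 0 < eps by rewrite /eps; lra.
have d20 : 0 < d / 2 by lra.
have [t [C [Y [t0 C0 Yd Yc Ym]]]] := static_lower_moment muE c0 c2 v0 v1 a10 a12 d20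
  (fun e e0 => static_lower_bound c0 c2 static va1 e0).
have C1 : 1 <= Num.max C 1 by rewrite le_max lexx orbT.
have Ym' T : (\int[mu]_w ((sev c w T \1_[set Y T] 0) `^ (- t))%:E <=
    (Num.max C 1 * expR (t * a2 * T%:R))%:E)%E.
  apply: (le_trans (Ym T)); rewrite lee_fin ler_wpM2r ?expR_ge0//.
  by rewrite le_max lexx.
have Yd' T : `|(Y T)%:~R - v * T%:R| <= d / 2 * T%:R + Num.max C 1.
  by apply: (le_trans (Yd T)); rewrite lerD2l le_max lexx.
have := cooling_lower_ae muE muNE c0 c2 tau_cooling t0 C1 Yc Ym' Yd' tau_cvg eps0 d20.
have -> : a2 + eps = a by rewrite /a2 /eps; field.
by have -> : 2 * (d / 2) = d by field.
Qed.

Lemma cooling_bounds_rat : {ae muN, forall Om,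
  right_bounds I (fun n A => cev c tau Om 0 n \1_A 0)}.
Proof.
apply: filterI.
  apply: ae_forall_count => v; apply: ae_forall_count => a.
  have [v0|v0] := ltP 0 (ratr v : R); last exact: aeW.
  have [av|av] := ltP (ratr a)%:E (I (ratr v)); last exact: aeW.
  by apply: filterS (cooling_upper_bound v0 av) => Om h _ _.
apply: ae_forall_count => v; apply: ae_forall_count => a; apply: ae_forall_count => d.
have [v0|v0] := ltP 0 (ratr v : R); last exact: aeW.
have [v1|v1] := ltP (ratr v : R) 1; last exact: aeW.
have [av|av] := ltP (I (ratr v)) (ratr a)%:E; last exact: aeW.
have [d0|d0] := ltP 0 (ratr d : R); last exact: aeW.
by apply: filterS (cooling_lower_bound v0 v1 av d0) => Om h _ _ _ _.
Qed.

End half_cooling.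

(** * Reflection and assembly *)

Lemma ex_ratr_between (R : realType) (x y : R) : x < y -> exists q : rat, x < ratr q < y.
Proof.
by move=> /(@rat_in_itvoo R)[q]; rewrite in_itv => h; exists q.
Qed.

Lemma ex_ratr_lt_ereal (R : realType) (a : R) (x : \bar R) : (a%:E < x)%E ->
  exists2 q : rat, a < ratr q & ((ratr q)%:E < x)%E.
Proof.
case: x => [y|_|//].
  by rewrite lte_fin => /ex_ratr_between[q /andP[aq qy]]; exists q.
have [|q /andP[aq _]] := @ex_ratr_between R a (a + 1); first by rewrite ltrDl.
by exists q => //; exact: ltry.
Qed.

Section one_sided.
Context (R : realType) (p : nat -> int -> R) (I : R -> \bar R).
Hypothesis p01 : forall t x, 0 <= p t x <= 1.
Hypotheses (I0 : forall x, (0 <= I x)%E) (Icvx : econvex I).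
Hypothesis Iclosed : forall a : R, closed [set x | (I x <= a%:E)%E].
Hypotheses (Izero : I 0 = 0%E) (Ione : (I 1 < +oo)%E).
Hypothesis Iout : forall x, 1 < x -> I x = +oo%E.
Hypothesis right : right_bounds I (fun n A => ev p 0 n \1_A 0).

Lemma ev_indic_mono n (A B : set int) : A `<=` B -> ev p 0 n \1_A 0 <= ev p 0 n \1_B 0.
Proof.
move=> AB; apply: ev_le => // x y _; rewrite !indicE ler_nat.
have [|_] := boolP (_ \in A); last by [].
by rewrite inE => /AB h; rewrite mem_set.
Qed.

(** The nonnegative part of [C] lies to the right of its least point, which is positive since
    [I 0 = 0 <= b]; a half-line from a rational slightly below that point covers it. The strict
    surplus [b < a] is left for adding the two sides. *)
Lemma one_sided_upper (C : set R) (b : R) : closed C -> 0 <= b ->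
  (forall x, C x -> 0 <= x -> (b%:E < I x)%E) ->
  exists2 a, b < a & \forall n \near \oo,
    ev p 0 n \1_(speed_set n C `&` [set z : int | 0 <= z]) 0 <= expR (- (a * n%:R)).
Proof.
move=> Ccl b0 Cb; pose S := C `&` [set x | 0 <= x].
have [[x Sx]|S0] := pselect (S !=set0); last first.
  exists (b + 1); first by rewrite ltrDl.
  apply: nearW => n; apply: le_trans (expR_ge0 _).
  rewrite -[leRHS](ev_cst p 0 n 0 0); apply: ev_le => // x y _.
  rewrite indicE memNset// => -[Cz z0]; apply: S0.
  by eexists; split; [exact: Cz|rewrite /= divr_ge0// ler0z].
have Slb : has_inf S by split; [exists x|exists 0 => y []].
have Sinf : S (inf S).
  split; last by apply: lb_le_inf => [|y []]//; exists x.
  apply: contrapT => nC; have : open (~` C) by rewrite openC.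
  move=> /(_ _ nC) /nbhs_ballP[e /= e0 eC].
  have [y Sy ye] := inf_adherent e0 Slb.
  apply: (eC y); last by case: Sy.
  have iy : inf S <= y by apply: ge_inf => //; case: Slb.
  by rewrite /ball/= ler0_norm; lra.
have [Ci i0] := Sinf.
have bi := Cb _ Ci i0.
have ipos : 0 < inf S.
  rewrite lt_neqAle i0 andbT; apply/negP => /eqP i00.
  by move: bi; rewrite -i00 Izero lte_fin ltNge b0.
have [y /andP[y0 yi] by_] := rate_gt_left Iclosed ipos bi.
have [v /andP[yv vi]] := ex_ratr_between yi.
have v0 : 0 < ratr v :> R by exact: lt_trans yv.
have bv : (b%:E < I (ratr v))%E.
  by apply: lt_le_trans by_ _; apply: (rate_mono I0 Icvx Izero); rewrite !ltW.
have [a ba av] := ex_ratr_lt_ereal bv.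
exists (ratr a) => //; have [rU _] := right.
apply: filterS2 (nbhs_infty_gt 0) (rU v a v0 av) => n n0 h.
apply: le_trans h; apply: ev_indic_mono => z [Cz z0] /=.
have n0' : 0 < n%:R :> R by rewrite ltr0n.
rewrite -ler_pdivlMr//; apply: (le_trans (ltW vi)); apply: ge_inf; first by case: Slb.
by split=> //=; rewrite divr_ge0// ler0z.
Qed.

(** A positive [x] is approximated from the left, where [I] is no larger, which also handles
    [x = 1]. At [x = 0] small positive speeds are cheap because convexity gives [I v <= v * I 1]. *)
Let near_point (x b e : R) : 0 <= x -> (I x < b%:E)%E -> 0 < e ->
  exists2 v : rat, 0 < (ratr v : R) < 1 & `|x - ratr v| < e /\ (I (ratr v) < b%:E)%E.
Proof.
rewrite le_eqVlt => /predU1P[<-|x0] xb e0.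
  have b0 : 0 < b by move: xb; rewrite Izero lte_fin.
  have i1 : I 1 = (fine (I 1))%:E by rewrite fineK// ge0_fin_numE.
  have i10 : 0 <= fine (I 1) by rewrite fine_ge0.
  set i := fine (I 1) in i1 i10.
  have [|v /andP[v0]] := @ex_ratr_between R 0 (Num.min 1 (Num.min e (b / (i + 1)))).
    by rewrite !lt_min ltr01 e0 divr_gt0//; lra.
  rewrite !lt_min => /and3P[v1 ve vb]; exists v; first by rewrite v0.
  split; first by rewrite sub0r normrN gtr0_norm.
  have v01 : 0 <= (ratr v : R) <= 1 by rewrite !ltW.
  have := Icvx 1 0 v01; rewrite mulr1 mulr0 addr0 Izero mule0 adde0 => /le_lt_trans; apply.
  rewrite i1 -EFinM lte_fin; move: vb; rewrite ltr_pdivlMr; last by lra.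
  by move=> h; lra.
have x1 : x <= 1 by rewrite leNgt; apply/negP => /Iout h; rewrite h in xb.
have [|v /andP[]] := @ex_ratr_between R (Num.max 0 (x - e)) x.
  by rewrite gt_max x0 ltrBlDr ltrDl.
rewrite gt_max => /andP[v0 vx] vx'; exists v; first by rewrite v0 (lt_le_trans vx').
split; first by rewrite gtr0_norm; lra.
by apply: le_lt_trans xb; apply: (rate_mono I0 Icvx Izero); rewrite !ltW.
Qed.

Lemma one_sided_lower (O : set R) (x b : R) : open O -> O x -> 0 <= x ->
  (I x < b%:E)%E ->
  \forall n \near \oo, expR (- (b * n%:R)) <= ev p 0 n \1_(speed_set n O) 0.
Proof.
move=> oO Ox x0 xb.
have /nbhs_ballP[e /= e0 eO] := open_nbhs_nbhs (conj oO Ox).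
have e20 : 0 < e / 2 by rewrite divr_gt0.
have [v /andP[v0 v1] [xv vb]] := near_point x0 xb e20.
have Iv : I (ratr v) = (fine (I (ratr v)))%:E.
  by rewrite fineK// ge0_fin_numE//; apply: lt_trans vb _; exact: ltry.
have fvb : fine (I (ratr v)) < b by rewrite -lte_fin -Iv.
have [a /andP[va ab]] := ex_ratr_between fvb.
have {}va : (I (ratr v) < (ratr a)%:E)%E by rewrite Iv lte_fin.
have [d /andP[d0 de]] := ex_ratr_between e20.
have [_ rL] := right.
apply: filterS2 (nbhs_infty_gt 0) (rL v a d v0 v1 va d0) => n n0 h.
have n0' : 0 < n%:R :> R by rewrite ltr0n.
apply: (@le_trans _ _ (expR (- (ratr a * n%:R)))).
  by rewrite ler_expR lerN2 ler_pM2r// ltW.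
apply: (le_trans h); apply: ev_indic_mono => z /= hz; apply: eO.
have {}hz : `|z%:~R / n%:R - ratr v| <= ratr d :> R.
  rewrite -(ler_pM2r n0'); apply: le_trans hz.
  by rewrite -[X in _ * X <= _](gtr0_norm n0') -normrM mulrBl divfK// gt_eqF.
rewrite /ball/=; apply: (@le_lt_trans _ _ (`|x - ratr v| + `|ratr v - z%:~R / n%:R|)).
  by rewrite (le_trans _ (ler_normD _ _))// addrA subrK.
by rewrite [X in _ + X]distrC; lra.
Qed.

End one_sided.

Lemma ev_reflect_indic (R : realType) (p : nat -> int -> R) n (A : set int) :
  ev (fun t y => 1 - p t (- y)) 0 n \1_[set z | A (- z)] 0 = ev p 0 n \1_A 0.
Proof.
have := ev_reflect p 0 n \1_A 0; rewrite oppr0 => ->.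
by congr (ev _ _ _ _ _); apply/funext => y; rewrite !indicE !in_setE.
Qed.

Lemma speed_set_opp (R : realType) n (C : set R) :
  speed_set n [set x | C (- x)] = [set z | speed_set n C (- z)].
Proof. by apply/seteqP; split=> z; rewrite /speed_set /= mulrNz mulNr. Qed.

Lemma closed_opp (R : realType) (C : set R) : closed C -> closed [set x | C (- x)].
Proof.
by move=> Ccl; apply: (closed_comp (f := fun x : R => - x)) Ccl => x _; exact: opp_continuous.
Qed.

Lemma open_opp (R : realType) (O : set R) : open O -> open [set x | O (- x)].
Proof.
by move=> oO; apply: (open_comp (f := fun x : R => - x)) oO => x _; exact: opp_continuous.
Qed.

Section two_sided.
Context (R : realType) (p : nat -> int -> R) (I : R -> \bar R).
Hypothesis p01 : forall t x, 0 <= p t x <= 1.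
Hypotheses (I0 : forall x, (0 <= I x)%E) (Icvx : econvex I).
Hypothesis Icpt : forall a : R, compact [set x | (I x <= a%:E)%E].
Hypothesis Izero : I 0 = 0%E.
Hypotheses (Ione : (I 1 < +oo)%E) (IN1 : (I (- 1) < +oo)%E).
Hypotheses (Iout : forall x, 1 < x -> I x = +oo%E).
Hypotheses (IoutN : forall x, 1 < x -> I (- x) = +oo%E).
Hypothesis right : right_bounds I (fun n A => ev p 0 n \1_A 0).
Hypothesis left : right_bounds (fun x => I (- x))
  (fun n A => ev (fun t y => 1 - p t (- y)) 0 n \1_A 0).

Lemma econvex_opp : econvex (fun x => I (- x)).
Proof. by move=> x y t t01; rewrite opprD -!mulrN; exact: Icvx. Qed.

Lemma walk_LDP_of_right_bounds : walk_LDP p I.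
Proof.
have Icl := closed_sublevel Icpt.
have p01' t x : 0 <= 1 - p t (- x) <= 1 by have := p01 t (- x); lra.
have I0' x : (0 <= I (- x))%E by [].
have Icl' a := closed_opp (Icl a).
have Izero' : I (- 0) = 0%E by rewrite oppr0.
apply: walk_LDP_of_near => //; first by exists 0; rewrite Izero.
- move=> C b Ccl b0 Cb.
  have [a1 ba1 h1] := one_sided_upper p01 I0 Icvx Icl Izero right Ccl b0
    (fun x Cx _ => Cb x Cx).
  have [a2 ba2 h2] := one_sided_upper p01' I0' econvex_opp Icl' Izero' left
    (closed_opp Ccl) b0 (fun x Cx _ => Cb _ Cx).
  (* The strict gap [a - b] absorbs the factor 2 from adding the two half-lines. *)
  pose a := Num.min a1 a2; have ba : b < a by rewrite lt_min ba1.
  have ab0 : 0 < a - b by rewrite subr_gt0.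
  apply: filterS2 (near_natr_gt (1 / (a - b))) (filterI h1 h2) => n nab [n1 n2].
  apply: (@le_trans _ _ (expR (- (a * n%:R)) + expR (- (a * n%:R)))); last first.
    rewrite (_ : - (b * n%:R) = (a - b) * n%:R + - (a * n%:R)); last by ring.
    have e2 : 2 <= expR ((a - b) * n%:R).
      apply: le_trans (expR_ge1Dx _); move: nab; rewrite ltr_pdivrMr// mulrC; lra.
    by rewrite expRD; have := ler_wpM2r (expR_ge0 (- (a * n%:R))) e2; lra.
  apply: (@le_trans _ _ (ev p 0 n \1_(speed_set n C `&` [set z : int | 0 <= z]) 0 +
      ev p 0 n \1_(speed_set n C `&` [set z : int | z <= 0]) 0)).
    rewrite -evD; apply: ev_le => // x y _; set z := 0 + _ - _.
    rewrite !indicE !in_setI -natrD ler_nat.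
    have -> : (z \in [set z : int | 0 <= z]) = (0 <= z) by apply/idP/idP; rewrite inE.
    have -> : (z \in [set z : int | z <= 0]) = (z <= 0) by apply/idP/idP; rewrite inE.
    by case: (_ \in _) => //=; case: (lerP 0 z) => // /ltW ->.
  have le_a a' : a <= a' -> expR (- (a' * n%:R)) <= expR (- (a * n%:R)) :> R.
    by move=> h; rewrite ler_expR lerN2 ler_wpM2r.
  apply: lerD; first by apply: (le_trans n1); apply: le_a; rewrite ge_min lexx.
  apply: le_trans (_ : _ <= expR (- (a2 * n%:R))) _; last first.
    by apply: le_a; rewrite ge_min lexx orbT.
  rewrite -ev_reflect_indic; move: n2; congr (ev _ _ _ \1__ _ <= _).
  by rewrite speed_set_opp; apply/seteqP; split=> z /=; rewrite oppr_le0.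
- move=> O x b oO Ox xb; have [x0|x0] := leP 0 x.
    exact: (one_sided_lower p01 I0 Icvx Izero Ione Iout right oO Ox x0 xb).
  have Ox' : [set x | O (- x)] (- x) by rewrite /= opprK.
  have x0' : 0 <= - x by rewrite oppr_ge0 ltW.
  have xb' : (I (- - x) < b%:E)%E by rewrite opprK.
  have := one_sided_lower p01' I0' econvex_opp Izero' IN1 IoutN left (open_opp oO) Ox' x0' xb'.
  by apply: filterS => n; rewrite speed_set_opp ev_reflect_indic.
Qed.

End two_sided.

Section pushforward.
Context (R : realType) d (S : measurableType d) (P : probability S R).

Lemma ae_pushforward d' (T : measurableType d') (f : {mfun S >-> T}) (A : set T) :
  {ae distribution P f, forall y, A y} -> {ae P, forall x, A (f x)}.
Proof.
move=> [N [mN N0 AN]]; exists (f @^-1` N); split.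
- by rewrite -[X in measurable X]setTI; exact: measurable_funPT.
- exact: N0.
- by move=> x; exact: AN.
Qed.

(** Since [f] is its own inverse, the image of an exceptional null set is its preimage, hence
    measurable and again null for the pushforward. *)
Lemma ae_pushforward_involution (f : {mfun S >-> S}) (A : set S) : involutive f ->
  {ae P, forall x, A (f x)} -> {ae distribution P f, forall y, A y}.
Proof.
move=> fK [N [mN N0 AN]].
exists (f @^-1` N); split.
- by rewrite -[X in measurable X]setTI; exact: measurable_funPT.
- transitivity (P N); last exact: N0.
  by congr (P _); apply/seteqP; split=> x /=; rewrite fK.
- by move=> y nAy; apply: AN; rewrite /= fK.
Qed.

End pushforward.

Section reflection.
Context (R : realType).

Definition reflect_prob (u : measurableTypeR R) : measurableTypeR R := 1 - u.

Definition reflect_env (w : env R) : env R := fun x => 1 - w (- x).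

Definition reflect_seq (Om : env_seq R) : env_seq R := fun k => reflect_env (Om k).

Lemma reflect_envK : involutive reflect_env.
Proof. by move=> w; apply/funext => x; rewrite /reflect_env opprK subKr. Qed.

Lemma measurable_reflect_prob : measurable_fun setT reflect_prob.
Proof. by apply: measurable_funB. Qed.

Lemma measurable_reflect_env : measurable_fun setT reflect_env.
Proof.
apply: measurable_to_fspace => x.
exact: (measurableT_comp measurable_reflect_prob
  (@measurable_coord int _ (measurableTypeR R) (- x))).
Qed.

Lemma measurable_reflect_seq : measurable_fun setT reflect_seq.
Proof.
apply: measurable_to_fspace => k.
exact: (measurableT_comp measurable_reflect_env (@measurable_coord nat _ (env R) k)).
Qed.

HB.instance Definition _ := isMeasurableFun.Build _ _ (measurableTypeR R) (measurableTypeR R)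
  reflect_prob measurable_reflect_prob.
HB.instance Definition _ := isMeasurableFun.Build _ _ (env R) (env R)
  reflect_env measurable_reflect_env.
HB.instance Definition _ := isMeasurableFun.Build _ _ (env_seq R) (env_seq R)
  reflect_seq measurable_reflect_seq.

Lemma reflect_env_law (alpha : probability (measurableTypeR R) R)
    (mu : probability (env R) R) : is_product_law alpha mu ->
  is_product_law (distribution alpha reflect_prob) (distribution mu reflect_env).
Proof.
move=> muE.
apply: (product_law_map (f := reflect_prob) (s := fun y => - y) (s' := fun y => - y) muE) => //.
exact: opprK.
Qed.

Lemma reflect_seq_law (mu : probability (env R) R) (muN : probability (env_seq R) R) :
  is_product_law mu muN ->
  is_product_law (distribution mu reflect_env) (distribution muN reflect_seq).
Proof.
move=> muNE; apply: (product_law_map (f := reflect_env) (s := id) (s' := id) muNE) => //.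
Qed.

Lemma clip_reflect_env (c : R) (w : env R) : c <= 2^-1 ->
  clip_env c (reflect_env w) = fun y => 1 - clip_env c w (- y).
Proof. by move=> c2; apply/funext => y; rewrite /clip_env clip_reflect. Qed.

Lemma static_bounds_reflect (c : R) (I : R -> \bar R) (w : env R) : c <= 2^-1 ->
  static_bounds c I w -> static_bounds c (fun x => I (- x)) (reflect_env w).
Proof.
move=> c2 [wU wL].
have sevE n (C : set R) : sev c (reflect_env w) n \1_(speed_set n C) 0 =
    sev c w n \1_(speed_set n [set x | C (- x)]) 0.
  rewrite /sev clip_reflect_env// speed_set_opp -[RHS]ev_reflect_indic.
  by congr (ev _ _ _ \1__ _); apply/seteqP; split=> z /=; rewrite opprK.
split=> [C b Ccl bC|O x b oO Ox xb].
  have bC' : (b%:E < ereal_inf [set I x | x in [set x : R | C (- x)%R]])%E.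
    apply: lt_le_trans bC _; apply: le_ereal_inf_tmp => _ [x Cx <-].
    by apply: ereal_inf_lbound; exists (- x); rewrite ?opprK.
  by apply: filterS (wU _ b (closed_opp Ccl) bC') => n; rewrite sevE.
have Ox' : [set x | O (- x)] (- x) by rewrite /= opprK.
by apply: filterS (wL _ _ b (open_opp oO) Ox' xb) => n; rewrite sevE.
Qed.

End reflection.

Theorem theorem2 (R : realType)
  (alpha : probability (measurableTypeR R) R)
  (mu : probability (env R) R)
  (muN : probability (env_seq R) R)
  (tau : nat -> nat)
  (I : R -> \bar R)
  (alpha_basic : basic alpha)
  (muE : is_product_law alpha mu)
  (muNE : is_product_law mu muN)
  (tau_cooling : cooling_map tau)
  (tau_cvg : (fun k => (tau k.+1 - tau k)%N) @ \oo --> \oo)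
  (IE : static_rate_function mu I) :
  {ae muN, forall Om : env_seq R, walk_LDP (cooling_prob Om tau) I}.
Proof.
have [c [p [c0 c2 alphac p12 [a1 a2]]]] := basic_constants alpha_basic.
have elliptic := elliptic_ae muE alphac.
have [Icvx Ildp] := IE.
have w01 (w : env R) : (forall x, c <= w x <= 1 - c) -> forall (t : nat) x, 0 <= w x <= 1.
  by move=> well _ x; have := well x; have := c0; lra.
(* [I] is deterministic, so its nonnegativity and compact level sets can be read off from a single
   good environment. *)
have [w [wI well]] := ae_prob_ex (filterI Ildp elliptic).
have [I0 Icpt _ _] := walk_LDP_near (w01 w well) wI.
have Icl := closed_sublevel Icpt.
have static : {ae mu, forall w, static_bounds c I w}.
  apply: filterS2 Ildp elliptic => {wI well}w wI well.
  have [_ _ up lo] := walk_LDP_near (w01 w well) wI.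
  have clipE : clip_env c w = w by apply/funext => x; exact: clip_id.
  by rewrite /static_bounds /sev clipE.
have Izero := rate_zero muE c0 static I0 Icl p12 a1 a2 elliptic.
have static' : {ae distribution mu (@reflect_env R),
    forall w, static_bounds c (fun x => I (- x)) w}.
  apply: ae_pushforward_involution; first exact: reflect_envK.
  by apply: filterS static => v; exact: static_bounds_reflect.
have I0' (x : R) : (0 <= I (- x)%R)%E by [].
have Icvx' := econvex_opp Icvx.
have Icl' a := closed_opp (Icl a).
have Izero' : I (- 0)%R = 0%E by rewrite oppr0.
have right := cooling_bounds_rat muE muNE c0 c2 static I0 Icvx Icl Izero tau_cooling tau_cvg.
(* The right-hand bounds rest on the static bounds and [I 0 = 0] rather than on [basic]. They
   therefore apply verbatim to the reflected product laws with rate [I (- x)], and are pulled back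
   along [reflect_seq]. *)
have left := ae_pushforward (cooling_bounds_rat (reflect_env_law muE) (reflect_seq_law muNE)
  c0 c2 static' I0' Icvx' Icl' Izero' tau_cooling tau_cvg).
apply: filterS3 (elliptic_seq_ae muE muNE alphac) right left => Om Omell Omr Oml.
have -> : cooling_prob Om tau = cool_env c tau Om.
  by apply/funext => n; apply/funext => x; rewrite /cool_env /clip_env clip_id.
apply: walk_LDP_of_right_bounds => //.
- by move=> t x; exact: cool_env01.
- exact: (rate_one_fin c0 c2 static I0 Icvx Izero).
- exact: (rate_one_fin c0 c2 static' I0' Icvx' Izero').
- by move=> x; exact: (rate_out c0 c2 static I0).
- by move=> x; exact: (rate_out c0 c2 static' I0').
have reflE : cool_env c tau (reflect_seq Om) = fun t y => 1 - cool_env c tau Om t (- y).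
  by apply/funext => t; exact: clip_reflect_env.
by move: Oml; rewrite /cev reflE.
Qed.
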